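(* Let $\mathbb{H}$ be the three-dimensional Heisenberg group, equipped with a left-invariant measure $\mu$. Then, for all $k\in\mathbb{N}$ and $m\in\{1,2\}$, there exist polynomials $Q^k_m$ with real coefficients and in $5$ variables, such that for any $C^2$ non-characteristic embedded submanifold $S\subset\mathbb{H}$ (without boundary) with codimension $m\in\{1,2\}$ it holds $$\mathrm{div}^k_{\mu/\delta^{m-1}}(\nabla\delta)=Q^k_m\left(F_1,F_2,F_3,F_4,\tfrac{m-1}{\delta}\right)\qquad\text{on }U\setminus S,$$ where $U$ is the tubular neighbourhood of $S$ and, for any given left-invariant and oriented orthonormal frame $\{X_1,X_2\}$, and letting $X_0$ be the Reeb vector field, the functions $F_i:U\setminus S\to\mathbb{R}$ are $$F_1:=X_1X_1\delta+X_2X_2\delta,\qquad F_2:=-(X_2\delta)(X_1X_0\delta)+(X_1\delta)(X_2X_0\delta),\qquad F_3:=X_0\delta,\qquad F_4:=X_0X_0\delta.$$ (The functions $F_1,\dots,F_4$ do not depend on the choice of the frame.) Furthermore, if $S$ is a two-sided surface (so $m=1$), then $$\mathrm{div}^k_{\mu}(\nabla\delta_{\mathrm{sign}})=Q^k_1\left(F_1,F_2,F_3,F_4,0\right)\qquad\text{on the whole }U,$$ where now $F_1,\dots,F_4:U\to\mathbb{R}$ are given by the same formulas with $\delta$ replaced by $\delta_{\mathrm{sign}}$.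
   Context: Heisenberg group $\mathbb{H}$: $\mathbb{R}^3$ with group law $(x,y,z)\star(x',y',z')=(x+x',y+y',z+z'+\frac12(xy'-x'y))$ and the left-invariant sub-Riemannian structure for which $\bar X_1=\partial_x-\frac y2\partial_z$, $\bar X_2=\partial_y+\frac x2\partial_z$ are orthonormal and generate the distribution $\mathcal{D}$; the Reeb vector field is $X_0=\partial_z=[\bar X_1,\bar X_2]$. A left-invariant oriented orthonormal frame is $X_i=\sum_{j=1}^2M_{ij}\bar X_j$ with $M\in\mathrm{SO}(2)$ constant. Horizontal curves $\gamma:[0,1]\to\mathbb{H}$ are absolutely continuous with $\dot\gamma_t=\sum_{i=1}^2 u_i(t)X_i(\gamma_t)$ a.e., $u\in L^\infty$; $\ell(\gamma)=\int_0^1|u(t)|\,dt$; $\mathsf{d}(p,q)$ is the infimum of lengths of horizontal curves joining $p$ and $q$. $\nabla a=\sum_{i=1}^2(X_ia)X_i$ is the horizontal gradient. $H(\lambda)=\frac12\sum_{i=1}^2\langle\lambda,X_i\rangle^2$ on $T^*\mathbb{H}$, $e^{t\vec H}$ is its Hamiltonian flow, $\pi$ the projection of $T^*\mathbb{H}$. For an embedded submanifold $S$: $AS=\{\lambda\in T^*\mathbb{H}\mid \pi(\lambda)\in S,\ \langle\lambda,T_{\pi(\lambda)}S\rangle=0\}$; $E:AS\to\mathbb{H}$, $E(\lambda)=\pi\circ e^{\vec H}(\lambda)$; $\delta(p)=\inf\{\mathsf{d}(p,q)\mid q\in S\}$. $S$ is non-characteristic if $\mathcal{D}_q+T_qS=T_q\mathbb{H}$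 for all $q\in S$. A minimizing geodesic from $S$ is a constant-speed horizontal curve $\gamma:[0,1]\to\mathbb{H}$ with $\gamma_0\in S$, $\gamma_1\notin S$, $\ell(\gamma)=\delta(\gamma_1)$. Tubular neighbourhood $U$ of a $C^2$ non-characteristic $S$: $U=E(V)$ with $V=\{\lambda\in AS\mid\sqrt{2H(\lambda)}<\varepsilon(\pi(\lambda))\}$, where $\varepsilon:S\to\mathbb{R}_{>0}$ is a continuous function such that (such $\varepsilon$ exists): $E:V\to U$ is a $C^1$ diffeomorphism; for every $\lambda\in V$ with $E(\lambda)\notin S$, $t\mapsto E(t\lambda)$ is the unique minimizing geodesic from $S$ to $E(\lambda)$, so $\delta\circ E=\sqrt{2H}$ on $V$; $\delta\in C^2(U\setminus S)$ with $\|\nabla\delta\|=1$ there; $\delta^2\in C^2(U)$; and for all smooth (or real-analytic) vector fields $X,Y$ the functions $\delta,X\delta,YX\delta$ are smooth (or real-analytic) in $t\in(0,1]$ along minimizing geodesics $\gamma$ from $S$ with $\gamma((0,1])\subset U\setminus S$. Two-sided surface: $S$ has codimension one and admits a continuous, never-vanishing vector field $N$ along $S$, transverse to $S$. With $A^{\pm}S=\{\lambda\in AS\mid\pm\langle\lambda,N\rangle>0\}$, the signed distance $\delta_{\mathrm{sign}}:U\to\mathbb{R}$ equals $\delta$ on $E(A^+S\cap V)$, $-\delta$ on $E(A^-S\cap V)$ and $0$ on $S$; it is of class $C^2$ on $U$. Iterated divergences: for a positive density $\omega$ and a vector field $X$, $\mathrm{div}^j_\omega(X)$ is the function such that $\mathscr{L}^j_X\omega=\mathrm{div}^j_\omega(X)\,\omega$,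 provided the Lie derivatives exist. Thus $\mathrm{div}^0_\omega(X)=1$, $\mathrm{div}^1_\omega(X)$ is the usual divergence, and $\mathrm{div}^{j+1}_\omega(X)=\mathrm{div}_\omega(X)\,\mathrm{div}^j_\omega(X)+X(\mathrm{div}^j_\omega(X))$ (derivative along integral curves of $X$). $\mathbb{N}$ includes $0$. *)

(* Defs.v *)
From HB Require Import structures.
From mathcomp Require Import all_boot all_order all_algebra.
From mathcomp Require Import all_classical all_reals all_analysis.
From mathcomp Require mpoly.
Set Implicit Arguments.
Unset Strict Implicit.
Unset Printing Implicit Defensive.
Import Order.TTheory GRing.Theory Num.Theory.
Import numFieldNormedType.Exports.
Local Open Scope classical_set_scope.
Local Open Scope ring_scope.

(* Meant for open A.  In finite dimension this is the usual class C^k: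
   differentiable, with all directional derivatives of class C^(k-1). *)
Fixpoint Ck_on (R : realType) (V W : normedModType R) (k : nat)
    (A : set V) (f : V -> W) : Prop :=
  match k with
  | 0%N => forall x, A x -> {for x, continuous f}
  | k'.+1 => (forall x, A x -> differentiable f x) /\
             (forall v, Ck_on k' A ('D_v f))
  end.

Definition smooth_on (R : realType) (V W : normedModType R)
    (A : set V) (f : V -> W) : Prop :=
  forall k, Ck_on k A f.

(* Regularity on a subset that need not be open (an interval with an endpoint,
   a submanifold of the ambient space): f extends locally, around each point of
   A, to a map of that regularity on an open set. *)
Definition locally_extends (R : realType) (V W : normedModType R)
    (P : set V -> (V -> W) -> Prop) (A : set V) (f : V -> W) : Prop :=
  forall x, A x -> exists O g,
    [/\ open O, O x, P O g & forall y, A y -> O y -> g y = f y].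

Definition Ck_diffeo (R : realType) (V W : normedModType R) (k : nat)
    (A : set V) (B : set W) (f : V -> W) : Prop :=
  [/\ f @` A = B,
      locally_extends (Ck_on k) A f &
      exists2 g : W -> V, locally_extends (Ck_on k) B g &
                          forall x, A x -> g (f x) = x].

Definition analytic1_on (R : realType) (A : set R) (f : R -> R) : Prop :=
  forall s, A s -> exists (a : nat -> R) (r : R), 0 < r /\
    forall t, A t -> `|t - s| < r ->
      series (fun n => a n * (t - s) ^+ n) @ \oo --> f t.

Notation heis R := ('rV[R]_3).
Notation coheis R := ('rV[R]_3 * 'rV[R]_3)%type.

Definition vec3 (R : realType) (x y z : R) : heis R :=
  \row_i nth 0 [:: x; y; z] i.
Definition xc (R : realType) (p : heis R) : R := p 0 (@Ordinal 3 0 isT).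
Definition yc (R : realType) (p : heis R) : R := p 0 (@Ordinal 3 1 isT).
Definition zc (R : realType) (p : heis R) : R := p 0 (@Ordinal 3 2 isT).

(* Real-analyticity in three variables: sum of an absolutely convergent
   triple power series around each point. *)
Definition analytic3 (R : realType) (f : heis R -> R) : Prop :=
  forall p, exists (a : nat -> nat -> nat -> R) (r : R), 0 < r /\
    forall q, `|q - p| < r ->
      let c i j k := a i j k * xc (q - p) ^+ i * yc (q - p) ^+ j
                             * zc (q - p) ^+ k in
      cvgn (fun n => \sum_(i < n) \sum_(j < n) \sum_(k < n) `|c i j k|) /\
      (fun n => \sum_(i < n) \sum_(j < n) \sum_(k < n) c i j k) @ \oo --> f q.

Definition hmul (R : realType) (p q : heis R) : heis R :=
  vec3 (xc p + xc q) (yc p + yc q)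
       (zc p + zc q + 2^-1 * (xc p * yc q - xc q * yc p)).

(* Tangent spaces are identified with R^3 by the global coordinates. *)
Definition Xbar (R : realType) (i : 'I_2) (p : heis R) : heis R :=
  if i == 0 then vec3 1 0 (- (yc p / 2)) else vec3 0 1 (xc p / 2).

Definition reeb (R : realType) (p : heis R) : heis R := vec3 0 0 1.

Definition SO2 (R : realType) (M : 'M[R]_2) : Prop :=
  M *m M^T = 1%:M /\ \det M = 1.

Definition frame (R : realType) (M : 'M[R]_2) (i : 'I_2) (p : heis R) : heis R :=
  \sum_j M i j *: Xbar j p.

Definition vact (R : realType) (X : heis R -> heis R) (f : heis R -> R) :
    heis R -> R :=
  fun p => 'D_(X p) f p.

(* Neither the horizontal gradient nor the Hamiltonian below depends on the
   oriented orthonormal frame, so they are written with Xbar. *)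
Definition hgrad (R : realType) (a : heis R -> R) (p : heis R) : heis R :=
  \sum_i vact (Xbar i) a p *: Xbar i p.

Definition hgrad_norm (R : realType) (a : heis R -> R) (p : heis R) : R :=
  Num.sqrt (\sum_i vact (Xbar i) a p ^+ 2).

Definition abs_continuous01 (R : realType) (g : R -> heis R) : Prop :=
  forall e : R, 0 < e -> exists2 d : R, 0 < d &
    forall (n : nat) (a b : nat -> R),
      (forall i, (i < n)%N -> 0 <= a i /\ a i <= b i /\ b i <= 1) ->
      (forall i, (i.+1 < n)%N -> b i <= a i.+1) ->
      \sum_(i < n) (b i - a i) < d ->
      \sum_(i < n) `|g (b i) - g (a i)| < e.

Definition enorm2 (R : realType) (u : 'rV[R]_2) : R :=
  Num.sqrt (\sum_i u 0 i ^+ 2).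

Definition horizontal_with (R : realType) (g : R -> heis R) (u : R -> 'rV[R]_2) :
    Prop :=
  [/\ abs_continuous01 g,
      forall i, measurable_fun (`[0, 1] : set R) (fun t => u t 0 i : R),
      exists C : R, {ae lebesgue_measure,
        forall t : R, t \in `]0, 1[ -> enorm2 (u t) <= C} &
      {ae lebesgue_measure, forall t : R, t \in `]0, 1[ ->
        is_derive t 1 g (\sum_i u t 0 i *: Xbar i (g t))}].

Definition control_length (R : realType) (u : R -> 'rV[R]_2) : R :=
  \int[lebesgue_measure]_(t in `[0, 1]) enorm2 (u t).

(* The sets below are nonempty (any two points are joined by a horizontal
   curve) and bounded below by 0, so the real-valued inf is the infimum. *)
Definition ccdist (R : realType) (p q : heis R) : R :=
  inf [set l | exists (g : R -> heis R) (u : R -> 'rV[R]_2),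
    [/\ horizontal_with g u, g 0 = p, g 1 = q & l = control_length u]].

Definition sdist (R : realType) (S : set (heis R)) (p : heis R) : R :=
  inf [set ccdist p q | q in S].

Definition min_geodesic (R : realType) (S : set (heis R)) (g : R -> heis R) :
    Prop :=
  exists u : R -> 'rV[R]_2,
    [/\ horizontal_with g u,
        exists c : R, {ae lebesgue_measure,
          forall t : R, t \in `]0, 1[ -> enorm2 (u t) = c},
        S (g 0), ~ S (g 1) &
        control_length u = sdist S (g 1)].

Definition pairing (R : realType) (eta v : heis R) : R :=
  \sum_i eta 0 i * v 0 i.

Definition ham (R : realType) (l : coheis R) : R :=
  2^-1 * \sum_i pairing l.2 (Xbar i l.1) ^+ 2.

Definition ham_vec (R : realType) (l : coheis R) : coheis R :=
  (\row_i 'D_((0, delta_mx 0 i) : coheis R) (@ham R) l,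
   - \row_i 'D_((delta_mx 0 i, 0) : coheis R) (@ham R) l).

(* The Hamiltonian vector field is complete and smooth: exactly one value
   satisfies the specification. *)
Definition ham_flow (R : realType) (t : R) (l : coheis R) : coheis R :=
  get [set l' | exists c : R -> coheis R,
    [/\ c 0 = l, forall s : R, is_derive s 1 c (ham_vec (c s)) & c t = l']].

Definition hexp (R : realType) (l : coheis R) : heis R := (ham_flow 1 l).1.

Definition cscale (R : realType) (t : R) (l : coheis R) : coheis R :=
  (l.1, t *: l.2).

(* C^2 slice charts: in the chart, S is given by the vanishing of the first m
   coordinates. *)
Definition C2_submanifold (R : realType) (m : nat) (S : set (heis R)) : Prop :=
  forall p, S p -> exists (O : set (heis R)) (phi : heis R -> heis R),
    [/\ open O, O p, open (phi @` O), Ck_diffeo 2 O (phi @` O) phi &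
        forall q, O q -> (S q <-> forall i : 'I_3, (i < m)%N -> phi q 0 i = 0)].

Definition tangent (R : realType) (S : set (heis R)) (p v : heis R) : Prop :=
  exists c : R -> heis R,
    [/\ c 0 = p, is_derive (0 : R) 1 c v & \forall t \near (0 : R), S (c t)].

Definition non_characteristic (R : realType) (S : set (heis R)) : Prop :=
  forall q, S q -> forall v : heis R, exists (a : 'rV[R]_2) (w : heis R),
    tangent S q w /\ v = \sum_i a 0 i *: Xbar i q + w.

Definition annihilator (R : realType) (S : set (heis R)) : set (coheis R) :=
  [set l | S l.1 /\ forall v, tangent S l.1 v -> pairing l.2 v = 0].

Definition tubV (R : realType) (S : set (heis R)) (eps : heis R -> R) :
    set (coheis R) :=
  [set l | annihilator S l /\ Num.sqrt (2 * ham l) < eps l.1].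

Definition tubU (R : realType) (S : set (heis R)) (eps : heis R -> R) :
    set (heis R) :=
  @hexp R @` tubV S eps.

Definition tubular (R : realType) (S : set (heis R)) (eps : heis R -> R) : Prop :=
  let U := tubU S eps in
  let V := tubV S eps in
  let delta := sdist S in
  {within S, continuous eps} /\
  (forall p, S p -> 0 < eps p) /\
  open U /\ Ck_diffeo 1 V U (@hexp R) /\
  (forall l, V l -> ~ S (hexp l) ->
    let g := fun t : R => hexp (cscale t l) in
    [/\ min_geodesic S g, g 1 = hexp l &
        forall g', min_geodesic S g' -> g' 1 = hexp l ->
          forall t, 0 <= t <= 1 -> g' t = g t]) /\
  (forall l, V l -> delta (hexp l) = Num.sqrt (2 * ham l)) /\
  Ck_on 2 (U `\` S) delta /\
  (forall p, (U `\` S) p -> hgrad_norm delta p = 1) /\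
  Ck_on 2 U (fun p => delta p ^+ 2) /\
  (forall X Y : heis R -> heis R, smooth_on setT X -> smooth_on setT Y ->
    forall g, min_geodesic S g ->
      (forall t, 0 < t <= 1 -> (U `\` S) (g t)) ->
      forall f, f = delta \/ f = vact X delta \/ f = vact Y (vact X delta) ->
        locally_extends (@smooth_on R R R) `]0, 1] (f \o g)) /\
  (forall X Y : heis R -> heis R,
    (forall i, analytic3 (fun p => X p 0 i)) ->
    (forall i, analytic3 (fun p => Y p 0 i)) ->
    forall g, min_geodesic S g ->
      (forall t, 0 < t <= 1 -> (U `\` S) (g t)) ->
      forall f, f = delta \/ f = vact X delta \/ f = vact Y (vact X delta) ->
        analytic1_on `]0, 1] (f \o g)).

Definition two_sided_by (R : realType) (S : set (heis R)) (N : heis R -> heis R) :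
    Prop :=
  {within S, continuous N} /\
  forall p, S p -> N p <> 0 /\ ~ tangent S p (N p).

Definition signed_dist (R : realType) (S : set (heis R)) (eps : heis R -> R)
    (N : heis R -> heis R) (p : heis R) : R :=
  if p \in @hexp R @` [set l | tubV S eps l /\ 0 < pairing l.2 (N l.1)]
  then sdist S p
  else if p \in @hexp R @` [set l | tubV S eps l /\ pairing l.2 (N l.1) < 0]
  then - sdist S p
  else 0.

(* A density is represented by its coefficient rho with respect to the density
   |dx dy dz|. *)
Definition pullback (R : realType) (phi : heis R -> heis R) (rho : heis R -> R) :
    heis R -> R :=
  fun p => rho (phi p) * `|\det (jacobian phi p)|.

Definition left_invariant (R : realType) (rho : heis R -> R) : Prop :=
  forall g, pullback (hmul g) rho =1 rho.

Definition local_flow (R : realType) (A : set (heis R)) (X : heis R -> heis R)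
    (p : heis R) (phi : R -> heis R -> heis R) : Prop :=
  exists (W : set (heis R)) (r : R),
    [/\ open W, W p, 0 < r &
     forall q, W q -> phi 0 q = q /\
       forall t, `|t| < r ->
         [/\ A (phi t q), differentiable (phi t) q &
             is_derive t 1 (phi ^~ q) (X (phi t q))]].

(* On the open set A, the density rho' is the Lie derivative of rho along X;
   the local flow is unique when X is C^1 on A. *)
Definition is_lie_derivative (R : realType) (A : set (heis R))
    (X : heis R -> heis R) (rho rho' : heis R -> R) : Prop :=
  forall p, A p -> exists2 phi, local_flow A X p phi &
    is_derive (0 : R) 1 (fun t : R => pullback (phi t) rho p) (rho' p).

Fixpoint is_iter_lie (R : realType) (A : set (heis R)) (X : heis R -> heis R)
    (k : nat) (rho rho' : heis R -> R) : Prop :=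
  match k with
  | 0%N => forall p, A p -> rho' p = rho p
  | k'.+1 => exists2 sigma, is_iter_lie A X k' rho sigma &
                            is_lie_derivative A X sigma rho'
  end.

(* The k-th Lie derivative of rho along X exists on A and
   div^k_rho(X) = D there. *)
Definition is_iter_div (R : realType) (A : set (heis R)) (rho : heis R -> R)
    (X : heis R -> heis R) (k : nat) (D : heis R -> R) : Prop :=
  is_iter_lie A X k rho (fun p => D p * rho p).

(* F_(i+1) for i < 4. *)
Definition Ffun (R : realType) (M : 'M[R]_2) (a : heis R -> R) (i : nat)
    (p : heis R) : R :=
  let X1 := vact (frame M 0) in
  let X2 := vact (frame M 1) in
  let X0 := vact (@reeb R) in
  nth 0 [:: X1 (X1 a) p + X2 (X2 a) p;
            - (X2 a p) * X1 (X0 a) p + X1 a p * X2 (X0 a) p;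
            X0 a p;
            X0 (X0 a) p] i.

Definition evalQ (R : realType) (Q : mpoly.mpoly 5 R) (M : 'M[R]_2)
    (a : heis R -> R) (s : R) (p : heis R) : R :=
  mpoly.meval
    (fun i : 'I_5 => if (i < 4)%N then Ffun M a i p else s) Q.

(* Main.v *)
From HB Require Import structures.
Require Import Defs.
From mathcomp Require Import all_boot all_order all_algebra.
From mathcomp Require Import all_classical all_reals all_analysis.
From mathcomp Require Import ring lra.
From mathcomp Require mpoly.
Import Order.TTheory GRing.Theory Num.Theory.
Import numFieldNormedType.Exports.
Local Open Scope classical_set_scope.
Local Open Scope ring_scope.

Set Implicit Arguments.
Unset Strict Implicit.
Unset Printing Implicit Defensive.

(** A C^2 solution [a] of the eikonal equation [|nabla a| = 1] has, along the integral
    curves of [nabla a], the covector of a normal geodesic: the error solves a linear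
    differential inequality, so Gronwall's lemma applies.  Hence the flow of [nabla a] is
    explicit in terms of the initial covector, and differentiating this covector identity
    in the initial point gives, along the flow,
      F1' = - F1^2 - F3^2 + 2 F2,  F2' = F4 - F1 F2,  F3' = 0,  F4' = - F2^2,
    while [s = (m - 1) / delta] satisfies [s' = - s^2].  If [T] is the derivation of the
    polynomial ring with these values on the variables, then [Q^0 = 1] and
    [Q^(k+1) = (F1 - s) Q^k + T Q^k], which does not depend on [m] nor on the surface.
    The signed distance is an eikonal solution up to the surface, because its gradient
    extends across it as the explicit unit covector along the normal geodesics. *)

(** The function [a] is only C^2, so its third derivatives, which a direct computation of the
    evolution of [F1], [F2] and [F4] would use, need not exist. Differentiating the covector
    identity in the initial point avoids them: each second derivative at the moved point is an
    explicit function of time minus products of a coefficient vanishing at time 0 with another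
    second derivative, and such a product is differentiable at 0 as soon as its second factor is
    continuous. Derivatives at time 0, at every point, are all that a Lie derivative asks for. Nor
    is a general theorem on flows of C^1 vector fields called upon: the explicit geodesic is
    differentiable in its starting point by its formula. To keep that formula uniform in the
    vertical momentum, the value 0 included, [sin x / x], [(1 - cos x) / x] and [(x - sin x) / x^2]
    are extended by their limits. For the signed distance, the inverse of the exponential map only
    yields class C^1; the second derivative is gained because the frame derivatives are themselves
    C^1 functions of that inverse. *)

(** * Directional derivatives with explicit values *)

Section Directional.
Variables (R : realType) (V : normedModType R).
Implicit Types (f g : V -> R) (x v : V).

Lemma derC (c : R) x v : is_derive x v (fun _ => c) 0.
Proof. exact: is_derive_cst. Qed.

Lemma derD f g x v a b : is_derive x v f a -> is_derive x v g b ->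
  is_derive x v (fun t => f t + g t) (a + b).
Proof. by move=> fa gb; apply: is_deriveD. Qed.

Lemma derN f x v a : is_derive x v f a -> is_derive x v (fun t => - f t) (- a).
Proof. by move=> fa; apply: is_deriveN. Qed.

Lemma derB f g x v a b : is_derive x v f a -> is_derive x v g b ->
  is_derive x v (fun t => f t - g t) (a - b).
Proof. by move=> fa gb; apply: is_deriveB. Qed.

Lemma derM f g x v a b : is_derive x v f a -> is_derive x v g b ->
  is_derive x v (fun t => f t * g t) (a * g x + f x * b).
Proof.
move=> fa gb; apply: is_derive_eq (is_deriveM fa gb) _.
by rewrite addrC /GRing.scale /= [a * _]mulrC.
Qed.

Lemma derX n f x v a : is_derive x v f a ->
  is_derive x v (fun t => f t ^+ n) (n%:R * f x ^+ n.-1 * a).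
Proof.
move=> fa; elim: n => [|n IH].
  by rewrite !mul0r; exact: (derC 1).
have -> : (fun t => f t ^+ n.+1) = (fun t => f t * f t ^+ n).
  by apply/funext => t; rewrite exprS.
apply: is_derive_eq (derM fa IH) _.
case: n {IH} => [|n] /=; first by rewrite expr0; ring.
rewrite -natr1 exprS; ring.
Qed.

(** The difference quotient along [v] is literally that of the restriction of [f] to a line at
    parameter 0, so one-variable results transfer to directional derivatives in any normed space. *)
Lemma line_quotient (W : normedModType R) (f : V -> W) x v :
  (fun h : R => h^-1 *: ((f \o shift x) (h *: v) - f x)) =
  (fun h => h^-1 *: (((fun s : R => f (x + s *: v)) \o shift 0) (h *: 1) -
     f (x + 0 *: v))).
Proof.
apply/funext => h /=.
by rewrite /= [h *: 1]mulr1 addr0 scale0r addr0 [_ + x]addrC.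
Qed.

Lemma derline (W : normedModType R) (f : V -> W) x v :
  'D_v f x = 'D_1 (fun s : R => f (x + s *: v)) 0.
Proof. by rewrite /derive line_quotient. Qed.

Lemma derivable_line (W : normedModType R) (f : V -> W) x v :
  derivable f x v <-> derivable (fun s : R => f (x + s *: v)) 0 1.
Proof. by rewrite /derivable line_quotient. Qed.

Lemma is_derive_line (W : normedModType R) (f : V -> W) x v a :
  is_derive x v f a <-> is_derive (0 : R) 1 (fun s : R => f (x + s *: v)) a.
Proof.
split=> - [fd <-].
  by split; [exact/derivable_line|rewrite derline].
by split; [apply/derivable_line|rewrite derline].
Qed.

Lemma der1comp (k : R -> R) f x v a b : is_derive (f x) 1 k b ->
  is_derive x v f a -> is_derive x v (fun t => k (f t)) (b * a).
Proof.
move=> kb /is_derive_line fa; apply/is_derive_line.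
have kb' : is_derive ((fun s : R => f (x + s *: v)) 0) 1 k b.
  by rewrite /= scale0r addr0.
exact: (is_derive1_comp kb' fa).
Qed.

Lemma derV f x v a : f x != 0 -> is_derive x v f a ->
  is_derive x v (fun t => (f t)^-1) (- a / f x ^+ 2).
Proof.
move=> f0 [fd fa]; split; first exact: derivableV.
by rewrite deriveV // fa /GRing.scale /=; ring.
Qed.

Lemma derSin f x v a : is_derive x v f a ->
  is_derive x v (fun t => sin (f t)) (cos (f x) * a).
Proof. by apply: der1comp; exact: is_derive_sin. Qed.

Lemma derCos f x v a : is_derive x v f a ->
  is_derive x v (fun t => cos (f t)) (- sin (f x) * a).
Proof. by apply: der1comp; exact: is_derive_cos. Qed.

Lemma near_is_derive (W : normedModType R) (f g : V -> W) x v a :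
  (\forall y \near x, f y = g y) -> is_derive x v f a -> is_derive x v g a.
Proof. by move=> fg fa; exact: (near_eq_is_derive fg fa). Qed.

End Directional.

(* Otherwise [apply:] resolves derivatives by instances, into unreadable values. *)
#[export] Remove Hints is_deriveD is_deriveB is_deriveN is_deriveM is_deriveZ
  is_deriveX is_derive_sum is_derive_cst is_derive_id is_deriveNid is_derive_sin
  is_derive_cos is_derive1_comp : typeclass_instances.

Ltac dstep := first
  [ exact: derC | exact: is_derive_id | assumption | apply: derD | apply: derB | apply: derM
  | apply: derN | apply: derX
  | apply: derSin | apply: derCos ].

Ltac der_solve := eapply is_derive_eq; [solve [repeat dstep] | ].

(** * Chain rule along curves and symmetry of second derivatives *)

Section Chain.
Variables (R : realType).

Lemma chain (U V W : normedModType R) (f : V -> W) (c : U -> V) (t v : U) (w : V) :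
  differentiable f (c t) -> differentiable c t -> 'D_v c t = w ->
  is_derive t v (f \o c) ('D_w f (c t)).
Proof.
move=> df dc <-.
have dfc : differentiable (f \o c) t by apply: differentiable_comp.
split; first exact: diff_derivable.
by rewrite !deriveE // diff_comp //.
Qed.

Lemma chain_curve (V W : normedModType R) (f : V -> W) (c : R -> V) (t : R) (w : V) :
  differentiable f (c t) -> is_derive t 1 c w ->
  is_derive t 1 (fun s => f (c s)) ('D_w f (c t)).
Proof.
move=> df [dc cw]; apply: chain => //.
exact/derivable1_diffP.
Qed.

Lemma is_derive1_cvg (f : R -> R) (t a : R) : is_derive t 1 f a ->
  (fun h => h^-1 * (f (t + h) - f t)) @ 0^' --> a.
Proof.
move=> [fd <-]; move: fd; rewrite /derivable /derive => /cvg_ex[l fl].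
have := cvg_lim (@Rhausdorff R) fl => ->.
apply: cvg_trans fl; apply: near_eq_cvg; near=> h.
by rewrite /GRing.scale /= [h * 1]mulr1 [t + h]addrC.
Unshelve. all: end_near. Qed.

Lemma cvg_is_derive1 (f : R -> R) (t a : R) :
  (fun h => h^-1 * (f (t + h) - f t)) @ 0^' --> a -> is_derive t 1 f a.
Proof.
move=> fa.
have fl : (fun h => h^-1 *: ((f \o shift t) (h *: 1) - f t)) @ 0^' --> a.
  apply: cvg_trans fa; apply: near_eq_cvg; near=> h.
  by rewrite /GRing.scale /= [h * 1]mulr1 [t + h]addrC.
by split; [apply/cvg_ex; exists a|apply: cvg_lim].
Unshelve. all: end_near. Qed.

Lemma is_derive_continuous (f : R -> R) (t a : R) : is_derive t 1 f a ->
  {for t, continuous f}.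
Proof.
by move=> [fd _]; apply: differentiable_continuous; apply/derivable1_diffP.
Qed.

Lemma der_along (V : normedModType R) (F : V -> R) (q u : V) (a : R) :
  derivable F (q + a *: u) u ->
  is_derive a 1 (fun b : R => F (q + b *: u)) ('D_u F (q + a *: u)).
Proof.
move=> /derivableP/is_derive_line Fd.
have Fd' : is_derive (a - a) 1 (fun s : R => F (q + a *: u + s *: u))
   ('D_u F (q + a *: u)) by rewrite subrr.
have H : is_derive a 1 (fun b : R => b - a) 1.
  by apply: is_derive_eq (derB (is_derive_id _ _) (derC _ _ _)) _; rewrite subr0.
have := @der1comp R _ _ (fun b => b - a) _ _ _ _ Fd' H.
rewrite mulr1 => D; apply: near_is_derive D; near=> b.
by rewrite -addrA -scalerDl [a + _]addrC subrK.
Unshelve. all: end_near. Qed.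

Lemma MVT0 (f df : R -> R) (s : R) : 0 < s ->
  (forall x, 0 <= x <= s -> is_derive x 1 f (df x)) ->
  exists2 x, 0 <= x <= s & f s - f 0 = s * df x.
Proof.
move=> s0 fd.
have [|||x] := @MVT R f df 0 s => //.
- by move=> x; rewrite in_itv /= => /andP[x0 xs]; apply: fd; rewrite !ltW.
- apply: derivable_within_continuous => x; rewrite in_itv /= => /fd fx.
  by case: fx.
rewrite in_itv /= => /andP[x0 xs] ->; exists x; rewrite ?ltW //.
by rewrite subr0 mulrC.
Qed.

(* Young's theorem through the second-order difference quotient. *)
Lemma second_difference (V : normedModType R) (f : V -> R) (p v w : V) (A : set V)
   (e : R) : open A -> A p -> 0 < e ->
  (forall x, A x -> derivable f x v) ->
  (forall x, A x -> derivable ('D_v f) x w) ->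
  {for p, continuous ('D_w ('D_v f))} ->
  \forall s \near 0^'+, `|(f (p + s *: v + s *: w) - f (p + s *: v)
     - f (p + s *: w) + f p) / s ^+ 2 - 'D_w ('D_v f) p| < e.
Proof.
move=> oA Ap e0 dv dw cp.
have [r r0 rA] : exists2 r : R, 0 < r & forall x, `|x - p| < r ->
    A x /\ `|'D_w ('D_v f) x - 'D_w ('D_v f) p| < e.
  have : \forall x \near p, A x /\ `|'D_w ('D_v f) x - 'D_w ('D_v f) p| < e.
    apply: filterI; first exact: open_nbhs_nbhs.
    exact: (cvgr_distC_lt _ _ cp _ e0).
  case/nbhs_ballP => r r0 rA; exists r; first exact: r0.
  move=> x xp; apply: rA; rewrite -ball_normE /ball_ /= distrC; exact: xp.
have [M M0 Mv] : exists2 M : R, 0 < M & `|v| + `|w| < M.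
  by exists (`|v| + `|w| + 1); rewrite ?ltrDl // ltr_wpDl // addr_ge0.
near=> s.
have s0 : 0 < s by near: s; exact: nbhs_right_gt.
have sM : s * M < r.
  rewrite -ltr_pdivlMr //; near: s; apply: nbhs_right_lt.
  by rewrite divr_gt0.
have inA a b : 0 <= a <= s -> 0 <= b <= s -> `|p + a *: v + b *: w - p| < r.
  move=> /andP[a0 a1] /andP[b0 b1]; apply: le_lt_trans sM.
  rewrite -[p + a *: v + b *: w]addrA [X in `|X|]addrC addKr.
  apply: (le_trans (ler_normD _ _)).
  rewrite !normrZ !ger0_norm //.
  apply: (@le_trans _ _ (s * `|v| + s * `|w|)).
    by apply: lerD; apply: ler_wpM2r.
  by rewrite -mulrDr ler_wpM2l // ltW.
have ss : 0 <= s <= s by apply/andP; split; [exact: ltW|exact: lexx].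
have zs : 0 <= (0 : R) <= s by apply/andP; split; [exact: lexx|exact: ltW].
(* The second difference is [g s - g 0]. The mean value theorem in the parameter of [v], and again
   in that of [w], writes it as [s ^+ 2] times the mixed derivative at one intermediate point. *)
pose g (a : R) : R := f (p + s *: w + a *: v) - f (p + a *: v).
pose dg (a : R) : R := 'D_v f (p + s *: w + a *: v) - 'D_v f (p + a *: v).
have gd x : 0 <= x <= s -> is_derive x 1 g (dg x).
  move=> xs; apply: derB; apply: der_along; apply: dv; apply: (proj1 (rA _ _)).
    by rewrite [p + s *: w + _]addrAC; exact: inA.
  by have := inA _ _ xs zs; rewrite scale0r addr0.
have [x xs gx] := MVT0 s0 gd.
pose g2 (b : R) : R := 'D_v f (p + x *: v + b *: w).
pose dg2 (b : R) : R := 'D_w ('D_v f) (p + x *: v + b *: w).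
have g2d y : 0 <= y <= s -> is_derive y 1 g2 (dg2 y).
  by move=> ys; apply: der_along; apply: dw; apply: (proj1 (rA _ _)); exact: inA.
have [y ys gy] := MVT0 s0 g2d.
have -> : f (p + s *: v + s *: w) - f (p + s *: v) - f (p + s *: w) + f p =
    s * (s * 'D_w ('D_v f) (p + x *: v + y *: w)).
  rewrite -/(dg2 y) -gy.
  have -> : g2 s - g2 0 = dg x.
    by rewrite /g2 /dg scale0r addr0 [p + x *: v + s *: w]addrAC.
  rewrite -gx /g scale0r !addr0 [p + s *: v + s *: w]addrAC.
  move: (f _) (f (p + s *: v)) (f (p + s *: w)) (f p) => a1 a2 a3 a4.
  by rewrite opprB addrA addrAC.
rewrite mulrA -expr2 mulrC mulKf ?expf_neq0 ?gt_eqF //.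
exact: (rA _ (inA _ _ xs ys)).2.
Unshelve. all: end_near. Qed.

Lemma close_pair (a x y e : R) : `|a - x| < e / 2 -> `|a - y| < e / 2 ->
  `|x - y| <= e.
Proof.
move=> H1 H2; rewrite (splitr e); apply: le_trans (ler_distD a x y) _.
by apply: lerD; apply: ltW => //; rewrite distrC.
Qed.

(** The second difference is symmetric in [v] and [w], so for small [s] both mixed derivatives lie
    within [e / 2] of one and the same quotient. *)
Lemma young (V : normedModType R) (f : V -> R) (p v w : V) (A : set V) :
  open A -> A p ->
  (forall x, A x -> derivable f x v) -> (forall x, A x -> derivable f x w) ->
  (forall x, A x -> derivable ('D_v f) x w) ->
  (forall x, A x -> derivable ('D_w f) x v) ->
  {for p, continuous ('D_w ('D_v f))} -> {for p, continuous ('D_v ('D_w f))} ->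
  'D_w ('D_v f) p = 'D_v ('D_w f) p.
Proof.
move=> oA Ap dv dw dvw dwv cvw cwv; apply/eqP; rewrite -subr_eq0 -normr_le0.
apply/ler_addgt0Pr => e e0; rewrite add0r.
have e2 : 0 < e / 2 by rewrite divr_gt0.
have [s [H1 H2]] := filter_ex (filterI
  (second_difference oA Ap e2 dv dvw cvw) (second_difference oA Ap e2 dw dwv cwv)).
apply: (close_pair H1); move: H2; rewrite [p + s *: w + s *: v]addrAC.
by rewrite [_ - f (p + s *: w) - f (p + s *: v)]addrAC.
Qed.

End Chain.

(** * The trigonometric quotients of the geodesic formula *)

Section Sinc.
Variable R : realType.
Implicit Types x t h : R.

Lemma nbhs_neq0 x : x != 0 -> \forall y \near x, y != 0.
Proof.
by move=> x0; apply: open_nbhs_nbhs; split => //; exact: open_neq.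
Qed.

(** The values at 0 are the limits there. Geodesics that project to lines and those that project to
    circles then share one formula. *)
Definition sinc x : R := if x == 0 then 1 else sin x / x.
Definition cosc x : R := if x == 0 then 0 else (1 - cos x) / x.
Definition sincc x : R := if x == 0 then 0 else (x - sin x) / x ^+ 2.

Lemma mul_sinc x : x * sinc x = sin x.
Proof.
by rewrite /sinc; case: eqVneq => [->|x0]; rewrite ?mul0r ?sin0 // mulrCA mulfV ?mulr1.
Qed.

Lemma mul_cosc x : x * cosc x = 1 - cos x.
Proof.
rewrite /cosc; case: eqVneq => [->|x0]; first by rewrite mul0r cos0 subrr.
by rewrite mulrCA mulfV ?mulr1.
Qed.

Lemma sinc0 : sinc 0 = 1. Proof. by rewrite /sinc eqxx. Qed.
Lemma cosc0 : cosc 0 = 0. Proof. by rewrite /cosc eqxx. Qed.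
Lemma sincc0 : sincc 0 = 0. Proof. by rewrite /sincc eqxx. Qed.

Lemma mul_sincc x : x * sincc x = 1 - sinc x.
Proof.
rewrite /sincc /sinc; case: eqVneq => [->|x0]; first by rewrite mul0r subrr.
by field.
Qed.

Lemma mul2_sincc x : x ^+ 2 * sincc x = x - sin x.
Proof. by rewrite expr2 -mulrA mul_sincc mulrBr mulr1 mul_sinc. Qed.

(** This identity is what makes the height of a geodesic grow like the area swept by its projection,
    in [der_geo_z]. *)
Lemma sinc_cosc x : sinc x * sin x - cosc x * cos x = cosc x.
Proof.
rewrite /sinc /cosc; case: eqVneq => [->|x0].
  by rewrite sin0 mul0r mulr0 subrr.
have -> : sin x / x * sin x - (1 - cos x) / x * cos x =
  (cos x ^+ 2 + sin x ^+ 2 - cos x) / x by ring.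
by rewrite cos2Dsin2.
Qed.

(** Each use gains one order in a Taylor remainder at 0; iterating it produces the expansions of
    [sin] and [cos] below. *)
Lemma lhopital_pow (f df : R -> R) (n : nat) : (0 < n)%N -> f 0 = 0 ->
  df 0 = 0 -> (forall x, is_derive x 1 f (df x)) ->
  (fun x => df x / x ^+ n) @ 0^' --> (0 : R) ->
  (fun x => f x / x ^+ n.+1) @ 0^' --> (0 : R).
Proof.
move=> n0 f0 df0 fd dfn.
have dg x : is_derive x 1 (fun x : R => x ^+ n.+1) (n.+1%:R * x ^+ n).
  by apply: is_derive_eq (derX n.+1 (is_derive_id x 1)) _; rewrite mulr1.
apply: (@lhopital R f df (fun x => x ^+ n.+1) (fun x => n.+1%:R * x ^+ n) (-1) 1 0 0) => //.
- by rewrite in_itv /= ltrN10 ltr01.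
- by rewrite -[X in _ --> X]f0; exact: (is_derive_continuous (fd 0)).
- have E : (0 : R) ^+ n.+1 = 0 by rewrite expr0n.
  by rewrite -[X in _ --> X]E; exact: (is_derive_continuous (dg 0)).
- move=> x; rewrite inE /= => -[_ /eqP x0].
  by rewrite mulf_neq0 ?pnatr_eq0 // expf_neq0.
- have : {for 0, continuous (fun x => df x / (n.+1%:R * x ^+ n))}.
    apply/continuous_withinNx; rewrite df0 mul0r.
    have -> : (fun x => df x / (n.+1%:R * x ^+ n)) =
      (fun x => (df x / x ^+ n) * n.+1%:R^-1).
      by apply/funext => x; rewrite invfM mulrCA mulrA [RHS]mulrC mulrA.
    by rewrite -[X in _ --> X](mul0r n.+1%:R^-1); apply: cvgMl.
  have E : df 0 / (n.+1%:R * 0 ^+ n) = 0 by rewrite df0 mul0r.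
  by rewrite -[X in _ -> _ --> X]E.
Qed.

(** Serves functions defined by cases at 0: only the formula [f] valid away from 0 enters the
    limit. *)
Lemma is_derive_punctured (k f : R -> R) (l d : R) : k 0 = l ->
  (forall x, x != 0 -> k x = f x) ->
  (fun x => (f x - l) / x - d) @ 0^' --> (0 : R) -> is_derive (0 : R) 1 k d.
Proof.
move=> k0 kf fl; apply: cvg_is_derive1.
have : (fun x => (f x - l) / x - d + d) @ 0^' --> 0 + d by apply: cvgD => //; apply: cvg_cst.
rewrite add0r; apply: cvg_trans; apply: near_eq_cvg; near=> x.
have x0 : x != 0 by near: x; exact: nbhs_dnbhs_neq.
by rewrite add0r k0 kf // subrK mulrC.
Unshelve. all: end_near. Qed.

Lemma cvg_sin_lin : (fun x : R => (sin x - x) / x ^+ 1) @ 0^' --> (0 : R).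
Proof.
have D : is_derive (0 : R) 1 (fun x : R => sin x - x) 0.
  by apply: is_derive_eq (derB (derSin (is_derive_id _ _)) (is_derive_id _ _)) _;
    rewrite cos0 mulr1 subrr.
have := is_derive1_cvg D; apply: cvg_trans; apply: near_eq_cvg; near=> x.
by rewrite add0r sin0 !subr0 expr1 mulrC.
Unshelve. all: end_near. Qed.

Lemma cvg_cos_lin : (fun x : R => (cos x - 1) / x ^+ 1) @ 0^' --> (0 : R).
Proof.
have D : is_derive (0 : R) 1 (fun x : R => cos x - 1) 0.
  by apply: is_derive_eq (derB (derCos (is_derive_id _ _)) (derC _ _ _)) _;
    rewrite sin0 oppr0 mul0r addr0.
have := is_derive1_cvg D; apply: cvg_trans; apply: near_eq_cvg; near=> x.
by rewrite add0r cos0 subrr subr0 expr1 mulrC.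
Unshelve. all: end_near. Qed.

Lemma cvg_cos_quad :
  (fun x : R => (1 - cos x - x ^+ 2 / 2) / x ^+ 2) @ 0^' --> (0 : R).
Proof.
apply: (@lhopital_pow _ (fun x => sin x - x)) => //.
- by rewrite cos0 subrr expr0n mul0r subr0.
- by rewrite sin0 subr0.
- move=> z; der_solve.
  by rewrite /=; field.
- exact: cvg_sin_lin.
Qed.

Lemma sinc_derivable x : derivable sinc x 1.
Proof.
have [->|x0] := eqVneq x 0; last first.
  have D : is_derive x 1 (fun x : R => sin x * x^-1) (cos x * 1 * x^-1 + sin x * (- 1 / x ^+ 2)).
    apply: derM; first by apply: derSin; exact: is_derive_id.
    by apply: derV => //; exact: is_derive_id.
  suff fg : \forall y \near x, sin y * y^-1 = sinc y by case: (near_is_derive fg D).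
  near=> y; have y0 : y != 0 by near: y; exact: nbhs_neq0.
  by rewrite /sinc (negbTE y0).
suff : is_derive (0 : R) 1 sinc 0 by case.
apply: (@is_derive_punctured _ (fun x => sin x / x) 1); first exact: sinc0.
  by move=> y y0; rewrite /sinc (negbTE y0).
have : (fun x : R => (sin x - x) / x ^+ 2) @ 0^' --> (0 : R).
  apply: (@lhopital_pow _ (fun x => cos x - 1)) => //.
  - by rewrite sin0 subrr.
  - by rewrite cos0 subrr.
  - move=> z; der_solve.
    by rewrite /= mulr1.
  - exact: cvg_cos_lin.
apply: cvg_trans; apply: near_eq_cvg; near=> y.
have y0 : y != 0 by near: y; exact: nbhs_dnbhs_neq.
by field.
Unshelve. all: end_near. Qed.

Lemma cosc_derivable x : derivable cosc x 1.
Proof.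
have [->|x0] := eqVneq x 0; last first.
  have D : is_derive x 1 (fun x : R => (1 - cos x) * x^-1)
     ((0 - - sin x * 1) * x^-1 + (1 - cos x) * (- 1 / x ^+ 2)).
    apply: derM; first by repeat dstep.
    by apply: derV => //; exact: is_derive_id.
  suff fg : \forall y \near x, (1 - cos y) * y^-1 = cosc y by case: (near_is_derive fg D).
  near=> y; have y0 : y != 0 by near: y; exact: nbhs_neq0.
  by rewrite /cosc (negbTE y0).
suff : is_derive (0 : R) 1 cosc (2^-1) by case.
apply: (@is_derive_punctured _ (fun x => (1 - cos x) / x) 0); first exact: cosc0.
  by move=> y y0; rewrite /cosc (negbTE y0).
have := cvg_cos_quad.
apply: cvg_trans; apply: near_eq_cvg; near=> y.
have y0 : y != 0 by near: y; exact: nbhs_dnbhs_neq.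
by field.
Unshelve. all: end_near. Qed.

Lemma sincc_derivable x : derivable sincc x 1.
Proof.
have [->|x0] := eqVneq x 0; last first.
  have D : is_derive x 1 (fun x : R => (x - sin x) * (x ^+ 2)^-1)
     ((1 - cos x * 1) * (x ^+ 2)^-1 + (x - sin x) * (- (2%:R * x ^+ 1 * 1) / (x ^+ 2) ^+ 2)).
    apply: derM; first by repeat dstep.
    apply: derV; first exact: expf_neq0.
    by repeat dstep.
  suff fg : \forall y \near x, (y - sin y) * (y ^+ 2)^-1 = sincc y by case: (near_is_derive fg D).
  near=> y; have y0 : y != 0 by near: y; exact: nbhs_neq0.
  by rewrite /sincc (negbTE y0).
(* The value comes from [x - sin x = x^3 / 6 + o(x^3)]. *)
suff : is_derive (0 : R) 1 sincc (6^-1) by case.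
apply: (@is_derive_punctured _ (fun x => (x - sin x) / x ^+ 2) 0); first exact: sincc0.
  by move=> y y0; rewrite /sincc (negbTE y0).
have : (fun x : R => (x - sin x - x ^+ 3 / 6) / x ^+ 3) @ 0^' --> (0 : R).
  apply: (@lhopital_pow _ (fun x => 1 - cos x - x ^+ 2 / 2)) => //.
  - by rewrite sin0 subrr expr0n mul0r subrr.
  - by rewrite cos0 subrr expr0n mul0r subrr.
  - move=> z; der_solve.
    by rewrite /=; field.
  - exact: cvg_cos_quad.
apply: cvg_trans; apply: near_eq_cvg; near=> y.
have y0 : y != 0 by near: y; exact: nbhs_dnbhs_neq.
by field.
Unshelve. all: end_near. Qed.

Definition dsinc x := 'D_1 sinc x.
Definition dcosc x := 'D_1 cosc x.
Definition dsincc x := 'D_1 sincc x.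

Lemma is_derive_sinc x : is_derive x 1 sinc (dsinc x).
Proof. exact/derivableP/sinc_derivable. Qed.
Lemma is_derive_cosc x : is_derive x 1 cosc (dcosc x).
Proof. exact/derivableP/cosc_derivable. Qed.
Lemma is_derive_sincc x : is_derive x 1 sincc (dsincc x).
Proof. exact/derivableP/sincc_derivable. Qed.

Lemma is_derive_uniq (f g : R -> R) x a b : f = g ->
  is_derive x 1 f a -> is_derive x 1 g b -> a = b.
Proof. by move=> -> [_ <-] [_ <-]. Qed.

Lemma mul_dsinc x : x * dsinc x = cos x - sinc x.
Proof.
have := @is_derive_uniq (fun x => x * sinc x) sin x _ _ _
  (derM (is_derive_id x 1) (is_derive_sinc x)) (is_derive_sin x).
move=> <-; last by apply/funext => y; exact: mul_sinc.
by rewrite mul1r [X in X - _]addrC addrK.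
Qed.

Lemma mul_dcosc x : x * dcosc x = sin x - cosc x.
Proof.
have := @is_derive_uniq (fun x => x * cosc x) (fun x => 1 - cos x) x _ _ _
  (derM (is_derive_id x 1) (is_derive_cosc x)) (derB (derC _ _ _) (is_derive_cos x)).
rewrite sub0r opprK => <-; last by apply/funext => y; exact: mul_cosc.
by rewrite mul1r [X in X - _]addrC addrK.
Qed.

Lemma mul_dsincc x : x * dsincc x = cosc x - 2 * sincc x.
Proof.
have [->|x0] := eqVneq x 0; first by rewrite mul0r cosc0 sincc0 mulr0 subrr.
have := @is_derive_uniq (fun x => x ^+ 2 * sincc x) (fun x => x - sin x) x _ _ _
  (derM (derX 2 (is_derive_id x 1)) (is_derive_sincc x))
  (derB (is_derive_id _ _) (is_derive_sin x)).
rewrite -mul_cosc => H; apply: (mulfI x0).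
rewrite mulrBr -H; last by apply/funext => y; exact: mul2_sincc.
by rewrite /=; ring.
Qed.

(** No continuity of [df] at 0 is assumed: for [h != 0] the function [t * df (h * t)] is
    [k (h * t) / h], and [k] is continuous with value 0 at 0. For [h = 0] it is linear in [t]. *)
Lemma cvg_dilate (df k : R -> R) h : (forall x, x * df x = k x) ->
  {for 0, continuous k} -> k 0 = 0 -> (fun t => t * df (h * t)) @ 0 --> (0 : R).
Proof.
move=> dk ck k0.
have [->|h0] := eqVneq h 0.
  have -> : (fun t : R => t * df (0 * t)) = (fun t => t * df 0).
    by apply/funext => t; rewrite mul0r.
  by rewrite -[X in _ --> X](mul0r (df 0)); apply: cvgMl; exact: cvg_id.
have -> : (fun t => t * df (h * t)) = (fun t => k (h * t) * h^-1).
  by apply/funext => t; rewrite -dk; field.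
rewrite -[X in _ --> X](mul0r h^-1); apply: cvgMl.
have H : (fun t : R => h * t) @ 0 --> (0 : R).
  by rewrite -[X in _ --> X](mulr0 h); apply: cvgMr; exact: cvg_id.
by rewrite -[X in _ --> X]k0; exact: (cvg_comp _ _ H ck).
Qed.

Lemma sinc_continuous x : {for x, continuous sinc}.
Proof. exact: is_derive_continuous (is_derive_sinc x). Qed.
Lemma cosc_continuous x : {for x, continuous cosc}.
Proof. exact: is_derive_continuous (is_derive_cosc x). Qed.
Lemma sincc_continuous x : {for x, continuous sincc}.
Proof. exact: is_derive_continuous (is_derive_sincc x). Qed.

Lemma cvg_dsinc h : (fun t => t * dsinc (h * t)) @ 0 --> (0 : R).
Proof.
apply: cvg_dilate mul_dsinc _ _; last by rewrite cos0 sinc0 subrr.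
by apply: cvgB; [exact: continuous_cos|exact: sinc_continuous].
Qed.

Lemma cvg_dcosc h : (fun t => t * dcosc (h * t)) @ 0 --> (0 : R).
Proof.
apply: cvg_dilate mul_dcosc _ _; last by rewrite sin0 cosc0 subrr.
by apply: cvgB; [exact: continuous_sin|exact: cosc_continuous].
Qed.

Lemma cvg_dsincc h : (fun t => t * dsincc (h * t)) @ 0 --> (0 : R).
Proof.
apply: cvg_dilate mul_dsincc _ _; last by rewrite cosc0 sincc0 mulr0 subrr.
apply: cvgB; first exact: cosc_continuous.
by apply: cvgMr; exact: sincc_continuous.
Qed.

(** Read as integration from 0, uniformly in [h]: this lemma and the next two give the primitives of
    [cos (h * t)], [sin (h * t)] and [t * cosc (h * t)], the integrals met in solving the geodesic
    equations. *)
Lemma der_sinc h t : is_derive t 1 (fun t => t * sinc (h * t)) (cos (h * t)).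
Proof.
eapply is_derive_eq; first apply: derM; first exact: is_derive_id.
  apply: der1comp; first exact: is_derive_sinc.
  by apply: derM; [exact: derC|exact: is_derive_id].
have H := mul_dsinc (h * t); rewrite /=.
have -> : 1 * sinc (h * t) + t * (dsinc (h * t) * (0 * t + h * 1)) =
  sinc (h * t) + h * t * dsinc (h * t) by ring.
by rewrite H; ring.
Qed.

Lemma der_cosc h t : is_derive t 1 (fun t => t * cosc (h * t)) (sin (h * t)).
Proof.
eapply is_derive_eq; first apply: derM; first exact: is_derive_id.
  apply: der1comp; first exact: is_derive_cosc.
  by apply: derM; [exact: derC|exact: is_derive_id].
have := mul_dcosc (h * t); rewrite /= => H.
have -> : 1 * cosc (h * t) + t * (dcosc (h * t) * (0 * t + h * 1)) =
  cosc (h * t) + h * t * dcosc (h * t) by ring.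
by rewrite H; ring.
Qed.

Lemma der_sincc h t :
  is_derive t 1 (fun t => t ^+ 2 * sincc (h * t)) (t * cosc (h * t)).
Proof.
eapply is_derive_eq; first apply: derM; first by apply: derX; exact: is_derive_id.
  apply: der1comp; first exact: is_derive_sincc.
  by apply: derM; [exact: derC|exact: is_derive_id].
have := mul_dsincc (h * t); rewrite /= => H.
have -> : 2 * t ^+ 1 * 1 * sincc (h * t) + t ^+ 2 * (dsincc (h * t) * (0 * t + h * 1))
  = t * (2 * sincc (h * t) + h * t * dsincc (h * t)) by ring.
by rewrite H; ring.
Qed.

End Sinc.

(** * Differentiability and class C^k as local properties *)

Section Local.
Variables (R : realType) (V W : normedModType R).
Implicit Types (f g : V -> W) (A : set V).

(** The locality of differentiability rests on this case: two functions that agree near [x] differ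
    by one that vanishes near [x], and the zero map serves as its differential. *)
Lemma near_zero_differentiable f x : (\forall y \near x, f y = 0) -> differentiable f x.
Proof.
move=> f0.
have E : f \o shift x = cst (f x) + \0 +o_ 0 id.
  apply/eqaddoP => e e0; near=> h.
  rewrite /= !fctE (nbhs_singleton f0) addr0 subr0.
  suff -> : f (h + x) = 0 by rewrite normr0 mulr_ge0 // ltW.
  near: h; move: f0; rewrite (near_shift 0) /= subr0.
  by apply: filterS => h; rewrite /= addrC.
have c0 : continuous (\0 : V -> W) by move=> y; apply: cvg_cst.
have D : 'd f x = \0 :> (V -> W) by apply: diff_unique.
by apply/diff_locallyP; rewrite D.
Unshelve. all: end_near. Qed.

Lemma near_differentiable f g x : (\forall y \near x, f y = g y) ->
  differentiable f x -> differentiable g x.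
Proof.
move=> fg df; have -> : g = f + (g - f).
  by apply/funext => y; change (g y = f y + (g y - f y)); rewrite addrC subrK.
apply: differentiableD => //; apply: near_zero_differentiable.
by apply: filterS fg => y E; change (g y - f y = 0); rewrite E subrr.
Qed.

Lemma near_derive f g x v : (\forall y \near x, f y = g y) -> 'D_v f x = 'D_v g x.
Proof.
have [->|v0] := eqVneq v 0; first by rewrite !derive0.
by move=> fg; exact: near_eq_derive.
Qed.

Lemma near_continuous f g x : (\forall y \near x, f y = g y) ->
  {for x, continuous f} -> {for x, continuous g}.
Proof.
move=> fg cf; change (g @ x --> g x); rewrite -(nbhs_singleton fg).
by apply: cvg_trans cf; apply: near_eq_cvg.
Qed.

Lemma Ck_on_sub k A B f : (forall x, B x -> A x) -> Ck_on k A f -> Ck_on k B f.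
Proof.
elim: k f => [|k IH] f BA /=; first by move=> cf x /BA; exact: cf.
by move=> [df Df]; split; [move=> x /BA; exact: df|move=> v; exact: IH].
Qed.

Lemma Ck_on_eq k A f g : open A -> (forall x, A x -> f x = g x) ->
  Ck_on k A f -> Ck_on k A g.
Proof.
elim: k f g => [|k IH] f g oA fg /=.
  move=> cf x Ax; apply: near_continuous (cf x Ax).
  by apply: filterS (open_nbhs_nbhs (conj oA Ax)) => y; exact: fg.
have nfg x : A x -> \forall y \near x, f y = g y.
  by move=> Ax; apply: filterS (open_nbhs_nbhs (conj oA Ax)) => y; exact: fg.
move=> [df Df]; split=> [x Ax|v]; first exact: near_differentiable (nfg x Ax) (df x Ax).
by apply: IH (Df v) => // x Ax; exact: near_derive (nfg x Ax).
Qed.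

Lemma Ck_on_local k A f :
  (forall x, A x -> exists2 O, O x & Ck_on k O f) -> Ck_on k A f.
Proof.
elim: k f => [|k IH] f H /=; first by move=> x /H [B Bx] cB; exact: cB.
split=> [x /H [B Bx [df _]]|v]; first exact: df.
apply: IH => x /H [B Bx [_ Df]]; exists B => //; exact: Df.
Qed.

Lemma locally_extends_open k A f : open A -> locally_extends (Ck_on k) A f ->
  Ck_on k A f.
Proof.
move=> oA H; apply: Ck_on_local => x Ax.
have [B [g [oO Ox Cg gf]]] := H x Ax.
exists (A `&` B) => //; apply: (@Ck_on_eq _ _ g); first exact: openI.
  by move=> y [Ay Oy]; exact: gf.
by apply: Ck_on_sub Cg => y [].
Qed.

End Local.

(** * Coordinates and the left-invariant frame *)

Section Frame.
Variable R : realType.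
Implicit Types (p v w : heis R) (f g a : heis R -> R) (A : set (heis R)).

Lemma xc_vec3 (x y z : R) : xc (vec3 x y z) = x. Proof. by rewrite /xc mxE. Qed.
Lemma yc_vec3 (x y z : R) : yc (vec3 x y z) = y. Proof. by rewrite /yc mxE. Qed.
Lemma zc_vec3 (x y z : R) : zc (vec3 x y z) = z. Proof. by rewrite /zc mxE. Qed.

Lemma heis_eq p q : xc p = xc q -> yc p = yc q -> zc p = zc q -> p = q.
Proof.
move=> ex ey ez; apply/rowP => -[[|[|[|//]]] lt3].
- by move: ex; rewrite /xc; congr (_ = _); congr (_ _ _); exact: val_inj.
- by move: ey; rewrite /yc; congr (_ = _); congr (_ _ _); exact: val_inj.
- by move: ez; rewrite /zc; congr (_ = _); congr (_ _ _); exact: val_inj.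
Qed.

Lemma vec3E p : p = vec3 (xc p) (yc p) (zc p).
Proof. by apply: heis_eq; rewrite ?xc_vec3 ?yc_vec3 ?zc_vec3. Qed.

Lemma xcD p q : xc (p + q) = xc p + xc q. Proof. by rewrite /xc mxE. Qed.
Lemma ycD p q : yc (p + q) = yc p + yc q. Proof. by rewrite /yc mxE. Qed.
Lemma zcD p q : zc (p + q) = zc p + zc q. Proof. by rewrite /zc mxE. Qed.
Lemma xcZ (c : R) p : xc (c *: p) = c * xc p. Proof. by rewrite /xc mxE. Qed.
Lemma ycZ (c : R) p : yc (c *: p) = c * yc p. Proof. by rewrite /yc mxE. Qed.
Lemma zcZ (c : R) p : zc (c *: p) = c * zc p. Proof. by rewrite /zc mxE. Qed.
Definition coordE := (xc_vec3, yc_vec3, zc_vec3, xcD, ycD, zcD, xcZ, ycZ, zcZ).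

Lemma dxc p v : is_derive p v (@xc R) (xc v).
Proof.
apply/is_derive_line; have -> : (fun s : R => xc (p + s *: v)) = (fun s => xc p + s * xc v).
  by apply/funext => s; rewrite !coordE.
by der_solve; rewrite /=; ring.
Qed.
Lemma dyc p v : is_derive p v (@yc R) (yc v).
Proof.
apply/is_derive_line; have -> : (fun s : R => yc (p + s *: v)) = (fun s => yc p + s * yc v).
  by apply/funext => s; rewrite !coordE.
by der_solve; rewrite /=; ring.
Qed.
Lemma dzc p v : is_derive p v (@zc R) (zc v).
Proof.
apply/is_derive_line; have -> : (fun s : R => zc (p + s *: v)) = (fun s => zc p + s * zc v).
  by apply/funext => s; rewrite !coordE.
by der_solve; rewrite /=; ring.
Qed.

Lemma xc_differentiable p : differentiable (@xc R) p.
Proof. exact: differentiable_coord. Qed.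
Lemma yc_differentiable p : differentiable (@yc R) p.
Proof. exact: differentiable_coord. Qed.
Lemma zc_differentiable p : differentiable (@zc R) p.
Proof. exact: differentiable_coord. Qed.

Lemma vec3_differentiable (V : normedModType R) (f g h : V -> R) x :
  differentiable f x -> differentiable g x -> differentiable h x ->
  differentiable (fun y => vec3 (f y) (g y) (h y)) x.
Proof.
move=> df dg dh.
have -> : (fun y => vec3 (f y) (g y) (h y)) =
   (fun y => f y *: vec3 1 0 0) + (fun y => g y *: vec3 0 1 0) +
   (fun y => h y *: vec3 0 0 1).
  by apply/funext => y; rewrite !fctE /= ; apply: heis_eq; rewrite !coordE; ring.
by apply: differentiableD; [apply: differentiableD|]; exact: differentiableZl.
Qed.

Lemma is_derive_vec3 (V : normedModType R) (f : V -> heis R) (x v : V) (a b c : R) :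
  is_derive x v (fun y => xc (f y)) a -> is_derive x v (fun y => yc (f y)) b ->
  is_derive x v (fun y => zc (f y)) c -> is_derive x v f (vec3 a b c).
Proof.
move=> fa fb fc.
have df : derivable f x v.
  apply/derivable_mxP => i j; rewrite (ord1 i).
  case: j => -[|[|[|//]]] lt3.
  - by rewrite (_ : Ordinal lt3 = @Ordinal 3 0 isT); [case: fa|exact: val_inj].
  - by rewrite (_ : Ordinal lt3 = @Ordinal 3 1 isT); [case: fb|exact: val_inj].
  - by rewrite (_ : Ordinal lt3 = @Ordinal 3 2 isT); [case: fc|exact: val_inj].
split=> //; rewrite derive_mx //.
apply: heis_eq; rewrite !coordE ?/xc ?/yc ?/zc mxE.
- by case: fa.
- by case: fb.
- by case: fc.
Qed.

Lemma is_derive_coord (V : normedModType R) (f : V -> heis R) (x v : V) w :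
  is_derive x v f w ->
  [/\ is_derive x v (fun y => xc (f y)) (xc w), is_derive x v (fun y => yc (f y)) (yc w) &
  is_derive x v (fun y => zc (f y)) (zc w)].
Proof.
move=> [df <-]; have /derivable_mxP dc := df; rewrite derive_mx //.
by split; split; try exact: dc; rewrite ?/xc ?/yc ?/zc mxE.
Qed.

(** Index 0 is the Reeb field. All indices from 2 on denote the second horizontal field, so most
    statements hold for every natural number; [i < 3] is required where index 2 must be told from
    larger ones. *)
Definition X_ (i : nat) p : heis R :=
  match i with
  | 0%N => vec3 0 0 1
  | 1%N => vec3 1 0 (- (yc p / 2))
  | _ => vec3 0 1 (xc p / 2)
  end.

End Frame.

(* Locked: comparing two distinct derivatives by conversion does not terminate in
   practice. *)
HB.lock Definition dd (R : realType) (i : nat) (f : heis R -> R) (p : heis R) : R :=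
  'D_(X_ i p) f p.

Section FrameDerivative.
Variable R : realType.
Implicit Types (p v w : heis R) (f g a : heis R -> R) (A : set (heis R)).

Lemma ddP i f p : dd i f p = 'D_(X_ i p) f p.
Proof. by rewrite dd.unlock. Qed.

(* The X_0-component of a vector v at p. *)
Definition vert p v : R := zc v + (yc p * xc v - xc p * yc v) / 2.

Lemma frame_decomp p v :
  v = xc v *: X_ 1 p + yc v *: X_ 2 p + vert p v *: X_ 0 p.
Proof. by apply: heis_eq; rewrite !coordE /vert; field. Qed.

Lemma derive_lin (W : normedModType R) (f : heis R -> W) p (a b c : R) u v w :
  differentiable f p -> 'D_(a *: u + b *: v + c *: w) f p =
   a *: 'D_u f p + b *: 'D_v f p + c *: 'D_w f p.
Proof. by move=> df; rewrite !deriveE // !linearD !linearZ. Qed.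

Lemma derive_frame f p v : differentiable f p ->
  'D_v f p = xc v * dd 1 f p + yc v * dd 2 f p + vert p v * dd 0 f p.
Proof. by move=> df; rewrite {1}(frame_decomp p v) derive_lin // dd.unlock. Qed.

Definition ex : heis R := vec3 1 0 0.
Definition ey : heis R := vec3 0 1 0.
Definition ez : heis R := vec3 0 0 1.

Definition Xx (i : nat) : R := (i == 1%N)%:R.
Definition Xy (i : nat) : R := (1 < i)%:R.
Definition Xz (i : nat) p : R :=
  match i with 0%N => 1 | 1%N => - (yc p / 2) | _ => xc p / 2 end.

Lemma X_E i p : X_ i p = Xx i *: ex + Xy i *: ey + Xz i p *: ez.
Proof.
by apply: heis_eq; rewrite /Xx /Xy /Xz; case: i => [|[|i]]; rewrite !coordE /=; ring.
Qed.

Lemma ddE i f p : differentiable f p ->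
  dd i f p = Xx i * 'D_ex f p + Xy i * 'D_ey f p + Xz i p * 'D_ez f p.
Proof. by move=> df; rewrite dd.unlock X_E derive_lin. Qed.

End FrameDerivative.

(** * Closure properties of continuity and differentiability *)

Section Continuity.
Variables (R : realType) (T : topologicalType).
Implicit Types (f g : T -> R) (x : T).

Lemma contD f g x : {for x, continuous f} -> {for x, continuous g} ->
  {for x, continuous (fun y => f y + g y)}.
Proof. by move=> cf cg; exact: (cvgD cf cg). Qed.

Lemma contN f x : {for x, continuous f} -> {for x, continuous (fun y => - f y)}.
Proof. by move=> cf; exact: (cvgN cf). Qed.

Lemma contB f g x : {for x, continuous f} -> {for x, continuous g} ->
  {for x, continuous (fun y => f y - g y)}.
Proof. by move=> cf cg; exact: (cvgB cf cg). Qed.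

Lemma contM f g x : {for x, continuous f} -> {for x, continuous g} ->
  {for x, continuous (fun y => f y * g y)}.
Proof. by move=> cf cg; exact: (cvgM cf cg). Qed.

Lemma contC (c : R) x : {for x, continuous (fun _ : T => c)}.
Proof. exact: cvg_cst. Qed.

End Continuity.

Section Differentiability.
Variables (R : realType) (V : normedModType R).
Implicit Types (f g : V -> R) (x : V).

Lemma difD f g x : differentiable f x -> differentiable g x ->
  differentiable (fun y => f y + g y) x.
Proof. exact: differentiableD. Qed.
Lemma difB f g x : differentiable f x -> differentiable g x ->
  differentiable (fun y => f y - g y) x.
Proof. exact: differentiableB. Qed.
Lemma difN f x : differentiable f x -> differentiable (fun y => - f y) x.
Proof. exact: differentiableN. Qed.
Lemma difM f g x : differentiable f x -> differentiable g x ->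
  differentiable (fun y => f y * g y) x.
Proof. exact: differentiableM. Qed.
Lemma difC (c : R) x : differentiable (fun _ : V => c) x.
Proof. exact: differentiable_cst. Qed.
Lemma difX n f x : differentiable f x -> differentiable (fun y => f y ^+ n) x.
Proof.
move=> df; elim: n => [|n IH].
  have -> : (fun y => f y ^+ 0) = (fun=> 1) by apply/funext => y; rewrite expr0.
  exact: difC.
have -> : (fun y => f y ^+ n.+1) = (fun y => f y * f y ^+ n).
  by apply/funext => y; rewrite exprS.
exact: difM.
Qed.
Lemma difcomp (U W : normedModType R) (k : W -> U) (h : V -> W) x :
  differentiable h x -> differentiable k (h x) -> differentiable (fun y => k (h y)) x.
Proof. exact: differentiable_comp. Qed.
Lemma difcomp1 (k : R -> R) f x : (forall y, derivable k y 1) ->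
  differentiable f x -> differentiable (fun y => k (f y)) x.
Proof. by move=> dk df; apply: difcomp df _; exact/derivable1_diffP. Qed.
End Differentiability.

Ltac dif := repeat first [ assumption | exact: difC | apply: difD | apply: difB
  | apply: difM | apply: difN | apply: difX ].

(** * Second frame derivatives of a C^2 function and their commutators *)

Section C2.
Variable R : realType.
Variables (A : set (heis R)) (a : heis R -> R).
Hypotheses (oA : open A) (a2 : Ck_on 2 A a).
Implicit Types (p v w : heis R).

Lemma C2_differentiable p : A p -> differentiable a p.
Proof. by case: a2 => + _; apply. Qed.

Lemma C2_differentiable_partial v p : A p -> differentiable ('D_v a) p.
Proof. by case: a2 => _ /(_ v)[+ _]; apply. Qed.

Lemma C2_continuous_partial v w p : A p -> {for p, continuous ('D_w ('D_v a))}.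
Proof. by case: a2 => _ /(_ v)[_ /(_ w)]; apply. Qed.

Lemma C2_sym v w p : A p -> 'D_w ('D_v a) p = 'D_v ('D_w a) p.
Proof.
move=> Ap; apply: (@young _ _ _ _ _ _ A) => //.
- by move=> x Ax; apply: diff_derivable; exact: C2_differentiable.
- by move=> x Ax; apply: diff_derivable; exact: C2_differentiable.
- by move=> x Ax; apply: diff_derivable; exact: C2_differentiable_partial.
- by move=> x Ax; apply: diff_derivable; exact: C2_differentiable_partial.
- exact: C2_continuous_partial.
- exact: C2_continuous_partial.
Qed.

Lemma nearA p : A p -> \forall q \near p, A q.
Proof. by move=> Ap; exact: open_nbhs_nbhs. Qed.

Lemma Xz_differentiable i p : differentiable (@Xz R i) p.
Proof.
case: i => [|[|i]]; rewrite /Xz; dif.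
- exact: yc_differentiable.
- exact: xc_differentiable.
Qed.

Definition dXz (i j : nat) : R :=
  match j with 0%N => 0 | 1%N => - (Xy R i / 2) | _ => Xx R i / 2 end.

Lemma xc_X i p : xc (X_ i p) = Xx R i.
Proof. by case: i => [|[|i]]; rewrite /X_ coordE. Qed.
Lemma yc_X i p : yc (X_ i p) = Xy R i.
Proof. by case: i => [|[|i]]; rewrite /X_ coordE. Qed.

Lemma der_Xz i j p : is_derive p (X_ i p) (@Xz R j) (dXz i j).
Proof.
case: j => [|[|j]]; rewrite /Xz /dXz.
- exact: derC.
- eapply is_derive_eq; first apply: derN; first apply: derM; [exact: dyc|exact: derC|].
  by rewrite yc_X; ring.
- eapply is_derive_eq; first apply: derM; [exact: dxc|exact: derC|].
  by rewrite xc_X; ring.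
Qed.

Lemma near_dd j p : A p -> \forall q \near p,
  Xx R j * 'D_(ex R) a q + Xy R j * 'D_(ey R) a q + Xz j q * 'D_(ez R) a q = dd j a q.
Proof.
move=> Ap; apply: filterS (nearA Ap) => q Aq.
by rewrite ddE //; exact: C2_differentiable.
Qed.

Lemma dd_differentiable j p : A p -> differentiable (dd j a) p.
Proof.
move=> Ap; apply: near_differentiable (near_dd j Ap) _.
have H v := C2_differentiable_partial v Ap.
have Hz := Xz_differentiable j p.
by dif; exact: H.
Qed.

Lemma dd_continuous j p : A p -> {for p, continuous (dd j a)}.
Proof. by move=> Ap; apply: differentiable_continuous; exact: dd_differentiable. Qed.

Definition part (i : nat) u p : R :=
  Xx R i * 'D_(ex R) ('D_u a) p + Xy R i * 'D_(ey R) ('D_u a) p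
    + Xz i p * 'D_(ez R) ('D_u a) p.

(** The product rule applied to [dd j a] written in coordinate partials. The only first-order term
    is the one with [dXz i j]: it is all that survives in the bracket of two horizontal fields, once
    the second partials are symmetric. *)
Definition second (i j : nat) p : R :=
  Xx R j * part i (ex R) p + Xy R j * part i (ey R) p
    + (dXz i j * 'D_(ez R) a p + Xz j p * part i (ez R) p).

Lemma der_part i u p : A p -> is_derive p (X_ i p) ('D_u a) (part i u p).
Proof.
move=> Ap; rewrite /part -ddE; last exact: C2_differentiable_partial.
by rewrite ddP; apply/derivableP/diff_derivable; exact: C2_differentiable_partial.
Qed.

Lemma der_comb (V : normedModType R) (c1 c2 : R) (z f1 f2 f3 : V -> R) (p v : V)
    (dz d1 d2 d3 : R) :
  is_derive p v f1 d1 -> is_derive p v f2 d2 -> is_derive p v f3 d3 ->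
  is_derive p v z dz ->
  is_derive p v (fun q => c1 * f1 q + c2 * f2 q + z q * f3 q)
    (c1 * d1 + c2 * d2 + (dz * f3 p + z p * d3)).
Proof.
move=> D1 D2 D3 Dz; eapply is_derive_eq.
  by repeat first [exact: derC|eassumption|apply: derD|apply: derM].
by rewrite /=; ring.
Qed.

Lemma dd2E i j p : A p -> dd i (dd j a) p = second i j p.
Proof.
move=> Ap; rewrite [LHS]ddP -(near_derive _ (near_dd j Ap)).
have D := der_comb (Xx R j) (Xy R j) (der_part i (ex R) Ap) (der_part i (ey R) Ap)
  (der_part i (ez R) Ap) (der_Xz i j p).
by case: D.
Qed.

Lemma dd2_continuous i j p : A p -> {for p, continuous (dd i (dd j a))}.
Proof.
move=> Ap; apply: (@near_continuous _ _ _ (second i j)).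
  by apply: filterS (nearA Ap) => q Aq; rewrite dd2E.
have Hz k : {for p, continuous (@Xz R k)}.
  exact: differentiable_continuous (Xz_differentiable k p).
have Hp k u : {for p, continuous (part k u)}.
  have H w := @C2_continuous_partial u w p Ap.
  apply: contD; first apply: contD.
  - by apply: contM; [exact: contC|exact: H].
  - by apply: contM; [exact: contC|exact: H].
  - by apply: contM; [exact: Hz|exact: H].
apply: contD; first apply: contD; last apply: contD.
- by apply: contM; [exact: contC|exact: Hp].
- by apply: contM; [exact: contC|exact: Hp].
- apply: contM; first exact: contC.
  exact: differentiable_continuous (C2_differentiable_partial _ Ap).
- by apply: contM; [exact: Hz|exact: Hp].
Qed.

(* The algebra behind the commutators, with the second partial derivatives
   [D_w D_u a] abstracted as [F u w]: comparing them as terms is very slow. *)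
Definition second_alg (i j : nat) p (F : nat -> nat -> R) (g : R) : R :=
  let part u := Xx R i * F u 0%N + Xy R i * F u 1%N + Xz i p * F u 2 in
  Xx R j * part 0%N + Xy R j * part 1%N + (dXz i j * g + Xz j p * part 2).

Definition e_ (i : nat) : heis R :=
  match i with 0%N => ex R | 1%N => ey R | _ => ez R end.

Definition F_ p (u w : nat) : R := 'D_(e_ w) ('D_(e_ u) a) p.

Lemma F_sym p (u w : nat) : A p -> F_ p u w = F_ p w u.
Proof. by move=> Ap; rewrite /F_ C2_sym. Qed.

Lemma dd2_alg i j p : A p -> dd i (dd j a) p = second_alg i j p (F_ p) ('D_(ez R) a p).
Proof. exact: dd2E. Qed.

Lemma second_alg12 p F g : (forall u w : nat, F u w = F w u) ->
  second_alg 1 2 p F g - second_alg 2 1 p F g = g.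
Proof.
move=> sF; rewrite /second_alg /Xx /Xy /Xz /dXz /Xx /Xy /=.
by rewrite (sF 2 0%N) (sF 2 1%N) (sF 1%N 0%N); field.
Qed.

Lemma second_alg0 i p F g : (forall u w : nat, F u w = F w u) ->
  second_alg i 0 p F g = second_alg 0 i p F g.
Proof.
move=> sF; rewrite /second_alg /Xx /Xy /Xz /dXz /Xx /Xy.
by case: i => [|[|i]] /=; rewrite (sF 2 0%N) (sF 2 1%N); field.
Qed.

Lemma dd_bracket12 p : A p -> dd 1 (dd 2 a) p - dd 2 (dd 1 a) p = dd 0 a p.
Proof.
move=> Ap; rewrite !(dd2_alg _ _ Ap) second_alg12 => [|u w]; last exact: F_sym.
rewrite (ddE 0 (C2_differentiable Ap)) /Xx /Xy /Xz /=.
by rewrite !mul0r !add0r mul1r.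
Qed.

Lemma dd_bracket0 i p : A p -> dd i (dd 0 a) p = dd 0 (dd i a) p.
Proof.
move=> Ap; rewrite !(dd2_alg _ _ Ap); apply: second_alg0 => u w; exact: F_sym.
Qed.

End C2.

(** * Explicit geodesics of the Heisenberg group *)

Section Geo.
Variable R : realType.
Implicit Types (q : heis R) (h t : R).

(** Hamilton's equations integrated from the origin: the horizontal momenta [rot1], [rot2] rotate at
    constant speed [h0], [geo_x] and [geo_y] are their primitives, and [geo_z] is the signed area
    swept by the projected curve. [geo] is the left translate by [q]. *)
Definition geo_x h1 h2 h0 t := h1 * (t * sinc (h0 * t)) - h2 * (t * cosc (h0 * t)).
Definition geo_y h1 h2 h0 t := h1 * (t * cosc (h0 * t)) + h2 * (t * sinc (h0 * t)).
Definition geo_z h1 h2 h0 t := (h1 ^+ 2 + h2 ^+ 2) / 2 * (t ^+ 2 * sincc (h0 * t)).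
Definition geo q h1 h2 h0 t : heis R :=
  vec3 (xc q + geo_x h1 h2 h0 t) (yc q + geo_y h1 h2 h0 t)
    (zc q + geo_z h1 h2 h0 t + (xc q * geo_y h1 h2 h0 t - yc q * geo_x h1 h2 h0 t) / 2).
Definition rot1 h1 h2 h0 t := h1 * cos (h0 * t) - h2 * sin (h0 * t).
Definition rot2 h1 h2 h0 t := h1 * sin (h0 * t) + h2 * cos (h0 * t).

Lemma geo_x0 h1 h2 h0 : geo_x h1 h2 h0 0 = 0. Proof. by rewrite /geo_x; ring. Qed.
Lemma geo_y0 h1 h2 h0 : geo_y h1 h2 h0 0 = 0. Proof. by rewrite /geo_y; ring. Qed.
Lemma geo_z0 h1 h2 h0 : geo_z h1 h2 h0 0 = 0. Proof. by rewrite /geo_z; ring. Qed.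

Lemma geo0 q h1 h2 h0 : geo q h1 h2 h0 0 = q.
Proof. by apply: heis_eq; rewrite /geo !coordE ?geo_x0 ?geo_y0 ?geo_z0; ring. Qed.

Lemma der_geo_x h1 h2 h0 t : is_derive t 1 (geo_x h1 h2 h0) (rot1 h1 h2 h0 t).
Proof.
eapply is_derive_eq.
  by apply: derB; (apply: derM; [exact: derC|]); [exact: der_sinc|exact: der_cosc].
by rewrite /rot1; ring.
Qed.

Lemma der_geo_y h1 h2 h0 t : is_derive t 1 (geo_y h1 h2 h0) (rot2 h1 h2 h0 t).
Proof.
eapply is_derive_eq.
  by apply: derD; (apply: derM; [exact: derC|]); [exact: der_cosc|exact: der_sinc].
by rewrite /rot2; ring.
Qed.

Lemma der_geo_z h1 h2 h0 t : is_derive t 1 (geo_z h1 h2 h0)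
  ((geo_x h1 h2 h0 t * rot2 h1 h2 h0 t - geo_y h1 h2 h0 t * rot1 h1 h2 h0 t) / 2).
Proof.
eapply is_derive_eq.
  by apply: derM; [exact: derC|exact: der_sincc].
rewrite /geo_x /geo_y /rot1 /rot2 -[in LHS]sinc_cosc.
by field.
Qed.

Lemma der_geo q h1 h2 h0 t : is_derive t 1 (geo q h1 h2 h0)
  (rot1 h1 h2 h0 t *: X_ 1 (geo q h1 h2 h0 t) + rot2 h1 h2 h0 t *: X_ 2 (geo q h1 h2 h0 t)).
Proof.
set w := _ + _.
rewrite (vec3E w); apply: is_derive_vec3; rewrite /geo.
- have -> : (fun y => xc (geo q h1 h2 h0 y)) = (fun y => xc q + geo_x h1 h2 h0 y).
    by apply/funext => y; rewrite /geo !coordE.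
  eapply is_derive_eq; first by apply: derD; [exact: derC|exact: der_geo_x].
  by rewrite /w /geo !coordE; ring.
- have -> : (fun y => yc (geo q h1 h2 h0 y)) = (fun y => yc q + geo_y h1 h2 h0 y).
    by apply/funext => y; rewrite /geo !coordE.
  eapply is_derive_eq; first by apply: derD; [exact: derC|exact: der_geo_y].
  by rewrite /w /geo !coordE; ring.
- have -> : (fun y => zc (geo q h1 h2 h0 y)) = (fun y => zc q + geo_z h1 h2 h0 y +
      (xc q * geo_y h1 h2 h0 y - yc q * geo_x h1 h2 h0 y) * 2^-1).
    by apply/funext => y; rewrite /geo !coordE.
  eapply is_derive_eq.
    apply: derD; first by apply: derD; [exact: derC|exact: der_geo_z].
    apply: derM; last exact: derC.
    by apply: derB; (apply: derM; [exact: derC|]); [exact: der_geo_y|exact: der_geo_x].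
  by rewrite /w /geo !coordE; field.
Qed.

Lemma der_rot1 h1 h2 h0 t : is_derive t 1 (rot1 h1 h2 h0) (- (h0 * rot2 h1 h2 h0 t)).
Proof. by rewrite /rot1; der_solve; rewrite /rot2 /=; ring. Qed.

Lemma der_rot2 h1 h2 h0 t : is_derive t 1 (rot2 h1 h2 h0) (h0 * rot1 h1 h2 h0 t).
Proof. by rewrite /rot2; der_solve; rewrite /rot1 /=; ring. Qed.

Lemma rot_norm h1 h2 h0 t : rot1 h1 h2 h0 t ^+ 2 + rot2 h1 h2 h0 t ^+ 2 = h1 ^+ 2 + h2 ^+ 2.
Proof.
have E := cos2Dsin2 (h0 * t).
have -> : rot1 h1 h2 h0 t ^+ 2 + rot2 h1 h2 h0 t ^+ 2 =
   (h1 ^+ 2 + h2 ^+ 2) * (cos (h0 * t) ^+ 2 + sin (h0 * t) ^+ 2).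
  by rewrite /rot1 /rot2; ring.
by rewrite E mulr1.
Qed.

Lemma geo_differentiable (V : normedModType R) (q : V -> heis R) (h1 h2 h0 t : V -> R) x :
  differentiable q x -> differentiable h1 x -> differentiable h2 x ->
  differentiable h0 x -> differentiable t x ->
  differentiable (fun y => geo (q y) (h1 y) (h2 y) (h0 y) (t y)) x.
Proof.
move=> dq d1 d2 d0 dt.
have dX : differentiable (fun y => xc (q y)) x by apply: difcomp dq _; exact: xc_differentiable.
have dY : differentiable (fun y => yc (q y)) x by apply: difcomp dq _; exact: yc_differentiable.
have dZ : differentiable (fun y => zc (q y)) x by apply: difcomp dq _; exact: zc_differentiable.
have ds : differentiable (fun y => sinc (h0 y * t y)) x.
  by apply: difcomp1; [exact: sinc_derivable|exact: difM].
have dc : differentiable (fun y => cosc (h0 y * t y)) x.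
  by apply: difcomp1; [exact: cosc_derivable|exact: difM].
have dss : differentiable (fun y => sincc (h0 y * t y)) x.
  by apply: difcomp1; [exact: sincc_derivable|exact: difM].
by rewrite /geo /geo_x /geo_y /geo_z; apply: vec3_differentiable; dif.
Qed.

End Geo.

(** * Gronwall's lemma with zero initial value *)

Section Gronwall.
Variable R : realType.
Implicit Types (W dW : R -> R) (C r t : R).

(** The derivative of [W s * expR (- C * s)] is nonpositive, so by the mean value theorem this
    nonnegative function cannot leave its initial value 0. Negative times follow by reversal. *)
Lemma gronwall_pos W dW C r : (forall s : R, `|s| < r -> is_derive s 1 W (dW s)) ->
  (forall s, `|s| < r -> 0 <= W s) ->
  (forall s, `|s| < r -> `|dW s| <= C * W s) -> W 0 = 0 ->
  forall t, 0 < t < r -> W t = 0.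
Proof.
move=> Wd W0 Wb Wz t /andP[t0 tr].
have inr s : 0 <= s <= t -> `|s| < r.
  by move=> /andP[s0 st]; rewrite ger0_norm //; apply: le_lt_trans tr.
pose g s := W s * expR (- C * s).
pose dg s := (dW s - C * W s) * expR (- C * s).
have gd s : 0 <= s <= t -> is_derive s 1 g (dg s).
  move=> st; have De : is_derive s 1 (fun s => expR (- C * s)) (expR (- C * s) * - C).
    apply: is_derive_eq.
      exact: (@der1comp _ _ _ (fun s => - C * s) _ _ _ _ (is_derive_expR _)
        (derM (derC _ _ _) (is_derive_id _ _))).
    by rewrite /=; ring.
  apply: is_derive_eq (derM (Wd s (inr s st)) De) _.
  by rewrite /dg; ring.
have [x xt] := MVT0 t0 gd.
have tt : 0 <= t <= t by rewrite (ltW t0) lexx.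
rewrite /g Wz mul0r subr0 /dg => E.
apply/eqP; rewrite eq_le W0 ?inr // andbT.
rewrite -(pmulr_lle0 _ (expR_gt0 (- C * t))) E.
rewrite pmulr_rle0 // pmulr_lle0 ?expR_gt0 // subr_le0.
exact: le_trans (ler_norm _) (Wb x (inr x xt)).
Qed.

Lemma gronwall W dW C r : (forall s : R, `|s| < r -> is_derive s 1 W (dW s)) ->
  (forall s, `|s| < r -> 0 <= W s) ->
  (forall s, `|s| < r -> `|dW s| <= C * W s) -> W 0 = 0 ->
  forall t, `|t| < r -> W t = 0.
Proof.
move=> Wd W0 Wb Wz t tr; case: (ltgtP t 0) => [t0|t0|->] //; last first.
  by apply: (gronwall_pos Wd W0 Wb Wz); rewrite t0 /=; apply: le_lt_trans tr; exact: ler_norm.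
have H := @gronwall_pos (fun s => W (- s)) (fun s => - dW (- s)) C r _ _ _ _ (- t).
rewrite opprK in H; apply: H.
- move=> s sr; have sr' : `|- s| < r by rewrite normrN.
  apply: is_derive_eq (@der1comp _ _ _ (fun s => - s) _ _ _ _ (Wd _ sr')
    (derN (is_derive_id _ _))) _.
  by rewrite mulrN1.
- by move=> s sr; apply: W0; rewrite normrN.
- by move=> s sr; rewrite normrN; apply: Wb; rewrite normrN.
- by rewrite oppr0.
- by rewrite oppr_gt0 t0 /=; apply: le_lt_trans tr; rewrite -normrN ler_norm.
Qed.

Lemma mul_bound (c x y W C : R) : `|c| <= C -> x ^+ 2 <= W -> y ^+ 2 <= W ->
  `|c * (x * y)| <= C * W.
Proof.
move=> cC xW yW; rewrite normrM; apply: ler_pM => //.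
rewrite ler_norml; apply/andP; split.
- have : 0 <= (x + y) ^+ 2 by exact: sqr_ge0.
  rewrite sqrrD; lra.
- have : 0 <= (x - y) ^+ 2 by exact: sqr_ge0.
  rewrite sqrrB; lra.
Qed.

Lemma sqr_norm_le1 (x y : R) : x ^+ 2 + y ^+ 2 = 1 -> `|x| <= 1.
Proof.
move=> xy; rewrite -(@expr_le1 _ 2) // -normrX ger0_norm ?sqr_ge0 // -xy.
by rewrite lerDl sqr_ge0.
Qed.

End Gronwall.

(** * The explicit flow of the gradient of an eikonal solution *)

Section Flow.
Variable R : realType.

Lemma derive_lin2 (f : heis R -> R) p (c d : R) u v : differentiable f p ->
  'D_(c *: u + d *: v) f p = c * 'D_u f p + d * 'D_v f p.
Proof. by move=> df; rewrite !deriveE // linearD !linearZ. Qed.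

Variables (A : set (heis R)) (a : heis R -> R).
Hypotheses (oA : open A) (a2 : Ck_on 2 A a).
Hypothesis eik : forall p, A p -> dd 1 a p ^+ 2 + dd 2 a p ^+ 2 = 1.
Implicit Types (p q : heis R) (s t : R).

Notation b i j := (dd i (dd j a)).

Lemma der_dd i j p : A p -> is_derive p (X_ i p) (dd j a) (b i j p).
Proof.
move=> Ap; rewrite ddP; apply/derivableP/diff_derivable.
exact: (dd_differentiable oA a2 j Ap).
Qed.

(** Half the derivative of the eikonal equation along [X_ i]. *)
Lemma eik_dd i p : A p -> dd 1 a p * b i 1 p + dd 2 a p * b i 2 p = 0.
Proof.
move=> Ap.
have D : is_derive p (X_ i p) (fun q => dd 1 a q ^+ 2 + dd 2 a q ^+ 2)
   (2%:R * dd 1 a p ^+ 1 * b i 1 p + 2%:R * dd 2 a p ^+ 1 * b i 2 p).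
  by apply: derD; apply: derX; exact: der_dd.
have [_ E1] : is_derive p (X_ i p) (fun q => 1 : R)
   (2%:R * dd 1 a p ^+ 1 * b i 1 p + 2%:R * dd 2 a p ^+ 1 * b i 2 p).
  by apply: near_is_derive D; apply: filterS (nearA oA Ap) => q; exact: eik.
have [_ E2] := derC (1 : R) p (X_ i p).
rewrite E1 in E2; move: E2; move: (dd 1 a p) (dd 2 a p) (b i 1 p) (b i 2 p) => x y z w.
by rewrite !expr1 => E2; lra.
Qed.

(** A candidate so far: the geodesic whose initial momenta are the frame derivatives of [a] at [q].
    It is defined for all [t] and differentiable in [q] wherever these derivatives are; that it
    follows [hgrad a] for small times is [flow_local]. *)
Definition flow t q := geo q (dd 1 a q) (dd 2 a q) (dd 0 a q) t.

Lemma flow0 q : flow 0 q = q. Proof. exact: geo0. Qed.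

Lemma flow_differentiable t q : A q -> differentiable (flow t) q.
Proof.
move=> Aq; have H j := dd_differentiable oA a2 j Aq.
by apply: (@geo_differentiable R (heis R) id); try exact: H; try exact: difC.
Qed.

Lemma flow_joint_cvg p : A p ->
  (fun z : R * heis R => flow z.1 z.2) @ ((0 : R), p) --> p.
Proof.
move=> Ap.
have d1 : differentiable (fst : R * heis R -> R) ((0 : R), p).
  by apply: linear_differentiable => z; exact: cvg_fst.
have d2 : differentiable (snd : R * heis R -> heis R) ((0 : R), p).
  by apply: linear_differentiable => z; exact: cvg_snd.
have H j : differentiable (fun z : R * heis R => dd j a z.2) ((0 : R), p).
  exact: (difcomp d2 (dd_differentiable oA a2 j Ap)).
have /differentiable_continuous : differentiable (fun z : R * heis R => flow z.1 z.2) ((0 : R), p).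
  by apply: geo_differentiable.
by move=> cf; rewrite -[X in _ --> X](flow0 p); exact: cf.
Qed.

Lemma flow_box p : A p -> exists (W : set (heis R)) (r C : R),
  [/\ open W, W p, 0 < r, 1 <= C & forall q t, W q -> `|t| < r ->
    [/\ A q, A (flow t q) & forall i j : 'I_3, `|b i j (flow t q)| <= C]].
Proof.
move=> Ap.
(* The summand 1 makes the bound at [p] strict, so that it persists nearby, and gives [1 <= C], so
   that [C] also bounds the unit vector [(h1, h2)]. *)
pose C : R := 1 + \sum_(i < 3) \sum_(j < 3) `|b i j p|.
have S0 : 0 <= \sum_(i < 3) \sum_(j < 3) `|b i j p|.
  by apply: sumr_ge0 => i _; apply: sumr_ge0.
have C1 : 1 <= C by rewrite /C lerDl.
have bC (i j : 'I_3) : `|b i j p| < C.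
  apply: (@le_lt_trans _ _ (\sum_(i < 3) \sum_(j < 3) `|b i j p|)); last by rewrite /C ltrDr.
  rewrite (bigD1 i) //= (bigD1 j) //= -addrA lerDl addr_ge0 //.
    by apply: sumr_ge0.
  by apply: sumr_ge0 => k _; apply: sumr_ge0.
have near_b : \forall x \near p, A x /\ forall i j : 'I_3, `|b i j x| <= C.
  have nb (i j : 'I_3) : nbhs p [set x | `|b i j x| <= C].
    have cb : `|b i j x| @[x --> p] --> `|b i j p|.
      have c0 : b i j x @[x --> p] --> b i j p := @dd2_continuous _ _ _ oA a2 i j p Ap.
      exact: cvg_norm c0.
    by apply: filterS (cvgr_lt _ cb _ (bC i j)) => x /ltW.
  have nf := @filter_forall _ _ _ (nbhs p) _ (fun i : 'I_3 =>
    @filter_forall _ _ _ (nbhs p) _ (nb i)).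
  by apply: filterI; [exact: nearA|exact: nf].
have /flow_joint_cvg near_flow := Ap.
have [[B1 B2] [/= n1 n2] sub] := near_flow _ near_b.
have [r r0 rB] : exists2 r : R, 0 < r & forall t, `|t| < r -> B1 t.
  case/nbhs_ballP : n1 => r r0 rB; exists r; first exact: r0.
  by move=> t tr; apply: rB; rewrite -ball_normE /ball_ /= sub0r normrN.
exists (B2^° `&` A), r, C; split => //.
- by apply: openI => //; exact: open_interior.
- by move=> q t [/interior_subset B2q Aq] /rB B1t; have [] := sub (t, q) (conj B1t B2q).
Qed.

Definition h1 t q := rot1 (dd 1 a q) (dd 2 a q) (dd 0 a q) t.
Definition h2 t q := rot2 (dd 1 a q) (dd 2 a q) (dd 0 a q) t.

Lemma der_flow t q : is_derive t 1 (flow ^~ q)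
  (h1 t q *: X_ 1 (flow t q) + h2 t q *: X_ 2 (flow t q)).
Proof. exact: der_geo. Qed.

Lemma der_dd_flow i t q : A (flow t q) ->
  is_derive t 1 (fun s => dd i a (flow s q))
   (h1 t q * b 1 i (flow t q) + h2 t q * b 2 i (flow t q)).
Proof.
move=> Aq; have d := dd_differentiable oA a2 i Aq.
have := chain_curve d (der_flow t q).
by rewrite derive_lin2 // -!ddP.
Qed.

(** Here [u] is the covector of [a] on the curve, [k] and [h0] the explicit one, [e] their
    difference. The eikonal rows are weighted by [u], the velocity of the curve by [k]; exchanging
    the indices of [b] through the brackets makes the main terms cancel and leaves terms linear in
    [e]. *)
Lemma gronwall_algebra (e1 e2 e0 u1 u2 u0 k1 k2 h0 b11 b12 b21 b22 b01 b02 b10 b20 : R) :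
  u1 = k1 + e1 -> u2 = k2 + e2 -> u0 = h0 + e0 ->
  u1 * b11 + u2 * b12 = 0 -> u1 * b21 + u2 * b22 = 0 -> u1 * b01 + u2 * b02 = 0 ->
  b12 - b21 = u0 -> b10 = b01 -> b20 = b02 ->
  [/\ k1 * b11 + k2 * b21 + h0 * k2 = - (e1 * b11) - e2 * b12 - e0 * k2,
      k1 * b12 + k2 * b22 - h0 * k1 = - (e1 * b21) - e2 * b22 + e0 * k1 &
      k1 * b10 + k2 * b20 = - (e1 * b01) - e2 * b02].
Proof.
move=> -> -> -> E1 E2 E0 B -> ->.
have Eb : b12 = b21 + (h0 + e0) by rewrite -B addrC subrK.
split; apply/eqP; rewrite -subr_eq0; apply/eqP.
- by rewrite -[RHS]E1 Eb; ring.
- by rewrite -[RHS]E2 Eb; ring.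
- by rewrite -[RHS]E0; ring.
Qed.

(* The covector of a along the explicit geodesic solves Hamilton's equations up to an
   error linear in its distance to the explicit covector: Gronwall closes the loop. *)
Lemma flow_char p : A p -> exists (W : set (heis R)) (r : R),
  [/\ open W, W p, 0 < r & forall q t, W q -> `|t| < r ->
    [/\ A q, A (flow t q), dd 1 a (flow t q) = h1 t q, dd 2 a (flow t q) = h2 t q &
      dd 0 a (flow t q) = dd 0 a q]].
Proof.
move=> Ap; have [W [r [C [oW Wp r0 C1 H]]]] := flow_box Ap.
exists W, r; split => // q t Wq tr.
pose e1 s := dd 1 a (flow s q) - h1 s q.
pose e2 s := dd 2 a (flow s q) - h2 s q.
pose e0 s := dd 0 a (flow s q) - dd 0 a q.
pose d1 s := - (e1 s * b 1 1 (flow s q)) - e2 s * b 1 2 (flow s q) - e0 s * h2 s q.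
pose d2 s := - (e1 s * b 2 1 (flow s q)) - e2 s * b 2 2 (flow s q) + e0 s * h1 s q.
pose d0 s := - (e1 s * b 0 1 (flow s q)) - e2 s * b 0 2 (flow s q).
have Aq : A q by case: (H q t Wq tr).
have De s : `|s| < r -> [/\ is_derive s 1 e1 (d1 s), is_derive s 1 e2 (d2 s) &
   is_derive s 1 e0 (d0 s)].
  move=> sr; have [_ As _] := H q s Wq sr.
  have [||||||||| G1 G2 G0] := @gronwall_algebra (e1 s) (e2 s) (e0 s)
    (dd 1 a (flow s q)) (dd 2 a (flow s q)) (dd 0 a (flow s q)) (h1 s q) (h2 s q)
    (dd 0 a q) (b 1 1 (flow s q)) (b 1 2 (flow s q)) (b 2 1 (flow s q))
    (b 2 2 (flow s q)) (b 0 1 (flow s q)) (b 0 2 (flow s q)) (b 1 0 (flow s q))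
    (b 2 0 (flow s q)).
  - by rewrite /e1 addrC subrK.
  - by rewrite /e2 addrC subrK.
  - by rewrite /e0 addrC subrK.
  - exact: eik_dd.
  - exact: eik_dd.
  - exact: eik_dd.
  - exact: (dd_bracket12 oA a2).
  - exact: (dd_bracket0 oA a2).
  - exact: (dd_bracket0 oA a2).
  split.
  - rewrite /d1 -G1.
    have D := derB (der_dd_flow 1 As) (der_rot1 (dd 1 a q) (dd 2 a q) (dd 0 a q) s).
    by rewrite opprK in D; exact: D.
  - rewrite /d2 -G2.
    exact: derB (der_dd_flow 2 As) (der_rot2 (dd 1 a q) (dd 2 a q) (dd 0 a q) s).
  - rewrite /d0 -G0.
    by have D := derB (der_dd_flow 0 As) (derC (dd 0 a q) s 1); rewrite subr0 in D; exact: D.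
pose Wf s := e1 s ^+ 2 + e2 s ^+ 2 + e0 s ^+ 2.
pose dWf s := 2%:R * e1 s ^+ 1 * d1 s + 2%:R * e2 s ^+ 1 * d2 s + 2%:R * e0 s ^+ 1 * d0 s.
have e0s : [/\ e1 0 = 0, e2 0 = 0 & e0 0 = 0].
  rewrite /e1 /e2 /e0 !flow0 /h1 /h2 /rot1 /rot2 mulr0 sin0 cos0.
  by rewrite !mulr1 !mulr0 subr0 add0r !subrr.
have Wz : Wf t = 0.
  (* The derivative [dWf s] is twice a sum of eight products, each at most [C * Wf s] in absolute
     value, so any factor from 16 on will do. *)
  apply: (@gronwall _ Wf dWf (18 * C) r _ _ _ _ t tr).
  - move=> s sr; have [D1 D2 D0] := De s sr.
    by apply: derD; [apply: derD|]; apply: derX.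
  - by move=> s _; rewrite /Wf !addr_ge0 // sqr_ge0.
  - move=> s sr; have [_ As Hb] := H q s Wq sr.
    have kn : h1 s q ^+ 2 + h2 s q ^+ 2 = 1 by rewrite /h1 /h2 rot_norm eik.
    have k1C : `|h1 s q| <= C by apply: le_trans (sqr_norm_le1 kn) C1.
    have k2C : `|h2 s q| <= C.
      by apply: le_trans C1; apply: (@sqr_norm_le1 _ _ (h1 s q)); rewrite addrC.
    have W1 : e1 s ^+ 2 <= Wf s by rewrite /Wf -addrA lerDl addr_ge0 // sqr_ge0.
    have W2 : e2 s ^+ 2 <= Wf s.
      by rewrite /Wf addrAC lerDr addr_ge0 // sqr_ge0.
    have W0 : e0 s ^+ 2 <= Wf s by rewrite /Wf lerDr addr_ge0 // sqr_ge0.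
    have bb i j := Hb (inord i) (inord j).
    have b11 := bb 1%N 1%N; have b12 := bb 1%N 2; have b21 := bb 2 1%N.
    have b22 := bb 2 2; have b01 := bb 0%N 1%N; have b02 := bb 0%N 2.
    rewrite !inordK // in b11 b12 b21 b22 b01 b02.
    have T1 := mul_bound b11 W1 W1; have T2 := mul_bound b12 W1 W2.
    have T3 := mul_bound b21 W1 W2; have T4 := mul_bound b22 W2 W2.
    have T5 := mul_bound b01 W1 W0; have T6 := mul_bound b02 W2 W0.
    have T7 := mul_bound k2C W1 W0; have T8 := mul_bound k1C W2 W0.
    have -> : dWf s = 2 * (- (b 1 1 (flow s q) * (e1 s * e1 s))
      - b 1 2 (flow s q) * (e1 s * e2 s) - b 2 1 (flow s q) * (e1 s * e2 s)
      - b 2 2 (flow s q) * (e2 s * e2 s) - b 0 1 (flow s q) * (e1 s * e0 s)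
      - b 0 2 (flow s q) * (e2 s * e0 s) - h2 s q * (e1 s * e0 s)
      + h1 s q * (e2 s * e0 s)).
      rewrite /dWf /d1 /d2 /d0.
      move: (e1 s) (e2 s) (e0 s) (h1 s q) (h2 s q) (b 1 1 (flow s q)) (b 1 2 (flow s q))
        (b 2 1 (flow s q)) (b 2 2 (flow s q)) (b 0 1 (flow s q)) (b 0 2 (flow s q)) => *.
      by ring.
    rewrite -mulrA.
    move: T1 T2 T3 T4 T5 T6 T7 T8.
    move: (b 1 1 _ * _) (b 1 2 _ * _) (b 2 1 _ * _) (b 2 2 _ * _) (b 0 1 _ * _)
      (b 0 2 _ * _) (h2 _ _ * _) (h1 _ _ * _) => t1 t2 t3 t4 t5 t6 t7 t8.
    move: (C * Wf s) => M; rewrite !ler_norml => /andP[? ?] /andP[? ?] /andP[? ?]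
      /andP[? ?] /andP[? ?] /andP[? ?] /andP[? ?] /andP[? ?].
    by apply/andP; split; lra.
  - by rewrite /Wf; have [-> -> ->] := e0s; rewrite expr0n !addr0.
have [_ At _] := H q t Wq tr.
have sq0 (x : R) y z : x ^+ 2 + y ^+ 2 + z ^+ 2 = 0 -> [/\ x = 0, y = 0 & z = 0].
  move=> E; have := sqr_ge0 x; have := sqr_ge0 y; have := sqr_ge0 z => z0 y0 x0.
  by split; apply/eqP; rewrite -sqrf_eq0; apply/eqP; lra.
have [E1 E2 E0] := sq0 _ _ _ Wz.
by split => //; apply/eqP; rewrite -subr_eq0; apply/eqP.
Qed.

Lemma hgradE q : hgrad a q = dd 1 a q *: X_ 1 q + dd 2 a q *: X_ 2 q.
Proof. by rewrite /hgrad !big_ord_recl big_ord0 addr0 /vact !ddP. Qed.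

Lemma flow_local p : A p -> local_flow A (hgrad a) p flow.
Proof.
move=> Ap; have [W [r [oW Wp r0 H]]] := flow_char Ap.
exists W, r; split => // q Wq; split; first exact: flow0.
move=> t tr; have [Aq At E1 E2 E0] := H q t Wq tr.
split => //; first exact: flow_differentiable.
by rewrite hgradE E1 E2; exact: der_flow.
Qed.

End Flow.

(** * Derivatives at time 0 of products with a merely continuous factor *)

Section AtZero.
Variable R : realType.
Implicit Types (f g : R -> R).

Lemma dnbhs_cvg f (l : R) : f @ 0 --> l -> f @ 0^' --> l.
Proof. by move=> fl; apply: cvg_trans fl; apply: cvg_app; exact: cvg_within. Qed.

(** Since [g] vanishes at 0, the difference quotient of the product is that of [g] times [f]. This
    is how second derivatives of [a], only continuous, get differentiated along the flow. *)
Lemma der0_mul_cont f g (g' : R) : is_derive (0 : R) 1 g g' -> g 0 = 0 ->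
  {for 0, continuous f} -> is_derive (0 : R) 1 (fun t => g t * f t) (g' * f 0).
Proof.
move=> /is_derive1_cvg Dg g0 cf; apply: cvg_is_derive1.
have -> : (fun h : R => h^-1 * (g (0 + h) * f (0 + h) - g 0 * f 0)) =
   (fun h => h^-1 * (g (0 + h) - g 0) * f h).
  by apply/funext => h; rewrite g0 mul0r !subr0 add0r mulrA.
by apply: cvgM Dg _; exact: dnbhs_cvg.
Qed.

Lemma der0_sq f h : (fun t => t * f (h * t)) @ 0 --> (0 : R) ->
  is_derive (0 : R) 1 (fun t => t ^+ 2 * f (h * t)) 0.
Proof.
move=> /dnbhs_cvg fl; apply: cvg_is_derive1.
apply: cvg_trans fl; apply: near_eq_cvg; near=> t.
have t0 : t != 0 by near: t; exact: nbhs_dnbhs_neq.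
by rewrite add0r; field.
Unshelve. all: end_near. Qed.

(** The derivative of [t * sinc (h * t)] in the variable [h]; likewise for [sq_dcosc]. For [sincc],
    whose geodesic coefficient carries [t ^+ 2], a further factor [t] appears in [var_z]. *)
Definition sq_dsinc h t : R := t ^+ 2 * dsinc (h * t).
Definition sq_dcosc h t : R := t ^+ 2 * dcosc (h * t).
Definition sq_dsincc h t : R := t ^+ 2 * dsincc (h * t).

Lemma der0_dsinc h : is_derive (0 : R) 1 (sq_dsinc h) 0.
Proof. exact: der0_sq (cvg_dsinc h). Qed.
Lemma der0_dcosc h : is_derive (0 : R) 1 (sq_dcosc h) 0.
Proof. exact: der0_sq (cvg_dcosc h). Qed.
Lemma der0_dsincc h : is_derive (0 : R) 1 (sq_dsincc h) 0.
Proof. exact: der0_sq (cvg_dsincc h). Qed.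

End AtZero.

(** * First variation of geodesics *)

Section Variation.
Variable R : realType.
Implicit Types (t : R).

(* Derivatives of the geodesic in a parameter on which h1, h2, h0 depend with
   derivatives d1, d2, d0. *)
Definition var_x (h1 h2 h0 d1 d2 d0 t : R) : R :=
  d1 * (t * sinc (h0 * t)) - d2 * (t * cosc (h0 * t))
  + d0 * (h1 * sq_dsinc h0 t - h2 * sq_dcosc h0 t).
Definition var_y (h1 h2 h0 d1 d2 d0 t : R) : R :=
  d1 * (t * cosc (h0 * t)) + d2 * (t * sinc (h0 * t))
  + d0 * (h1 * sq_dcosc h0 t + h2 * sq_dsinc h0 t).
Definition var_z (h1 h2 h0 d1 d2 d0 t : R) : R :=
  (h1 * d1 + h2 * d2) * (t ^+ 2 * sincc (h0 * t))
  + (h1 ^+ 2 + h2 ^+ 2) / 2 * d0 * (t * sq_dsincc h0 t).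

Lemma var_x0 h1 h2 h0 d1 d2 d0 : var_x h1 h2 h0 d1 d2 d0 0 = 0.
Proof. by rewrite /var_x /sq_dsinc /sq_dcosc; ring. Qed.
Lemma var_y0 h1 h2 h0 d1 d2 d0 : var_y h1 h2 h0 d1 d2 d0 0 = 0.
Proof. by rewrite /var_y /sq_dsinc /sq_dcosc; ring. Qed.
Lemma var_z0 h1 h2 h0 d1 d2 d0 : var_z h1 h2 h0 d1 d2 d0 0 = 0.
Proof. by rewrite /var_z /sq_dsincc; ring. Qed.

(** To first order in time only the variation of the initial velocity is felt; that of the vertical
    momentum enters through terms with zero derivative at time 0. *)
Lemma der0_var_x h1 h2 h0 d1 d2 d0 :
  is_derive (0 : R) 1 (var_x h1 h2 h0 d1 d2 d0) d1.
Proof.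
have D := derD (derB (derM (derC d1 _ _) (der_sinc h0 0)) (derM (derC d2 _ _) (der_cosc h0 0)))
  (derM (derC d0 _ _) (derB (derM (derC h1 _ _) (der0_dsinc h0)) (derM (derC h2 _ _) (der0_dcosc h0)))).
by apply: is_derive_eq D _; rewrite mulr0 cos0 sin0; ring.
Qed.

Lemma der0_var_y h1 h2 h0 d1 d2 d0 :
  is_derive (0 : R) 1 (var_y h1 h2 h0 d1 d2 d0) d2.
Proof.
have D := derD (derD (derM (derC d1 _ _) (der_cosc h0 0)) (derM (derC d2 _ _) (der_sinc h0 0)))
  (derM (derC d0 _ _) (derD (derM (derC h1 _ _) (der0_dcosc h0)) (derM (derC h2 _ _) (der0_dsinc h0)))).
by apply: is_derive_eq D _; rewrite mulr0 cos0 sin0; ring.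
Qed.

Lemma der0_var_z h1 h2 h0 d1 d2 d0 :
  is_derive (0 : R) 1 (var_z h1 h2 h0 d1 d2 d0) 0.
Proof.
have D := derD (derM (derC (h1 * d1 + h2 * d2) _ _) (der_sincc h0 0))
  (derM (derC ((h1 ^+ 2 + h2 ^+ 2) / 2 * d0) _ _) (derM (is_derive_id _ _) (der0_dsincc h0))).
by apply: is_derive_eq D _; rewrite /sq_dsincc; ring.
Qed.

Lemma der_geo_var (V : normedModType R) (q : V -> heis R) (h1 h2 h0 : V -> R) (x v : V)
    (w : heis R) (d1 d2 d0 t : R) :
  is_derive x v q w -> is_derive x v h1 d1 -> is_derive x v h2 d2 ->
  is_derive x v h0 d0 ->
  let vx := var_x (h1 x) (h2 x) (h0 x) d1 d2 d0 t in
  let vy := var_y (h1 x) (h2 x) (h0 x) d1 d2 d0 t in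
  let vz := var_z (h1 x) (h2 x) (h0 x) d1 d2 d0 t in
  is_derive x v (fun y => geo (q y) (h1 y) (h2 y) (h0 y) t)
   (vec3 (xc w + vx) (yc w + vy) (zc w + vz +
     (xc w * geo_y (h1 x) (h2 x) (h0 x) t + xc (q x) * vy
      - (yc w * geo_x (h1 x) (h2 x) (h0 x) t + yc (q x) * vx)) / 2)).
Proof.
move=> Dq D1 D2 D0 vx vy vz.
have [Dx Dy Dz] := is_derive_coord Dq.
have D0t := derM D0 (derC t x v).
have Ds := der1comp (is_derive_sinc _) D0t.
have Dc := der1comp (is_derive_cosc _) D0t.
have Dss := der1comp (is_derive_sincc _) D0t.
have Dts := derM (derC t x v) Ds; have Dtc := derM (derC t x v) Dc.
have Dtss := derM (derC (t ^+ 2) x v) Dss.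
have Dgx : is_derive x v (fun y => geo_x (h1 y) (h2 y) (h0 y) t) vx.
  apply: is_derive_eq (derB (derM D1 Dts) (derM D2 Dtc)) _.
  by rewrite /vx /var_x /sq_dsinc /sq_dcosc; ring.
have Dgy : is_derive x v (fun y => geo_y (h1 y) (h2 y) (h0 y) t) vy.
  apply: is_derive_eq (derD (derM D1 Dtc) (derM D2 Dts)) _.
  by rewrite /vy /var_y /sq_dsinc /sq_dcosc; ring.
have Dgz : is_derive x v (fun y => geo_z (h1 y) (h2 y) (h0 y) t) vz.
  apply: is_derive_eq (derM (derM (derD (derX 2 D1) (derX 2 D2)) (derC 2^-1 x v)) Dtss) _.
  by rewrite /vz /var_z /sq_dsincc /=; field.
apply: is_derive_vec3.
- apply: near_is_derive (derD Dx Dgx); near=> y; by rewrite /geo coordE.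
- apply: near_is_derive (derD Dy Dgy); near=> y; by rewrite /geo coordE.
- have Dzz := derD (derD Dz Dgz) (derM (derB (derM Dx Dgy) (derM Dy Dgx)) (derC 2^-1 x v)).
  set r := (X in is_derive _ _ _ X); rewrite (_ : r = zc w + vz + ((xc w * geo_y (h1 x) (h2 x) (h0 x) t
    + xc (q x) * vy - (yc w * geo_x (h1 x) (h2 x) (h0 x) t + yc (q x) * vx)) / 2 +
    (xc (q x) * geo_y (h1 x) (h2 x) (h0 x) t -
         yc (q x) * geo_x (h1 x) (h2 x) (h0 x) t) * 0)); last by rewrite mulr0 addr0.
  by apply: near_is_derive Dzz; near=> y; rewrite /geo coordE.
Unshelve. all: end_near. Qed.

End Variation.

(** * Evolution of the second derivatives along the flow *)

Section FlowDerivative.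
Variable R : realType.
Variables (A : set (heis R)) (a : heis R -> R).
Hypotheses (oA : open A) (a2 : Ck_on 2 A a).
Hypothesis eik : forall p, A p -> dd 1 a p ^+ 2 + dd 2 a p ^+ 2 = 1.
Implicit Types (p q v : heis R) (s t : R).

Notation b i j := (dd i (dd j a)).

Definition gx t p := geo_x (dd 1 a p) (dd 2 a p) (dd 0 a p) t.
Definition gy t p := geo_y (dd 1 a p) (dd 2 a p) (dd 0 a p) t.

Section Direction.
Variables (p v : heis R) (d : nat -> R).

Hypothesis Dd : forall j, is_derive p v (dd j a) (d j).

Definition vx t := var_x (dd 1 a p) (dd 2 a p) (dd 0 a p) (d 1) (d 2) (d 0) t.
Definition vy t := var_y (dd 1 a p) (dd 2 a p) (dd 0 a p) (d 1) (d 2) (d 0) t.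
Definition vz t := var_z (dd 1 a p) (dd 2 a p) (dd 0 a p) (d 1) (d 2) (d 0) t.
Definition dflow t : heis R :=
  vec3 (xc v + vx t) (yc v + vy t) (zc v + vz t +
   (xc v * gy t p + xc p * vy t - (yc v * gx t p + yc p * vx t)) / 2).

Lemma der_flow_dir t : is_derive p v (flow a t) (dflow t).
Proof. exact: (der_geo_var t (is_derive_id p v) (Dd 1) (Dd 2) (Dd 0)). Qed.

(** A trace of left invariance: measured in the frame at the moved point, the vertical component
    contains the coordinates of [p] explicitly only in [vert p v]. *)
Lemma vert_dflow t : vert (flow a t p) (dflow t) =
  vert p v + (vz t + xc v * gy t p - yc v * gx t p
      + (gy t p * vx t - gx t p * vy t) / 2).
Proof.
rewrite /vert /dflow /flow /geo !coordE -/(gx t p) -/(gy t p).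
by field.
Qed.

End Direction.

Lemma dd_flow_continuous i j p : A p -> {for 0, continuous (fun t => b i j (flow a t p))}.
Proof.
move=> Ap.
have c1 : {for 0, continuous (fun t => flow a t p)}.
  apply: differentiable_continuous; apply/derivable1_diffP.
  by case: (der_flow a 0 p).
apply: (@continuous_comp _ _ _ (fun t => flow a t p)) => //.
by rewrite flow0; exact: (@dd2_continuous _ _ _ oA a2 i j p Ap).
Qed.

Lemma vert_X i p : vert p (X_ i p) = (i == 0%N)%:R.
Proof. by case: i => [|[|i]]; rewrite /vert /X_ !coordE /=; field. Qed.

Lemma dd_index (f : heis R -> R) p i : (i < 3)%N ->
  dd i f p = Xx R i * dd 1 f p + Xy R i * dd 2 f p + (i == 0%N)%:R * dd 0 f p.
Proof.
by case: i => [|[|[|//]]] _; rewrite /Xx /Xy /= !mul1r !mul0r ?add0r ?addr0.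
Qed.

(** Differentiate [dd j a (flow a t q) = H t q] at [q = p] along [X_ i]. The right side gives [K t];
    by the chain rule the left side is [b i j] at the moved point plus [x_ t], [y_ t], [v_ t] times
    [b 1 j], [b 2 j], [b 0 j] there. These three coefficients vanish at time 0, so solving for
    [b i j] shows it differentiable at 0 by [der0_mul_cont], without third derivatives of [a]. *)
Lemma der_b i j p (H : R -> heis R -> R) (K : R -> R) (Kd : R) : (i < 3)%N -> A p ->
  (exists (W : set (heis R)) (r : R), [/\ open W, W p, 0 < r & forall q t, W q -> `|t| < r ->
     A (flow a t q) /\ dd j a (flow a t q) = H t q]) ->
  (forall t, is_derive p (X_ i p) (H t) (K t)) -> is_derive (0 : R) 1 K Kd ->
  is_derive (0 : R) 1 (fun t => b i j (flow a t p))
   (Kd - b i 1 p * b 1 j p - b i 2 p * b 2 j p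
     - (Xx R i * dd 2 a p - Xy R i * dd 1 a p) * b 0 j p).
Proof.
move=> i3 Ap [W [r [oW Wp r0 HW]]] DH DK.
pose d k := b i k p.
have Dd k : is_derive p (X_ i p) (dd k a) (d k) by exact: (der_dd oA a2).
pose x_ t := vx p d t; pose y_ t := vy p d t.
pose v_ t := vz p d t + Xx R i * gy t p - Xy R i * gx t p
      + (gy t p * x_ t - gx t p * y_ t) / 2.
have near_r : \forall t \near (0 : R), `|t| < r.
  apply/nbhs_ballP; exists r; first exact: r0.
  by move=> t; rewrite -ball_normE /ball_ /= sub0r normrN.
have E t : `|t| < r -> K t - x_ t * b 1 j (flow a t p) - y_ t * b 2 j (flow a t p)
   - v_ t * b 0 j (flow a t p) = b i j (flow a t p).
  move=> tr; have [At _] := HW p t Wp tr.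
  have DH' : is_derive p (X_ i p) (fun q => dd j a (flow a t q)) (K t).
    apply: near_is_derive (DH t); apply: filterS (open_nbhs_nbhs (conj oW Wp)) => q Wq.
    by have [_ ->] := HW q t Wq tr.
  have df := der_flow_dir Dd t.
  have DC := chain (dd_differentiable oA a2 j At) (flow_differentiable oA a2 t Ap)
    (@derive_val _ _ _ _ _ _ _ df).
  have -> : K t = 'D_(dflow p (X_ i p) d t) (dd j a) (flow a t p).
    by case: DH' => _ <-; case: DC => _ <-.
  rewrite (derive_frame _ (dd_differentiable oA a2 j At)) vert_dflow vert_X.
  rewrite xc_X yc_X /dflow !coordE xc_X yc_X -/(x_ t) -/(y_ t) -/(v_ t).
  rewrite (dd_index (dd j a) (flow a t p) i3).
  move: (b 1 j _) (b 2 j _) (b 0 j _) (x_ t) (y_ t) (v_ t) => b1 b2 b0 xx yy vv.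
  by ring.
have cb k := @dd_flow_continuous k j p Ap.
have gd := der_flow a 0 p.
have Dgx : is_derive (0 : R) 1 (gx ^~ p) (dd 1 a p).
  by apply: is_derive_eq (der_geo_x _ _ _ _) _; rewrite /rot1 mulr0 cos0 sin0; ring.
have Dgy : is_derive (0 : R) 1 (gy ^~ p) (dd 2 a p).
  by apply: is_derive_eq (der_geo_y _ _ _ _) _; rewrite /rot2 mulr0 cos0 sin0; ring.
have Dx : is_derive (0 : R) 1 x_ (d 1) by exact: der0_var_x.
have Dy : is_derive (0 : R) 1 y_ (d 2) by exact: der0_var_y.
have Dz : is_derive (0 : R) 1 (vz p d) 0 by exact: der0_var_z.
have x00 : x_ 0 = 0 by exact: var_x0.
have y00 : y_ 0 = 0 by exact: var_y0.
have z00 : vz p d 0 = 0 by exact: var_z0.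
have gx00 : gx 0 p = 0 by exact: geo_x0.
have gy00 : gy 0 p = 0 by exact: geo_y0.
have Dv : is_derive (0 : R) 1 v_ (Xx R i * dd 2 a p - Xy R i * dd 1 a p).
  apply: is_derive_eq (derD (derB (derD Dz (derM (derC (Xx R i) _ _) Dgy))
     (derM (derC (Xy R i) _ _) Dgx))
    (derM (derB (derM Dgy Dx) (derM Dgx Dy)) (derC 2^-1 _ _))) _.
  by rewrite x00 y00 gx00 gy00; ring.
have v00 : v_ 0 = 0 by rewrite /v_ z00 x00 y00 gx00 gy00; ring.
have D := derB (derB (derB DK (der0_mul_cont Dx x00 (cb 1%N)))
   (der0_mul_cont Dy y00 (cb 2))) (der0_mul_cont Dv v00 (cb 0%N)).
rewrite !flow0 in D.
by apply: near_is_derive D; apply: filterS near_r => t; exact: E.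
Qed.

(** This and the next two lemmas form a Riccati equation for the matrix [b]: the quadratic terms
    come from the variation of the moved point, the others from the rotation of the covector and the
    vertical drift. For [j = 0] the covector component is conserved, so [H] is constant in time. *)
Lemma der_b0 i p : (i < 3)%N -> A p -> is_derive (0 : R) 1 (fun t => b i 0 (flow a t p))
   (- (b i 1 p * b 1 0 p) - b i 2 p * b 2 0 p
     - (Xx R i * dd 2 a p - Xy R i * dd 1 a p) * b 0 0 p).
Proof.
move=> i3 Ap; rewrite -[- (_ * _)]add0r.
apply: (@der_b i 0 p (fun _ => dd 0 a) (fun _ => b i 0 p)) => //.
- have [W [r [oW Wp r0 H]]] := flow_char oA a2 eik Ap.
  by exists W, r; split => // q t Wq /(H q t Wq)[].
- by move=> _; exact: (der_dd oA a2).
- exact: derC.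
Qed.

Lemma der_b1 i p : (i < 3)%N -> A p -> is_derive (0 : R) 1 (fun t => b i 1 (flow a t p))
   (- (dd 0 a p * b i 2 p + dd 2 a p * b i 0 p) - b i 1 p * b 1 1 p - b i 2 p * b 2 1 p
     - (Xx R i * dd 2 a p - Xy R i * dd 1 a p) * b 0 1 p).
Proof.
move=> i3 Ap.
have D k : is_derive p (X_ i p) (dd k a) (b i k p) by exact: (der_dd oA a2).
have Dt t : is_derive p (X_ i p) (fun q => dd 0 a q * t) (b i 0 p * t).
  by apply: is_derive_eq (derM (D 0%N) (derC t _ _)) _; ring.
apply: (@der_b i 1 p (h1 a) (fun t => b i 1 p * cos (dd 0 a p * t)
   - dd 1 a p * (sin (dd 0 a p * t) * (b i 0 p * t))
   - b i 2 p * sin (dd 0 a p * t) - dd 2 a p * (cos (dd 0 a p * t) * (b i 0 p * t)))) => //.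
- have [W [r [oW Wp r0 H]]] := flow_char oA a2 eik Ap.
  by exists W, r; split => // q t Wq /(H q t Wq)[].
- move=> t; apply: is_derive_eq (derB (derM (D 1%N) (derCos (Dt t))) (derM (D 2) (derSin (Dt t)))) _.
  by ring.
- move: (b i 1 p) (b i 2 p) (b i 0 p) (dd 1 a p) (dd 2 a p) (dd 0 a p) => B1 B2 B0 a_1 a_2 a_0.
  by der_solve; rewrite /= !mulr0 cos0 sin0; ring.
Qed.

Lemma der_b2 i p : (i < 3)%N -> A p -> is_derive (0 : R) 1 (fun t => b i 2 (flow a t p))
   (dd 0 a p * b i 1 p + dd 1 a p * b i 0 p - b i 1 p * b 1 2 p - b i 2 p * b 2 2 p
     - (Xx R i * dd 2 a p - Xy R i * dd 1 a p) * b 0 2 p).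
Proof.
move=> i3 Ap.
have D k : is_derive p (X_ i p) (dd k a) (b i k p) by exact: (der_dd oA a2).
have Dt t : is_derive p (X_ i p) (fun q => dd 0 a q * t) (b i 0 p * t).
  by apply: is_derive_eq (derM (D 0%N) (derC t _ _)) _; ring.
apply: (@der_b i 2 p (h2 a) (fun t => b i 1 p * sin (dd 0 a p * t)
   + dd 1 a p * (cos (dd 0 a p * t) * (b i 0 p * t))
   + b i 2 p * cos (dd 0 a p * t) - dd 2 a p * (sin (dd 0 a p * t) * (b i 0 p * t)))) => //.
- have [W [r [oW Wp r0 H]]] := flow_char oA a2 eik Ap.
  by exists W, r; split => // q t Wq /(H q t Wq)[].
- move=> t; apply: is_derive_eq (derD (derM (D 1%N) (derSin (Dt t))) (derM (D 2) (derCos (Dt t)))) _.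
  by ring.
- move: (b i 1 p) (b i 2 p) (b i 0 p) (dd 1 a p) (dd 2 a p) (dd 0 a p) => B1 B2 B0 a_1 a_2 a_0.
  by der_solve; rewrite /= !mulr0 cos0 sin0; ring.
Qed.

Definition F1 p := b 1 1 p + b 2 2 p.
Definition F2 p := - dd 2 a p * b 1 0 p + dd 1 a p * b 2 0 p.
Definition F3 p := dd 0 a p.
Definition F4 p := b 0 0 p.

(* The eikonal equation makes every row (b i 1, b i 2) of the horizontal Hessian
   orthogonal to the gradient. *)
Lemma eik_rows p : A p -> exists beta : nat -> R,
  [/\ forall i, b i 1 p = - (beta i * dd 2 a p), forall i, b i 2 p = beta i * dd 1 a p,
   b 1 0 p = - (beta 0%N * dd 2 a p), b 2 0 p = beta 0%N * dd 1 a p &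
   dd 0 a p = beta 1%N * dd 1 a p + beta 2 * dd 2 a p].
Proof.
move=> Ap; have N1 := eik Ap.
pose beta i := dd 1 a p * b i 2 p - dd 2 a p * b i 1 p.
have E i := eik_dd oA a2 eik i Ap.
have B1 i : b i 1 p = - (beta i * dd 2 a p).
  rewrite /beta; move: (E i) N1; move: (b i 1 p) (b i 2 p) (dd 1 a p) (dd 2 a p) => x y u w H N.
  rewrite -[LHS]mul1r -N.
  rewrite [LHS](_ : _ = u * (u * x + w * y) - (u * y - w * x) * w); last by ring.
  by rewrite H mulr0 sub0r.
have B2 i : b i 2 p = beta i * dd 1 a p.
  rewrite /beta; move: (E i) N1; move: (b i 1 p) (b i 2 p) (dd 1 a p) (dd 2 a p) => x y u w H N.
  rewrite -[LHS]mul1r -N.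
  rewrite [LHS](_ : _ = w * (u * x + w * y) + (u * y - w * x) * u); last by ring.
  by rewrite H mulr0 add0r.
exists beta; split => //.
- by rewrite (dd_bracket0 oA a2) // B1.
- by rewrite (dd_bracket0 oA a2) // B2.
- by rewrite -(dd_bracket12 oA a2) // B1 B2 opprK.
Qed.

Lemma der0_dd i p : A p -> is_derive (0 : R) 1 (fun t => dd i a (flow a t p))
  (dd 1 a p * b 1 i p + dd 2 a p * b 2 i p).
Proof.
move=> Ap; have A0 : A (flow a 0 p) by rewrite flow0.
apply: is_derive_eq (der_dd_flow oA a2 i A0) _.
by rewrite /h1 /h2 flow0 /rot1 /rot2 mulr0 sin0 cos0 !mulr1 !mulr0 subr0 add0r.
Qed.

Lemma der_a p : A p -> is_derive (0 : R) 1 (fun t => a (flow a t p)) 1.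
Proof.
move=> Ap; have A0 : A (flow a 0 p) by rewrite flow0.
have := chain_curve (C2_differentiable a2 A0) (der_flow a 0 p).
rewrite derive_lin2; last exact: (C2_differentiable a2 A0).
rewrite -!ddP; move=> D; apply: is_derive_eq D _.
rewrite /h1 /h2 geo0 /rot1 /rot2 mulr0 sin0 cos0 !mulr1 !mulr0 subr0 add0r.
by rewrite -!expr2 eik.
Qed.

(** The trace of the Riccati equation. By [eik_rows] the horizontal block has rank at most one, so
    the trace of its square is [F1 p ^+ 2]; its antisymmetric part is [F3 p] by the bracket, and the
    two mixed contributions add up to [2 * F2 p]. *)
Lemma der_F1 p : A p -> is_derive (0 : R) 1 (fun t => F1 (flow a t p))
  (- F1 p ^+ 2 - F3 p ^+ 2 + 2 * F2 p).
Proof.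
move=> Ap; apply: is_derive_eq (derD (@der_b1 1 p isT Ap) (@der_b2 2 p isT Ap)) _.
have [beta [B1 B2 C1 C2 C0]] := eik_rows Ap.
rewrite /F1 /F2 /F3 !B1 !B2 C1 C2 C0 /Xx /Xy /=.
by move: (beta _) (beta 1%N) (beta 2) (dd 1 a p) (dd 2 a p) => *; ring.
Qed.

Lemma der_F2 p : A p -> is_derive (0 : R) 1 (fun t => F2 (flow a t p))
  (F4 p - F1 p * F2 p).
Proof.
move=> Ap; have N1 := eik Ap.
apply: is_derive_eq (derD (derM (derN (der0_dd 2 Ap)) (@der_b0 1 p isT Ap))
   (derM (der0_dd 1 Ap) (@der_b0 2 p isT Ap))) _.
have [beta [B1 B2 C1 C2 C0]] := eik_rows Ap.
rewrite /F1 /F2 /F4 !flow0 !B1 !B2 C1 C2 /Xx /Xy /=.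
(* The eikonal equation enters as a multiplication by 1; after it, both sides agree as
   polynomials. *)
have G : b 0 0 p = (dd 1 a p ^+ 2 + dd 2 a p ^+ 2) * b 0 0 p by rewrite N1 mul1r.
rewrite [b 0 0 p in RHS]G.
by move: (beta _) (beta 1%N) (beta 2) (dd 1 a p) (dd 2 a p) (b 0 0 p) => *; ring.
Qed.

Lemma der_F3 p : A p -> is_derive (0 : R) 1 (fun t => F3 (flow a t p)) 0.
Proof.
move=> Ap; apply: is_derive_eq (der0_dd 0 Ap) _.
have [beta [_ _ C1 C2 _]] := eik_rows Ap; rewrite C1 C2.
by move: (beta _) (dd 1 a p) (dd 2 a p) => *; ring.
Qed.

Lemma der_F4 p : A p -> is_derive (0 : R) 1 (fun t => F4 (flow a t p)) (- F2 p ^+ 2).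
Proof.
move=> Ap; have N1 := eik Ap.
apply: is_derive_eq (@der_b0 0 p isT Ap) _.
have [beta [B1 B2 C1 C2 _]] := eik_rows Ap.
have -> : F2 p = beta 0%N * (dd 1 a p ^+ 2 + dd 2 a p ^+ 2).
  by rewrite /F2 C1 C2; move: (beta _) (dd 1 a p) (dd 2 a p) => *; ring.
have G : (beta 0%N) ^+ 2 = (dd 1 a p ^+ 2 + dd 2 a p ^+ 2) * beta 0%N ^+ 2 by rewrite N1 mul1r.
rewrite N1 mulr1 !B1 !B2 C1 C2 /Xx /Xy /= G.
by move: (beta _) (dd 1 a p) (dd 2 a p) (b 0 0 p) => *; ring.
Qed.

End FlowDerivative.

(** * Derivations of a polynomial ring, read along curves *)

Section PolynomialChainRule.
Import -(notations) mpoly.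
Variables (R : realType) (n : nat) (P : 'I_n -> mpoly n R).
Notation poly := (mpoly n R).

(* T is the derivation of the polynomial ring with T X_i = P i. *)
Definition transports (Q T : poly) := forall v : R -> 'I_n -> R,
  (forall i, is_derive (0 : R) 1 (fun t => v t i) (meval (v 0) (P i))) ->
  is_derive (0 : R) 1 (fun t => meval (v t) Q) (meval (v 0) T).

Lemma transportsC (c : R) : transports (mpolyC n c) 0.
Proof.
move=> v _; rewrite meval0.
have -> : (fun t => meval (v t) (mpolyC n c)) = (fun _ => c).
  by apply/funext => t; rewrite mevalC.
exact: derC.
Qed.

Lemma transportsX (i : 'I_n) : transports (mpolyX R (mnm1 i)) (P i).
Proof.
move=> v /(_ i); have -> : (fun t => meval (v t) (mpolyX R (mnm1 i))) = (fun t => v t i).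
  by apply/funext => t; rewrite mevalXU.
by [].
Qed.

Lemma transportsD Q Q' T T' : transports Q T -> transports Q' T' ->
  transports (Q + Q') (T + T').
Proof.
move=> HQ HQ' v Hv; rewrite mevalD.
have -> : (fun t => meval (v t) (Q + Q')) = (fun t => meval (v t) Q + meval (v t) Q').
  by apply/funext => t; rewrite mevalD.
by apply: derD; [exact: HQ|exact: HQ'].
Qed.

Lemma transportsM Q Q' T T' : transports Q T -> transports Q' T' ->
  transports (Q * Q') (T * Q' + Q * T').
Proof.
move=> HQ HQ' v Hv; rewrite mevalD !mevalM.
have -> : (fun t => meval (v t) (Q * Q')) = (fun t => meval (v t) Q * meval (v t) Q').
  by apply/funext => t; rewrite mevalM.
by apply: derM; [exact: HQ|exact: HQ'].
Qed.

(** The relation contains constants and variables and is closed under sums and, by Leibniz,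
    products; hence it reaches every polynomial. No formula for [T] is needed. *)
Lemma transports_ex (Q : poly) : exists T, transports Q T.
Proof.
elim/mpolyind: Q => [|c m p _ _ [T HT]].
  by exists 0; rewrite -(mpolyC0 n R); exact: transportsC.
suff [T' HT'] : exists T', transports (mpolyX R m) T'.
  exists (0 * mpolyX R m + mpolyC n c * T' + T).
  by rewrite -mul_mpolyC; apply: transportsD => //; apply: transportsM => //; exact: transportsC.
rewrite mpolyXE_id; apply: (big_ind (fun Q => exists T', transports Q T')).
- by exists 0; rewrite -(mpolyC1 n R); exact: transportsC.
- by move=> Q Q' [T1 H1] [T2 H2]; eexists; apply: transportsM; eassumption.
- move=> i _; elim: (m i) => [|k [T' HT']].
    by exists 0; rewrite expr0 -(mpolyC1 n R); exact: transportsC.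
  by rewrite exprS; eexists; apply: transportsM; [exact: transportsX|eassumption].
Qed.

End PolynomialChainRule.

(** * Jacobian determinants, divergence of the gradient, change of frame *)

Section Det3.
Variable R : comNzRingType.

Lemma det3 (F : nat -> nat -> R) : \det (\matrix_(i < 3, j < 3) F i j) =
  F 0%N 0%N * (F 1%N 1%N * F 2 2 - F 1%N 2 * F 2 1%N)
  - F 0%N 1%N * (F 1%N 0%N * F 2 2 - F 1%N 2 * F 2 0%N)
  + F 0%N 2 * (F 1%N 0%N * F 2 1%N - F 1%N 1%N * F 2 0%N).
Proof.
rewrite (expand_det_row _ ord0) !big_ord_recl big_ord0 /cofactor.
rewrite !(expand_det_row _ ord0) !big_ord_recl !big_ord0 /cofactor !det_mx11 !mxE /=.
by rewrite /bump /= !expr0 !expr1 !sqrrN !expr1n; ring.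
Qed.

End Det3.

Section Divergence.
Variable R : realType.
Variables (A : set (heis R)) (a : heis R -> R).
Hypotheses (oA : open A) (a2 : Ck_on 2 A a).
Hypothesis eik : forall p, A p -> dd 1 a p ^+ 2 + dd 2 a p ^+ 2 = 1.
Implicit Types (p q v : heis R) (s t : R).

Definition coord (j : nat) v : R :=
  match j with 0%N => xc v | 1%N => yc v | _ => zc v end.

Lemma coordP (j : 'I_3) v : v 0 j = coord j v.
Proof. by case: j => -[|[|[|//]]] lt3; rewrite /coord /xc /yc /zc /=; congr (v _ _); exact: val_inj. Qed.

Lemma delta_e (i : 'I_3) : delta_mx 0 i = e_ R i.
Proof.
by case: i => -[|[|[|//]]] lt3; apply: heis_eq; rewrite /e_ /= ?/ex ?/ey ?/ez ?coordE /xc /yc /zc !mxE.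
Qed.

(** Points are row vectors, so row [i] holds the derivative along the [i]-th basis vector: the
    transpose of the usual layout, with the same determinant. *)
Lemma jacobianE (f : heis R -> heis R) p : differentiable f p ->
  jacobian f p = \matrix_(i < 3, j < 3) coord j ('D_(e_ R i) f p).
Proof.
by move=> df; apply/matrixP => i j; rewrite !mxE -coordP -delta_e deriveE.
Qed.

(** Jacobi's formula at the identity matrix: the derivative of the determinant is the trace. Near 0
    the determinant is positive, so the absolute value is harmless. *)
Lemma der_det3 (F : nat -> nat -> R -> R) (d : nat -> nat -> R) :
  (forall i j, (i < 3)%N -> (j < 3)%N -> is_derive (0 : R) 1 (F i j) (d i j)) ->
  (forall i j, (i < 3)%N -> (j < 3)%N -> F i j 0 = (i == j)%:R) ->
  is_derive (0 : R) 1 (fun t => `|\det (\matrix_(i < 3, j < 3) F i j t)|)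
   (d 0%N 0%N + d 1%N 1%N + d 2 2).
Proof.
move=> DF F0.
pose m t := F 0%N 0%N t * (F 1%N 1%N t * F 2 2 t - F 1%N 2 t * F 2 1%N t)
  - F 0%N 1%N t * (F 1%N 0%N t * F 2 2 t - F 1%N 2 t * F 2 0%N t)
  + F 0%N 2 t * (F 1%N 0%N t * F 2 1%N t - F 1%N 1%N t * F 2 0%N t).
have Dm : is_derive (0 : R) 1 m (d 0%N 0%N + d 1%N 1%N + d 2 2).
  have D i j (lij : ((i < 3) && (j < 3))%N) : is_derive (0 : R) 1 (F i j) (d i j).
    by case/andP: lij; exact: DF.
  apply: is_derive_eq (derD (derB
    (derM (D 0 0 isT)%N (derB (derM (D 1 1 isT)%N (D 2 2 isT)%N) (derM (D 1 2 isT)%N (D 2 1 isT)%N)))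
    (derM (D 0 1 isT)%N (derB (derM (D 1 0 isT)%N (D 2 2 isT)%N) (derM (D 1 2 isT)%N (D 2 0 isT)%N))))
    (derM (D 0 2 isT)%N (derB (derM (D 1 0 isT)%N (D 2 1 isT)%N) (derM (D 1 1 isT)%N (D 2 0 isT)%N)))) _.
  by rewrite !F0 //=; ring.
have m0 : m 0 = 1 by rewrite /m !F0 //=; ring.
apply: near_is_derive (Dm).
have cm : m @ 0 --> m 0 := is_derive_continuous Dm.
have m00 : 0 < m 0 by rewrite m0.
apply: filterS (cvgr_gt _ cm _ m00) => t mt.
by rewrite (det3 (fun i j => F i j t)) -/(m t) ger0_norm // ltW.
Qed.

Definition pdd p (i j : nat) : R := 'D_(e_ R i) (dd j a) p.

Lemma jacobian_flow t p : A p -> jacobian (flow a t) p =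
  \matrix_(i < 3, j < 3) coord j (dflow a p (e_ R i) (pdd p i) t).
Proof.
move=> Ap; rewrite jacobianE; last exact: (flow_differentiable oA a2).
apply/matrixP => i j; rewrite !mxE.
have D k : is_derive p (e_ R i) (dd k a) (pdd p i k).
  apply/derivableP/diff_derivable; exact: (dd_differentiable oA a2 k Ap).
by have [_ ->] := der_flow_dir D t.
Qed.

Lemma coord_e i j : (i < 3)%N -> coord j (e_ R i) = (i == minn j 2)%:R.
Proof.
by case: i => [|[|[|//]]] _; case: j => [|[|j]]; rewrite /coord /e_ ?/ex ?/ey ?/ez ?coordE.
Qed.

Definition ddflow (p v : heis R) (d : nat -> R) (j : nat) : R :=
  match j with 0%N => d 1%N | 1%N => d 2 | _ =>
   (xc v * dd 2 a p + xc p * d 2 - (yc v * dd 1 a p + yc p * d 1%N)) / 2 end.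

Lemma der0_dflow p v d j : is_derive (0 : R) 1 (fun t => coord j (dflow a p v d t))
  (ddflow p v d j).
Proof.
have Dx : is_derive (0 : R) 1 (vx a p d) (d 1%N) by exact: der0_var_x.
have Dy : is_derive (0 : R) 1 (vy a p d) (d 2) by exact: der0_var_y.
have Dz : is_derive (0 : R) 1 (vz a p d) 0 by exact: der0_var_z.
have Dgx : is_derive (0 : R) 1 ((gx a) ^~ p) (dd 1 a p).
  by apply: is_derive_eq (der_geo_x _ _ _ _) _; rewrite /rot1 mulr0 cos0 sin0; ring.
have Dgy : is_derive (0 : R) 1 ((gy a) ^~ p) (dd 2 a p).
  by apply: is_derive_eq (der_geo_y _ _ _ _) _; rewrite /rot2 mulr0 cos0 sin0; ring.
case: j => [|[|j]].
- have D := derD (derC (xc v) (0 : R) 1) Dx; rewrite add0r in D.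
  by apply: near_is_derive D; near=> t; rewrite /coord /dflow coordE.
- have D := derD (derC (yc v) (0 : R) 1) Dy; rewrite add0r in D.
  by apply: near_is_derive D; near=> t; rewrite /coord /dflow coordE.
- have D := derD (derD (derC (zc v) (0 : R) 1) Dz) (derM (derB
    (derD (derM (derC (xc v) _ _) Dgy) (derM (derC (xc p) _ _) Dy))
    (derD (derM (derC (yc v) _ _) Dgx) (derM (derC (yc p) _ _) Dx))) (derC 2^-1 _ _)).
  apply: (@near_is_derive _ _ _ (fun t => zc v + vz a p d t +
   (xc v * gy a t p + xc p * vy a p d t - (yc v * gx a t p + yc p * vx a p d t)) / 2)).
    by near=> t; rewrite /coord /dflow coordE.
  by apply: is_derive_eq D _; rewrite /ddflow; ring.
Unshelve. all: end_near. Qed.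

Lemma dflow0 p v d : dflow a p v d 0 = v.
Proof.
rewrite /dflow /vx /vy /vz var_x0 var_y0 var_z0 /gx /gy geo_x0 geo_y0.
by apply: heis_eq; rewrite !coordE; ring.
Qed.

(** In other words, [F1] is the divergence of [hgrad a] for the coordinate volume: the trace of
    first derivatives regroups as a sum of squares of fields because [X_ 1] and [X_ 2] are
    divergence free. *)
Lemma der0_jacobian p : A p ->
  is_derive (0 : R) 1 (fun t => `|\det (jacobian (flow a t) p)|) (F1 a p).
Proof.
move=> Ap.
pose F i j t := coord j (dflow a p (e_ R i) (pdd p i) t).
pose d i j := ddflow p (e_ R i) (pdd p i) j.
have DF i j (_ : (i < 3)%N) (_ : (j < 3)%N) : is_derive (0 : R) 1 (F i j) (d i j).
  exact: der0_dflow.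
have F0 i j : (i < 3)%N -> (j < 3)%N -> F i j 0 = (i == j)%:R.
  by move=> i3 j3; rewrite /F dflow0 coord_e //; case: j j3 => [|[|[|//]]].
have D := der_det3 DF F0.
apply: is_derive_eq.
  by apply: near_is_derive D; near=> t; rewrite jacobian_flow.
rewrite /d /ddflow /F1 /pdd.
rewrite (ddE 1 (dd_differentiable oA a2 1 Ap)) (ddE 2 (dd_differentiable oA a2 2 Ap)).
rewrite /e_ /Xx /Xy /Xz /=.
have -> : xc (ez R) = 0 by rewrite /ez coordE.
have -> : yc (ez R) = 0 by rewrite /ez coordE.
move: ('D_(ex R) (dd 1 a) p) ('D_(ey R) (dd 1 a) p) ('D_(ez R) (dd 1 a) p) => x1 y1 z1.
move: ('D_(ex R) (dd 2 a) p) ('D_(ey R) (dd 2 a) p) ('D_(ez R) (dd 2 a) p) => x2 y2 z2.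
by ring.
Unshelve. all: end_near. Qed.

Lemma jacobian_flow0 p : A p -> `|\det (jacobian (flow a 0) p)| = 1.
Proof.
move=> Ap; rewrite (jacobian_flow 0 Ap).
have -> : \matrix_(i < 3, j < 3) coord j (dflow a p (e_ R i) (pdd p i) 0) = 1%:M.
  apply/matrixP => i j; rewrite !mxE dflow0 coord_e //.
  congr (_%:R); congr nat_of_bool; rewrite -val_eqE /=.
  by case: j => -[|[|[|//]]].
by rewrite det1 normr1.
Qed.

Lemma vact_frame M i (f : heis R -> R) p : differentiable f p ->
  vact (frame M i) f p = M i 0 * dd 1 f p + M i 1 * dd 2 f p.
Proof.
move=> df; rewrite /vact /frame !big_ord_recl big_ord0 addr0 derive_lin2 // !ddP.
by congr (M i _ * _ + M i _ * _); exact: val_inj.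
Qed.

Lemma vact_reeb (f : heis R -> R) p : vact (@reeb R) f p = dd 0 f p.
Proof. by rewrite ddP. Qed.

Lemma vact_reeb_fun (f : heis R -> R) : vact (@reeb R) f = dd 0 f.
Proof. by apply/funext => p; exact: vact_reeb. Qed.

Lemma vact_frame2 M i j p : A p -> vact (frame M i) (vact (frame M j) a) p =
  M i 0 * (M j 0 * dd 1 (dd 1 a) p + M j 1 * dd 1 (dd 2 a) p) +
  M i 1 * (M j 0 * dd 2 (dd 1 a) p + M j 1 * dd 2 (dd 2 a) p).
Proof.
move=> Ap.
have E : \forall q \near p, M j 0 * dd 1 a q + M j 1 * dd 2 a q = vact (frame M j) a q.
  apply: filterS (nearA oA Ap) => q Aq.
  by rewrite vact_frame //; exact: (C2_differentiable a2).
have H k := dd_differentiable oA a2 k Ap.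
have df : differentiable (fun q => M j 0 * dd 1 a q + M j 1 * dd 2 a q) p.
  by apply: difD; (apply: difM; [exact: difC|exact: H]).
rewrite vact_frame; last exact: near_differentiable E df.
have Dk k : dd k (vact (frame M j) a) p =
    M j 0 * dd k (dd 1 a) p + M j 1 * dd k (dd 2 a) p.
  rewrite [LHS]ddP -(near_derive _ E).
  have [_ E2] := derD (derM (derC (M j 0) p (X_ k p)) (der_dd oA a2 k 1 Ap))
    (derM (derC (M j 1) p (X_ k p)) (der_dd oA a2 k 2 Ap)).
  by rewrite !mul0r !add0r in E2; rewrite E2.
by rewrite !Dk.
Qed.

Definition Fcan (i : nat) p : R := nth 0 [:: F1 a p; F2 a p; F3 a p; F4 a p] i.

Lemma SO2_entries (M : 'M[R]_2) : SO2 M ->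
  [/\ M 1 0 = - M 0 1, M 1 1 = M 0 0 & M 0 0 ^+ 2 + M 0 1 ^+ 2 = 1].
Proof.
move=> [MM dM].
have e i j := congr1 (fun B : 'M[R]_2 => B i j) MM.
have o1 : lift (ord0 : 'I_2) ord0 = 1 by exact: val_inj.
have E00 := e 0 0; have E01 := e 0 1; have E11 := e 1 1.
rewrite !mxE !big_ord_recl !big_ord0 !mxE /= !addr0 ?o1 in E00 E01 E11.
have D : M 0 0 * M 1 1 - M 0 1 * M 1 0 = 1.
  rewrite -dM (expand_det_row _ 0) !big_ord_recl big_ord0 /cofactor !det_mx11 !mxE /= !o1.
  have -> : lift (1 : 'I_2) ord0 = 0 by exact: val_inj.
  by rewrite /bump /= expr0 expr1; ring.
move: E00 E01 E11 D; move: (M 0 0) (M 0 1) (M 1 0) (M 1 1) => x y z w.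
rewrite ?mulr1n ?mulr0n => E00 E01 E11 D.
split.
- apply/eqP; rewrite -subr_eq0 opprK; apply/eqP.
  (* The unit row and the unit determinant stand for two factors 1; what results is a multiple of
     the orthogonality relation [E01]. *)
  have -> : z + y = z * (x * x + y * y) + y * (x * w - y * z) by rewrite E00 D !mulr1.
  by rewrite [LHS](_ : _ = x * (x * z + y * w)); [rewrite E01 mulr0|ring].
- apply/eqP; rewrite -subr_eq0; apply/eqP.
  have -> : w - x = w * (x * x + y * y) - x * (x * w - y * z) by rewrite E00 D !mulr1.
  by rewrite [LHS](_ : _ = y * (x * z + y * w)); [rewrite E01 mulr0|ring].
- by rewrite !expr2.
Qed.

(** A constant rotation preserves the trace of the horizontal second derivatives, which is [F1], and
    the determinant of two planar vectors, which is [F2]; the other two functions involve only the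
    Reeb field. *)
Lemma Ffun_can (M : 'M[R]_2) i p : SO2 M -> A p -> Ffun M a i p = Fcan i p.
Proof.
move=> /SO2_entries[M10 M11 N] Ap; rewrite /Ffun /Fcan.
have da := C2_differentiable a2 Ap.
have d0 := dd_differentiable oA a2 0 Ap.
case: i => [|[|[|[|i]]]] //=.
- rewrite !vact_frame2 // M10 M11 /F1.
  move: (dd 1 (dd 1 a) p) (dd 1 (dd 2 a) p) (dd 2 (dd 1 a) p) (dd 2 (dd 2 a) p) => x y z w.
  rewrite -[x in RHS]mul1r -[w in RHS]mul1r -N.
  by move: (M 0 0) (M 0 1) => *; ring.
- rewrite vact_reeb_fun !vact_frame // M10 M11 /F2.
  move: (dd 1 a p) (dd 2 a p) (dd 1 (dd 0 a) p) (dd 2 (dd 0 a) p) => x y z w.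
  rewrite -[RHS]mul1r -N.
  by move: (M 0 0) (M 0 1) => *; ring.
- by rewrite vact_reeb.
- by rewrite !vact_reeb_fun.
Qed.

End Divergence.

(** * The recursion for iterated divergences *)

Section Iteration.
Import -(notations) mpoly.
Variable R : realType.
Notation poly := (mpoly 5 R).

Definition var (k : nat) : poly := mpolyX R (mnm1 (inord k : 'I_5)).

(** Variables 0 to 3 stand for [F1] to [F4], and variable 4 for [s]. *)
Definition drift (i : 'I_5) : poly :=
  nth 0 [:: - var 0 ^+ 2 - var 2 ^+ 2 + (var 1 + var 1); var 3 - var 0 * var 1; 0;
     - var 1 ^+ 2; - var 4 ^+ 2] i.

Definition divergence_polys (Q : nat -> poly) : Prop := Q 0%N = 1 /\
  forall k, exists2 T, transports drift (Q k) T & Q k.+1 = (var 0 - var 4) * Q k + T.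

Lemma divergence_polys_ex : exists Q, divergence_polys Q.
Proof.
have [T HT] := choice (transports_ex drift).
exists (fun k => iter k (fun Q => (var 0 - var 4) * Q + T Q) 1); split => // k.
by exists (T (iter k (fun Q => (var 0 - var 4) * Q + T Q) 1)).
Qed.

Variables (A : set (heis R)) (a : heis R -> R).
Hypotheses (oA : open A) (a2 : Ck_on 2 A a).
Hypothesis eik : forall p, A p -> dd 1 a p ^+ 2 + dd 2 a p ^+ 2 = 1.

Definition Fval (s : heis R -> R) (p : heis R) (i : 'I_5) : R :=
  if (i < 4)%N then Fcan a i p else s p.

Lemma near_flow_in p : A p -> \forall t \near (0 : R), A (flow a t p).
Proof.
move=> Ap; have [W [r [oW Wp r0 H]]] := flow_char oA a2 eik Ap.
apply/nbhs_ballP; exists r; first exact: r0.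
move=> t; rewrite -ball_normE /ball_ /= sub0r normrN => tr.
by have [] := H p t Wp tr.
Qed.

Lemma evalQ_can (M : 'M[R]_2) (Q : poly) s p : SO2 M -> A p ->
  evalQ Q M a (s p) p = meval (Fval s p) Q.
Proof.
move=> SM Ap; apply: meval_eq => i; rewrite /Fval; case: ifP => // _.
exact: (Ffun_can oA a2).
Qed.

(** The pullback of [Q_k * rho] under the flow is a product of three factors: the polynomial changes
    by its derivation, [rho] at the rate [- s], the Jacobian at the rate [F1]. Their sum is the
    recursion. The codimension and the surface enter only through [rho] and [s]. *)
Lemma iter_div_poly (Q : nat -> poly) (rho s : heis R -> R) (M : 'M[R]_2) (k : nat) :
  divergence_polys Q ->
  (forall p, A p -> is_derive (0 : R) 1 (fun t => rho (flow a t p)) (- (s p * rho p))) ->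
  (forall p, A p -> is_derive (0 : R) 1 (fun t => s (flow a t p)) (- s p ^+ 2)) ->
  SO2 M ->
  is_iter_div A rho (hgrad a) k (fun p => evalQ (Q k) M a (s p) p).
Proof.
move=> [Q0 QS] Drho Ds SM; elim: k => [|k IH].
  by move=> p Ap; rewrite Q0 /evalQ meval1 mul1r.
exists (fun p => evalQ (Q k) M a (s p) p * rho p) => // p Ap.
exists (flow a); first exact: (flow_local oA a2 eik).
have [T HT QE] := QS k.
pose v t := Fval s (flow a t p).
have v0 : v 0 = Fval s p by rewrite /v flow0.
have Dv i : is_derive (0 : R) 1 (fun t => v t i) (meval (v 0) (drift i)).
  rewrite v0; case: i => -[|[|[|[|[|//]]]]] lt5; rewrite /v /Fval /drift /Fcan /=.
  - apply: is_derive_eq (der_F1 oA a2 eik Ap) _.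
    rewrite !mevalD !mevalN !rmorphXn /= /var !mevalXU.
    by rewrite !inordK //=; ring.
  - apply: is_derive_eq (der_F2 oA a2 eik Ap) _.
    by rewrite mevalB mevalM /= /var !mevalXU !inordK.
  - by apply: is_derive_eq (der_F3 oA a2 eik Ap) _; rewrite meval0.
  - apply: is_derive_eq (der_F4 oA a2 eik Ap) _.
    by rewrite mevalN rmorphXn /= /var !mevalXU !inordK.
  - apply: is_derive_eq (Ds p Ap) _.
    by rewrite mevalN rmorphXn /= /var !mevalXU !inordK.
have [J [JE DJ J0]] : exists J : R -> R, [/\ forall t, J t = `|\det (jacobian (flow a t) p)|,
    is_derive (0 : R) 1 J (F1 a p) & J 0 = 1].
  exists (fun t => `|\det (jacobian (flow a t) p)|); split; first by [].
    exact: (der0_jacobian oA a2).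
  exact: (jacobian_flow0 oA a2).
have D := derM (derM (HT v Dv) (Drho p Ap)) DJ.
rewrite !flow0 v0 J0 mulr1 in D.
have E : \forall t \near (0 : R), meval (v t) (Q k) * rho (flow a t p) * J t =
   pullback (flow a t) (fun p => evalQ (Q k) M a (s p) p * rho p) p.
  apply: filterS (near_flow_in Ap) => t At.
  by rewrite /pullback evalQ_can // JE.
apply: near_is_derive E _; apply: is_derive_eq D _.
have V0 : Fval s p (inord 0) = F1 a p by rewrite /Fval !inordK.
have V4 : Fval s p (inord 4) = s p by rewrite /Fval !inordK.
rewrite evalQ_can // QE mevalD mevalM mevalB /var !mevalXU V0 V4.
by move: (meval _ _) (meval _ _) (F1 a p) => *; ring.
Qed.

End Iteration.

(** * Left-invariant densities *)

Section LeftInvariant.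
Variable R : realType.

Lemma hmul_jacobian (g p : heis R) : \det (jacobian (hmul g) p) = 1.
Proof.
have dx := xc_differentiable p; have dy := yc_differentiable p; have dz := zc_differentiable p.
rewrite jacobianE; last by apply: vec3_differentiable; dif.
pose F i j := coord j (vec3 (xc (e_ R i)) (yc (e_ R i))
  (zc (e_ R i) + 2^-1 * (xc g * yc (e_ R i) - xc (e_ R i) * yc g))).
have -> : \matrix_(i < 3, j < 3) coord j ('D_(e_ R i) (hmul g) p) = \matrix_(i < 3, j < 3) F i j.
  apply/matrixP => i j; rewrite !mxE /F; congr coord.
  have [Dx Dy Dz] := And3 (dxc p (e_ R i)) (dyc p (e_ R i)) (dzc p (e_ R i)).
  have DX := derD (derC (xc g) p (e_ R i)) Dx; rewrite add0r in DX.
  have DY := derD (derC (yc g) p (e_ R i)) Dy; rewrite add0r in DY.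
  have DZ := derD (derD (derC (zc g) p (e_ R i)) Dz) (derM (derC 2^-1 p (e_ R i))
    (derB (derM (derC (xc g) p (e_ R i)) Dy) (derM Dx (derC (yc g) p (e_ R i))))).
  have [//|//|//|_ ->] := @is_derive_vec3 _ _ (hmul g) p (e_ R i) (xc (e_ R i)) (yc (e_ R i)) 
    (zc (e_ R i) + 2^-1 * (xc g * yc (e_ R i) - xc (e_ R i) * yc g)).
  - by apply: near_is_derive DX; near=> q; rewrite /hmul coordE.
  - by apply: near_is_derive DY; near=> q; rewrite /hmul coordE.
  - apply: (@near_is_derive _ _ _ (fun q => zc g + zc q + 2^-1 * (xc g * yc q - xc q * yc g))).
      by near=> q; rewrite /hmul coordE.
    by apply: is_derive_eq DZ _; ring.
  - by [].
rewrite det3 /F /coord /e_ /ex /ey /ez !coordE /=.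
by ring.
Unshelve. all: end_near. Qed.

(** Left translation by [p] carries 0 to [p] with Jacobian determinant 1. *)
Lemma left_invariant_cst (mu : heis R -> R) : left_invariant mu -> forall p, mu p = mu 0.
Proof.
move=> inv p; have := inv p 0; rewrite /pullback hmul_jacobian normr1 mulr1 => <-.
by congr mu; apply: heis_eq; rewrite /hmul !coordE /xc /yc /zc !mxE; ring.
Qed.

End LeftInvariant.

(** * The Hamiltonian flow and the exponential map in closed form *)

Section HamiltonianFlow.
Variable R : realType.
Implicit Types (l v : coheis R) (s t : R).

(** The momenta of a covector: its pairings with [X_ 1], [X_ 2] and [X_ 0]. In them Hamilton's
    equations become a rotation of [(mom1, mom2)] with constant [mom0]. *)
Definition mom1 l : R := xc l.2 - yc l.1 / 2 * zc l.2.
Definition mom2 l : R := yc l.2 + xc l.1 / 2 * zc l.2.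
Definition mom0 l : R := zc l.2.

Lemma pairingE (eta v : heis R) : pairing eta v = xc eta * xc v + yc eta * yc v + zc eta * zc v.
Proof.
rewrite /pairing !big_ord_recl big_ord0 addr0 -addrA.
by rewrite /xc /yc /zc; congr (eta _ _ * v _ _ + (eta _ _ * v _ _ + eta _ _ * v _ _)); exact: val_inj.
Qed.

Lemma hamE l : ham l = 2^-1 * (mom1 l ^+ 2 + mom2 l ^+ 2).
Proof.
rewrite /ham !big_ord_recl big_ord0 addr0 !pairingE /Xbar /= !coordE /mom1 /mom2.
by congr (_ * (_ ^+ 2 + _ ^+ 2)); ring.
Qed.

Lemma fst_differentiable (V W : normedModType R) (x : V * W) : differentiable (fst : V * W -> V) x.
Proof. by apply: linear_differentiable => z; exact: cvg_fst. Qed.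
Lemma snd_differentiable (V W : normedModType R) (x : V * W) : differentiable (snd : V * W -> W) x.
Proof. by apply: linear_differentiable => z; exact: cvg_snd. Qed.

Lemma der_fst (V W : normedModType R) (f : V -> R) (l v : V * W) d :
  is_derive l.1 v.1 f d -> is_derive l v (fun x => f x.1) d.
Proof. by move=> /is_derive_line D; apply/is_derive_line. Qed.
Lemma der_snd (V W : normedModType R) (f : W -> R) (l v : V * W) d :
  is_derive l.2 v.2 f d -> is_derive l v (fun x => f x.2) d.
Proof. by move=> /is_derive_line D; apply/is_derive_line. Qed.

Lemma der_ham l v : is_derive l v (@ham R)
  (mom1 l * (xc v.2 - (yc v.1 / 2 * zc l.2 + yc l.1 / 2 * zc v.2)) +
   mom2 l * (yc v.2 + (xc v.1 / 2 * zc l.2 + xc l.1 / 2 * zc v.2))).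
Proof.
have -> : @ham R = (fun k => 2^-1 * (mom1 k ^+ 2 + mom2 k ^+ 2)).
  by apply/funext => k; exact: hamE.
have Dx1 := @der_fst _ _ _ l v _ (dxc l.1 v.1); have Dy1 := @der_fst _ _ _ l v _ (dyc l.1 v.1).
have Dx2 := @der_snd _ _ _ l v _ (dxc l.2 v.2); have Dy2 := @der_snd _ _ _ l v _ (dyc l.2 v.2).
have Dz2 := @der_snd _ _ _ l v _ (dzc l.2 v.2).
have c2 := derC (2^-1 : R) l v.
have D1 := derB Dx2 (derM (derM Dy1 c2) Dz2).
have D2 := derD Dy2 (derM (derM Dx1 c2) Dz2).
apply: is_derive_eq (derM c2 (derD (derX 2 D1) (derX 2 D2))) _.
by rewrite /mom1 /mom2 /=; field.
Qed.

Lemma ham_vecE l : ham_vec l =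
  (vec3 (mom1 l) (mom2 l) ((xc l.1 * mom2 l - yc l.1 * mom1 l) / 2),
   vec3 (- (mom2 l * mom0 l / 2)) (mom1 l * mom0 l / 2) 0).
Proof.
have E v : 'D_v (@ham R) l = mom1 l * (xc v.2 - (yc v.1 / 2 * zc l.2 + yc l.1 / 2 * zc v.2)) +
   mom2 l * (yc v.2 + (xc v.1 / 2 * zc l.2 + xc l.1 / 2 * zc v.2)).
  by case: (der_ham l v).
have x0 : xc (0 : heis R) = 0 by rewrite /xc mxE.
have y0 : yc (0 : heis R) = 0 by rewrite /yc mxE.
have z0 : zc (0 : heis R) = 0 by rewrite /zc mxE.
rewrite /ham_vec /mom0; congr pair; apply: heis_eq; rewrite !coordE.
- by rewrite /xc mxE E delta_e /e_ /ex /= !coordE ?x0 ?y0 ?z0; field.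
- by rewrite /yc mxE E delta_e /e_ /ey /= !coordE ?x0 ?y0 ?z0; field.
- by rewrite /zc mxE E delta_e /e_ /ez /= !coordE ?x0 ?y0 ?z0; field.
- by rewrite /xc !mxE E delta_e /e_ /ex /= !coordE ?x0 ?y0 ?z0; field.
- by rewrite /yc !mxE E delta_e /e_ /ey /= !coordE ?x0 ?y0 ?z0; field.
- by rewrite /zc !mxE E delta_e /e_ /ez /= !coordE ?x0 ?y0 ?z0; field.
Qed.

(** The second component is the covector over the geodesic with momenta [rot1], [rot2] and [mom0 l],
    converted back to coordinates. *)
Definition ham_sol l t : coheis R :=
  let g := geo l.1 (mom1 l) (mom2 l) (mom0 l) t in
  (g, vec3 (rot1 (mom1 l) (mom2 l) (mom0 l) t + yc g / 2 * mom0 l)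
           (rot2 (mom1 l) (mom2 l) (mom0 l) t - xc g / 2 * mom0 l) (mom0 l)).

Lemma mom_ham_sol l t : mom1 (ham_sol l t) = rot1 (mom1 l) (mom2 l) (mom0 l) t /\
  mom2 (ham_sol l t) = rot2 (mom1 l) (mom2 l) (mom0 l) t.
Proof. by rewrite /ham_sol /mom1 /mom2 /= !coordE; split; ring. Qed.

Lemma is_derive_pair (V W : normedModType R) (f : R -> V) (g : R -> W) (t : R) (v : V) (w : W) :
  is_derive t 1 f v -> is_derive t 1 g w -> is_derive t 1 (fun s => (f s, g s)) (v, w).
Proof.
move=> [/derivable1_diffP df <-] [/derivable1_diffP dg <-].
have d := differentiable_pair df dg.
split; first exact: diff_derivable.
by rewrite !deriveE // diff_pair.
Qed.

Lemma der_curve_fst (V W : normedModType R) (c : R -> V * W) (t : R) w :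
  is_derive t 1 c w -> is_derive t 1 (fun s => (c s).1) w.1.
Proof.
move=> D; have dfst := @fst_differentiable _ _ (c t).
apply: is_derive_eq (chain_curve dfst D) _.
by rewrite deriveE // diff_lin // => z; exact: cvg_fst.
Qed.

Lemma der_curve_snd (V W : normedModType R) (c : R -> V * W) (t : R) w :
  is_derive t 1 c w -> is_derive t 1 (fun s => (c s).2) w.2.
Proof.
move=> D; have dsnd := @snd_differentiable _ _ (c t).
apply: is_derive_eq (chain_curve dsnd D) _.
by rewrite deriveE // diff_lin // => z; exact: cvg_snd.
Qed.

Lemma der_ham_sol l t : is_derive t 1 (ham_sol l) (ham_vec (ham_sol l t)).
Proof.
have [E1 E2] := mom_ham_sol l t.
rewrite ham_vecE E1 E2; have E0 : mom0 (ham_sol l t) = mom0 l by rewrite /mom0 /ham_sol /= coordE.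
rewrite E0.
have Dg := der_geo l.1 (mom1 l) (mom2 l) (mom0 l) t.
apply: is_derive_pair.
  by apply: is_derive_eq Dg _; apply: heis_eq; rewrite /= !coordE; field.
have [Dx Dy _] := is_derive_coord Dg.
have c2 := derC (2^-1 : R) t 1; have c0 := derC (mom0 l) t 1.
have DX := derD (der_rot1 (mom1 l) (mom2 l) (mom0 l) t) (derM (derM Dy c2) c0).
have DY := derB (der_rot2 (mom1 l) (mom2 l) (mom0 l) t) (derM (derM Dx c2) c0).
apply: is_derive_vec3.
- apply: (@near_is_derive _ _ _ (fun s => rot1 (mom1 l) (mom2 l) (mom0 l) s +
    yc (geo l.1 (mom1 l) (mom2 l) (mom0 l) s) / 2 * mom0 l)).
    by near=> s; rewrite coordE.
  by apply: is_derive_eq DX _; rewrite !coordE; field.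
- apply: (@near_is_derive _ _ _ (fun s => rot2 (mom1 l) (mom2 l) (mom0 l) s -
    xc (geo l.1 (mom1 l) (mom2 l) (mom0 l) s) / 2 * mom0 l)).
    by near=> s; rewrite coordE.
  by apply: is_derive_eq DY _; rewrite !coordE; field.
- by apply: near_is_derive (c0); near=> s; rewrite coordE.
Unshelve. all: end_near. Qed.

Lemma ham_sol0 l : ham_sol l 0 = l.
Proof.
rewrite /ham_sol geo0 /rot1 /rot2 mulr0 cos0 sin0 /mom1 /mom2 /mom0.
case: l => q eta /=; congr pair; apply: heis_eq; rewrite !coordE //; ring.
Qed.

Lemma cst_of_der0 (f : R -> R) (d : R -> R) t : (forall s, is_derive s 1 f (d s)) ->
  (forall s, d s = 0) -> f t = f 0.
Proof.
move=> fd d0; apply: is_derive_0_is_cst => s.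
by rewrite -(d0 s).
Qed.

(** [ham_flow] is a choice among endpoints of solution curves, so uniqueness is what identifies it
    with the explicit solution. *)
Lemma ham_sol_unique l (c : R -> coheis R) t : c 0 = l ->
  (forall s, is_derive s 1 c (ham_vec (c s))) ->
  (c t).1 = geo l.1 (mom1 l) (mom2 l) (mom0 l) t.
Proof.
move=> c0 Dc.
have D1 s : is_derive s 1 (fun s => (c s).1) (vec3 (mom1 (c s)) (mom2 (c s))
   ((xc (c s).1 * mom2 (c s) - yc (c s).1 * mom1 (c s)) / 2)).
  by have := der_curve_fst (Dc s); rewrite ham_vecE.
have D2 s : is_derive s 1 (fun s => (c s).2) (vec3 (- (mom2 (c s) * mom0 (c s) / 2))
   (mom1 (c s) * mom0 (c s) / 2) 0).
  by have := der_curve_snd (Dc s); rewrite ham_vecE.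
have Dx s : is_derive s 1 (fun s => xc (c s).1) (mom1 (c s)).
  by have [D _ _] := is_derive_coord (D1 s); rewrite coordE in D.
have Dy s : is_derive s 1 (fun s => yc (c s).1) (mom2 (c s)).
  by have [_ D _] := is_derive_coord (D1 s); rewrite coordE in D.
have Dz s : is_derive s 1 (fun s => zc (c s).1)
    ((xc (c s).1 * mom2 (c s) - yc (c s).1 * mom1 (c s)) / 2).
  by have [_ _ D] := is_derive_coord (D1 s); rewrite coordE in D.
have Dex s : is_derive s 1 (fun s => xc (c s).2) (- (mom2 (c s) * mom0 (c s) / 2)).
  by have [D _ _] := is_derive_coord (D2 s); rewrite coordE in D.
have Dey s : is_derive s 1 (fun s => yc (c s).2) (mom1 (c s) * mom0 (c s) / 2).
  by have [_ D _] := is_derive_coord (D2 s); rewrite coordE in D.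
have Dez s : is_derive s 1 (fun s => mom0 (c s)) 0.
  by have [_ _ D] := is_derive_coord (D2 s); rewrite coordE in D.
have M0 s : mom0 (c s) = mom0 l.
  by rewrite -c0; apply: (@cst_of_der0 (fun s => mom0 (c s)) (fun _ => 0)).
have Dm1 s : is_derive s 1 (fun s => mom1 (c s)) (- (mom0 l * mom2 (c s))).
  apply: is_derive_eq (derB (Dex s) (derM (derM (Dy s) (derC 2^-1 _ _)) (Dez s))) _.
  by rewrite M0; field.
have Dm2 s : is_derive s 1 (fun s => mom2 (c s)) (mom0 l * mom1 (c s)).
  apply: is_derive_eq (derD (Dey s) (derM (derM (Dx s) (derC 2^-1 _ _)) (Dez s))) _.
  by rewrite M0; field.
pose k1 := rot1 (mom1 l) (mom2 l) (mom0 l); pose k2 := rot2 (mom1 l) (mom2 l) (mom0 l).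
have Dk1 s : is_derive s 1 k1 (- (mom0 l * k2 s)) by exact: der_rot1.
have Dk2 s : is_derive s 1 k2 (mom0 l * k1 s) by exact: der_rot2.
have k10 : k1 0 = mom1 l by rewrite /k1 /rot1 mulr0 cos0 sin0; ring.
have k20 : k2 0 = mom2 l by rewrite /k2 /rot2 mulr0 cos0 sin0; ring.
(* Both pairs solve the same rotation equation, so the square of their distance has derivative 0. *)
have EM s : mom1 (c s) = k1 s /\ mom2 (c s) = k2 s.
  have De s := derD (derX 2 (derB (Dm1 s) (Dk1 s))) (derX 2 (derB (Dm2 s) (Dk2 s))).
  have := cst_of_der0 s De; rewrite c0 k10 k20 !subrr expr0n addr0 => H.
  have /eqP : (mom1 (c s) - k1 s) ^+ 2 + (mom2 (c s) - k2 s) ^+ 2 = 0.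
    by apply: H => r /=; ring.
  rewrite paddr_eq0 ?sqr_ge0 // !sqrf_eq0 !subr_eq0 => /andP[/eqP-> /eqP->].
  by [].
pose g := geo l.1 (mom1 l) (mom2 l) (mom0 l).
have Dg s := is_derive_coord (der_geo l.1 (mom1 l) (mom2 l) (mom0 l) s).
have g0 : g 0 = l.1 by rewrite /g geo0.
have Ex s : xc (c s).1 = xc (g s).
  have De r := derB (Dx r) (let: And3 D _ _ := Dg r in D).
  have := cst_of_der0 s De; rewrite c0 -/g g0 subrr => H.
  apply/eqP; rewrite -subr_eq0; apply/eqP; apply: H => r.
  by have [-> _] := EM r; rewrite !coordE -/(k1 r) -/(k2 r); ring.
have Ey s : yc (c s).1 = yc (g s).
  have De r := derB (Dy r) (let: And3 _ D _ := Dg r in D).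
  have := cst_of_der0 s De; rewrite c0 -/g g0 subrr => H.
  apply/eqP; rewrite -subr_eq0; apply/eqP; apply: H => r.
  by have [_ ->] := EM r; rewrite !coordE -/(k1 r) -/(k2 r); ring.
have Ez s : zc (c s).1 = zc (g s).
  have De r := derB (Dz r) (let: And3 _ _ D := Dg r in D).
  have := cst_of_der0 s De; rewrite c0 -/g g0 subrr => H.
  apply/eqP; rewrite -subr_eq0; apply/eqP; apply: H => r.
  have [-> ->] := EM r; rewrite Ex Ey !coordE -/(k1 r) -/(k2 r) -/(g r).
  by field.
exact: heis_eq.
Qed.

Lemma hexpE l : hexp l = geo l.1 (mom1 l) (mom2 l) (mom0 l) 1.
Proof.
rewrite /hexp /ham_flow.
set P := [set l' | _].
have /getPex : exists l', P l'.
  exists (ham_sol l 1), (ham_sol l); split => //; first exact: ham_sol0.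
  by move=> s; exact: der_ham_sol.
move=> [c [c0 Dc <-]]; exact: ham_sol_unique.
Qed.

(** Homogeneity of geodesics: scaling the covector amounts to scaling time. *)
Lemma geo_scale (q : heis R) (k1 k2 k0 t : R) :
  geo q (t * k1) (t * k2) (t * k0) 1 = geo q k1 k2 k0 t.
Proof.
rewrite /geo; have C : t * k0 * 1 = k0 * t by ring.
have -> : geo_x (t * k1) (t * k2) (t * k0) 1 = geo_x k1 k2 k0 t.
  by rewrite /geo_x C; ring.
have -> : geo_y (t * k1) (t * k2) (t * k0) 1 = geo_y k1 k2 k0 t.
  by rewrite /geo_y C; ring.
have -> : geo_z (t * k1) (t * k2) (t * k0) 1 = geo_z k1 k2 k0 t.
  by rewrite /geo_z C; field.
by [].
Qed.

Lemma hexp_cscale l t : hexp (Defs.cscale t l) = geo l.1 (mom1 l) (mom2 l) (mom0 l) t.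
Proof.
have E1 : mom1 (Defs.cscale t l) = t * mom1 l by rewrite /mom1 /= !coordE; ring.
have E2 : mom2 (Defs.cscale t l) = t * mom2 l by rewrite /mom2 /= !coordE; ring.
have E0 : mom0 (Defs.cscale t l) = t * mom0 l by rewrite /mom0 /= !coordE; ring.
by rewrite hexpE E1 E2 E0 geo_scale.
Qed.

Lemma ham2E l : 2 * ham l = mom1 l ^+ 2 + mom2 l ^+ 2.
Proof. by rewrite hamE; field. Qed.

Lemma hexp_zero (q : heis R) : hexp (q, 0) = q.
Proof.
have z : (q, 0) = Defs.cscale 0 (q, 0) :> coheis R by rewrite /Defs.cscale /= scale0r.
by rewrite z hexp_cscale geo0.
Qed.

End HamiltonianFlow.

(** * Local minima, and the unsigned distance on the tube *)

Section LocalMin.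
Variable R : realType.

Lemma right_min_derive (f : R -> R) (d : R) : is_derive (0 : R) 1 f d ->
  (\forall t \near (0 : R), f 0 <= f t) -> 0 <= d.
Proof.
move=> /is_derive1_cvg fd fmin; rewrite leNgt; apply/negP => d0.
have fd' : (fun h => h^-1 * (f (0 + h) - f 0)) @ 0^'+ --> d.
  exact: cvg_dnbhs_at_right fd.
have n1 : \forall t \near (0 : R)^'+, t^-1 * (f (0 + t) - f 0) < 0.
  by apply: (cvgr_lt _ fd').
have n2 : \forall t \near (0 : R)^'+, f 0 <= f t.
  by apply: filterS fmin => t.
have n3 : \forall t \near (0 : R)^'+, 0 < t by exact: nbhs_right_gt.
have [t [[t1 t2] t3]] := filter_ex (filterI (filterI n1 n2) n3).
move: t1; rewrite add0r => t1.
have : 0 <= t^-1 * (f t - f 0) by rewrite mulr_ge0 ?invr_ge0 ?subr_ge0 // ltW.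
by rewrite leNgt t1.
Qed.

Lemma local_min_derive (f : R -> R) (d : R) : is_derive (0 : R) 1 f d ->
  (\forall t \near (0 : R), f 0 <= f t) -> d = 0.
Proof.
move=> fd fmin; apply/eqP; rewrite eq_le (right_min_derive fd fmin) andbT.
rewrite -oppr_ge0; apply: (@right_min_derive (fun t => f (- t))).
- have fd' : is_derive (- (0 : R)) 1 f d by rewrite oppr0.
  apply: is_derive_eq (@der1comp _ _ f (fun t => - t) _ _ _ _ fd' (derN (is_derive_id _ _))) _.
  by rewrite mulrN1.
- rewrite oppr0; have : (fun t : R => - t) @ 0 --> (0 : R).
    by rewrite -[X in _ --> X]oppr0; apply: cvgN; exact: cvg_id.
  by move=> c; exact: (c _ fmin).
Qed.

End LocalMin.

Section Tube.
Variable R : realType.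
Variables (S : set (heis R)) (eps : heis R -> R).
Hypothesis tub : tubular S eps.
Let U := tubU S eps.
Let V := tubV S eps.
Let delta := sdist S.

Lemma tub_eps p : S p -> 0 < eps p. Proof. by case: tub => _ [+ _]; apply. Qed.
Lemma tub_open : open U. Proof. by case: tub => _ [_ []]. Qed.
Lemma tub_diffeo : Ck_diffeo 1 V U (@hexp R).
Proof. by case: tub => _ [_ [_ []]]. Qed.
Lemma tub_delta l : V l -> delta (hexp l) = Num.sqrt (2 * ham l).
Proof. by case: tub => _ [_ [_ [_ [_ [+ _]]]]]; apply. Qed.
Lemma tub_C2 : Ck_on 2 (U `\` S) delta.
Proof. by case: tub => _ [_ [_ [_ [_ [_ [+ _]]]]]]. Qed.
Lemma tub_norm p : (U `\` S) p -> hgrad_norm delta p = 1.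
Proof. by case: tub => _ [_ [_ [_ [_ [_ [_ [+ _]]]]]]]; apply. Qed.
Lemma tub_sq : Ck_on 2 U (fun p => delta p ^+ 2).
Proof. by case: tub => _ [_ [_ [_ [_ [_ [_ [_ [+ _]]]]]]]]. Qed.

Lemma tubV_scale l t : annihilator S l -> `|t| * Num.sqrt (2 * ham l) < eps l.1 -> V (Defs.cscale t l).
Proof.
move=> [Sl al] tl; split; first split => //= v /al.
  by rewrite !pairingE !coordE => E; rewrite -!mulrA -!mulrDr E mulr0.
rewrite /= ham2E.
have -> : mom1 (Defs.cscale t l) ^+ 2 + mom2 (Defs.cscale t l) ^+ 2 = t ^+ 2 * (2 * ham l).
  by rewrite ham2E /mom1 /mom2 /= !coordE; ring.
by rewrite sqrtrM ?sqr_ge0 // sqrtr_sqr.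
Qed.

Lemma tubV_zero q : S q -> V (q, 0).
Proof.
move=> Sq; split; first split => //= v _.
  by rewrite pairingE /xc /yc /zc !mxE !mul0r !addr0.
rewrite ham2E /mom1 /mom2 /= /xc /yc /zc !mxE.
by rewrite !mulr0 subrr addr0 expr0n /= addr0 sqrtr0; exact: tub_eps.
Qed.

Lemma tub_S q : S q -> U q /\ delta q = 0.
Proof.
move=> Sq; have V0 := tubV_zero Sq; split.
  by exists (q, 0) => //; exact: hexp_zero.
have := tub_delta V0; rewrite hexp_zero => ->.
rewrite ham2E /mom1 /mom2 /= /xc /yc /zc !mxE.
by rewrite !mulr0 subrr addr0 expr0n /= addr0 sqrtr0.
Qed.

Lemma tub_ge0 p : U p -> 0 <= delta p.
Proof. by move=> [l Vl <-]; rewrite tub_delta // sqrtr_ge0. Qed.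

Lemma eik_of_norm (a : heis R -> R) p : hgrad_norm a p = 1 ->
  dd 1 a p ^+ 2 + dd 2 a p ^+ 2 = 1.
Proof.
rewrite /hgrad_norm !big_ord_recl big_ord0 addr0 /vact !ddP => /(congr1 (fun x => x ^+ 2)).
by rewrite expr1n sqr_sqrtr // addr_ge0 // sqr_ge0.
Qed.

(** A zero of [delta] in [U] is a local minimum, where every frame derivative vanishes; off [S] this
    contradicts the eikonal equation. *)
Lemma delta_gt0 p : (U `\` S) p -> 0 < delta p.
Proof.
move=> US; have [Up nS] := US; rewrite lt_neqAle tub_ge0 // andbT eq_sym.
apply/negP => /eqP d0.
have [df _] := tub_C2; have dp := df p US.
have D0 i : dd i delta p = 0.
  rewrite ddP; apply: (@local_min_derive _ (fun s : R => delta (p + s *: X_ i p))).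
    have dv : derivable delta p (X_ i p) by exact: diff_derivable.
    by have /is_derive_line D := derivableP dv.
  have c : (fun s : R => p + s *: X_ i p) @ 0 --> p.
    have E : p = p + 0 *: X_ i p by rewrite scale0r addr0.
    rewrite [X in _ --> X]E.
    apply: cvgD; first exact: cvg_cst.
    by apply: cvgZr_tmp; exact: cvg_id.
  have cU : \forall s \near (0 : R), U (p + s *: X_ i p).
    exact: (c _ (open_nbhs_nbhs (conj tub_open Up))).
  by apply: filterS cU => s Us; rewrite scale0r addr0 d0; exact: tub_ge0.
have := eik_of_norm (tub_norm US); rewrite !D0 expr0n addr0 => /eqP.
by rewrite eq_sym oner_eq0.
Qed.

(** Inside [U] the complement of [S] is the set where [delta ^+ 2], continuous across [S], is
    positive. No closedness of [S] is used. *)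
Lemma tub_diff_open : open (U `\` S).
Proof.
rewrite openE => p US; have [Up nS] := US.
have [df _] := tub_sq; have cf := differentiable_continuous (df p Up).
have n1 : \forall q \near p, 0 < delta q ^+ 2.
  by apply: (cvgr_gt _ cf); rewrite exprn_gt0 // delta_gt0.
have n2 : \forall q \near p, U q by exact: open_nbhs_nbhs (conj tub_open Up).
apply: filterS (filterI n1 n2) => q [q1 Uq]; split => // Sq.
by move: q1; have [_ ->] := tub_S Sq; rewrite expr0n ltxx.
Qed.

Lemma tub_eik p : (U `\` S) p -> dd 1 delta p ^+ 2 + dd 2 delta p ^+ 2 = 1.
Proof. by move=> US; exact/eik_of_norm/tub_norm. Qed.

Lemma unsigned_frame (M M' : 'M[R]_2) i p : SO2 M -> SO2 M' -> (U `\` S) p ->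
  Ffun M delta i p = Ffun M' delta i p.
Proof.
by move=> SM SM' US; rewrite !(Ffun_can tub_diff_open tub_C2 _ _ US).
Qed.

Lemma unsigned_div (mu : heis R -> R) (c : R) (Q : nat -> mpoly.mpoly 5 R) (m k : nat)
    (M : 'M[R]_2) :
  (forall p, mu p = c) -> (m = 1 \/ m = 2)%N ->
  divergence_polys Q ->
  SO2 M ->
  is_iter_div (U `\` S) (fun p => mu p / delta p ^+ m.-1) (hgrad delta) k
    (fun p => evalQ (Q k) M delta (m.-1%:R / delta p) p).
Proof.
move=> muc m12 HQ SM.
apply: (iter_div_poly tub_diff_open tub_C2 tub_eik (rho := fun p => mu p / delta p ^+ m.-1)
  (s := fun p => m.-1%:R / delta p)) => // p US.
- have d0 := delta_gt0 US; have dn : delta p != 0 by rewrite gt_eqF.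
  have Da := der_a tub_C2 tub_eik US.
  have E : (fun t => mu (flow delta t p) / delta (flow delta t p) ^+ m.-1) =
    (fun t => c * (delta (flow delta t p) ^+ m.-1)^-1).
    by apply/funext => t; rewrite muc.
  rewrite E muc; case: m12 => ->.
    rewrite /= mul0r mul0r oppr0.
    by apply: (@near_is_derive _ _ _ (fun _ => c)); [near=> t; rewrite expr0 invr1 mulr1|exact: derC].
  have dn' : delta (flow delta 0 p) != 0 by rewrite flow0.
  have D := derM (derC c (0 : R) 1) (@derV _ _ (fun t => delta (flow delta t p)) (0 : R) 1 _ dn' Da).
  apply: (@near_is_derive _ _ _ (fun t => c * (delta (flow delta t p))^-1)).
    by near=> t; rewrite expr1.
  by apply: is_derive_eq D _; rewrite flow0 /= expr1; field.
- have d0 := delta_gt0 US; have dn : delta p != 0 by rewrite gt_eqF.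
  have Da := der_a tub_C2 tub_eik US.
  have dn' : delta (flow delta 0 p) != 0 by rewrite flow0.
  apply: is_derive_eq (derM (derC m.-1%:R _ _) (@derV _ _ (fun t => delta (flow delta t p)) (0 : R) 1 _ dn' Da)) _.
  (* The derivative [- (m - 1) / delta ^+ 2] equals [- s ^+ 2] because [m - 1] is 0 or 1, hence its
     own square. *)
  by rewrite flow0; case: m12 => -> /=; field.
Unshelve. all: end_near. Qed.

End Tube.

(** * Calculus of C^1 functions *)

Section C1Calculus.
Variables (R : realType) (V : normedModType R) (A : set V).
Hypothesis oA : open A.
Implicit Types (f g : V -> R).

Lemma Ck_lin (W W' : normedModType R) (L : W -> W') k (f : V -> W) :
  (forall y, differentiable L y) -> (forall y w, 'D_w L y = L w) ->
  Ck_on k A f -> Ck_on k A (fun x => L (f x)).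
Proof.
move=> dL DL; elim: k f => [|k IH] f /=.
  move=> cf x Ax; apply: (@continuous_comp _ _ _ f L); first exact: cf.
  exact: differentiable_continuous (dL (f x)).
move=> [df Df]; split=> [x Ax|v]; first exact: difcomp (df x Ax) (dL (f x)).
apply: (@Ck_on_eq _ _ _ _ _ (fun x => L ('D_v f x))) => //; last exact: IH.
move=> x Ax; have [_ E] := chain (dL (f x)) (df x Ax) (erefl ('D_v f x)).
by rewrite -[RHS]/('D_v (L \o f) x) E DL.
Qed.

Lemma C1_intro f (d : V -> V -> R) : (forall x, A x -> differentiable f x) ->
  (forall v x, A x -> 'D_v f x = d v x) ->
  (forall v x, A x -> {for x, continuous (d v)}) -> Ck_on 1 A f.
Proof.
move=> df Df cd; split=> // v; apply: (@Ck_on_eq _ _ _ 0 _ (d v)) => //.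
  by move=> x Ax; rewrite Df.
by move=> x Ax; exact: cd.
Qed.

Lemma C1_diff f x : Ck_on 1 A f -> A x -> differentiable f x.
Proof. by case=> + _; apply. Qed.

Lemma C1_der f x v : Ck_on 1 A f -> A x -> is_derive x v f ('D_v f x).
Proof. by move=> Cf Ax; apply/derivableP/diff_derivable; exact: C1_diff. Qed.

Lemma C1_cont f x : Ck_on 1 A f -> A x -> {for x, continuous f}.
Proof. by move=> Cf Ax; apply: differentiable_continuous; exact: C1_diff. Qed.

Lemma C1_dcont f x v : Ck_on 1 A f -> A x -> {for x, continuous ('D_v f)}.
Proof. by case=> _ /(_ v); apply. Qed.

Lemma C1C (c : R) : Ck_on 1 A (fun _ => c).
Proof.
apply: (@C1_intro _ (fun _ _ => 0)) => [x _|v x _|v x _]; first exact: difC.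
- by have [_] := derC c x v.
- exact: contC.
Qed.

Lemma C1D f g : Ck_on 1 A f -> Ck_on 1 A g -> Ck_on 1 A (fun x => f x + g x).
Proof.
move=> Cf Cg; apply: (@C1_intro _ (fun v x => 'D_v f x + 'D_v g x)).
- by move=> x Ax; apply: difD; apply: C1_diff.
- by move=> v x Ax; have [_] := derD (C1_der v Cf Ax) (C1_der v Cg Ax).
- by move=> v x Ax; apply: contD; apply: C1_dcont.
Qed.

Lemma C1N f : Ck_on 1 A f -> Ck_on 1 A (fun x => - f x).
Proof.
move=> Cf; apply: (@C1_intro _ (fun v x => - 'D_v f x)).
- by move=> x Ax; apply: difN; apply: C1_diff.
- by move=> v x Ax; have [_] := derN (C1_der v Cf Ax).
- by move=> v x Ax; apply: contN; apply: C1_dcont.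
Qed.

Lemma C1B f g : Ck_on 1 A f -> Ck_on 1 A g -> Ck_on 1 A (fun x => f x - g x).
Proof. by move=> Cf Cg; exact: (C1D Cf (C1N Cg)). Qed.

Lemma C1M f g : Ck_on 1 A f -> Ck_on 1 A g -> Ck_on 1 A (fun x => f x * g x).
Proof.
move=> Cf Cg; apply: (@C1_intro _ (fun v x => 'D_v f x * g x + f x * 'D_v g x)).
- by move=> x Ax; apply: difM; apply: C1_diff.
- by move=> v x Ax; have [_] := derM (C1_der v Cf Ax) (C1_der v Cg Ax).
- move=> v x Ax; apply: contD; apply: contM; try exact: C1_dcont; exact: C1_cont.
Qed.

Lemma C1comp1 (B : set R) (k dk : R -> R) f : (forall y, B y -> is_derive y 1 k (dk y)) ->
  (forall y, B y -> {for y, continuous dk}) -> (forall x, A x -> B (f x)) ->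
  Ck_on 1 A f -> Ck_on 1 A (fun x => k (f x)).
Proof.
move=> Dk ck AB Cf; apply: (@C1_intro _ (fun v x => dk (f x) * 'D_v f x)).
- move=> x Ax; apply: difcomp (C1_diff Cf Ax) _; apply/derivable1_diffP.
  by case: (Dk _ (AB x Ax)).
- by move=> v x Ax; have [_] := der1comp (Dk _ (AB x Ax)) (C1_der v Cf Ax).
- move=> v x Ax; apply: contM; last exact: C1_dcont.
  by apply: (@continuous_comp _ _ _ f dk); [exact: C1_cont|exact: ck (AB x Ax)].
Qed.

Lemma C1comp_heis (f : V -> heis R) (O : set (heis R)) (h : heis R -> R) :
  Ck_on 1 A f -> Ck_on 1 O h -> (forall x, A x -> O (f x)) -> Ck_on 1 A (fun x => h (f x)).
Proof.
move=> Cf [dh ch] AO.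
have df x : A x -> differentiable f x by case: Cf => + _; apply.
have cdf v x : A x -> {for x, continuous ('D_v f)} by case: Cf => _ /(_ v); apply.
have cL (L : heis R -> R) v x : (forall y, differentiable L y) -> A x ->
    {for x, continuous (fun x => L ('D_v f x))}.
  move=> dL Ax; apply: (@continuous_comp _ _ _ ('D_v f) L); first exact: cdf.
  exact: differentiable_continuous (dL _).
have cD w x : A x -> {for x, continuous (fun x => 'D_w h (f x))}.
  move=> Ax; apply: (@continuous_comp _ _ _ f ('D_w h)).
    exact: differentiable_continuous (df x Ax).
  exact: ch (AO x Ax).
apply: (@C1_intro _ (fun v x => xc ('D_v f x) * 'D_(ex R) h (f x) +
   yc ('D_v f x) * 'D_(ey R) h (f x) + zc ('D_v f x) * 'D_(ez R) h (f x))).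
- by move=> x Ax; apply: difcomp (df x Ax) _; exact: dh (AO x Ax).
- move=> v x Ax.
  have [_ E] := chain (dh _ (AO x Ax)) (df x Ax) (erefl ('D_v f x)).
  rewrite -[LHS]/('D_v (h \o f) x) E.
  have {1}-> : 'D_v f x = xc ('D_v f x) *: ex R + yc ('D_v f x) *: ey R + zc ('D_v f x) *: ez R.
    by apply: heis_eq; rewrite /ex /ey /ez !coordE; ring.
  by rewrite derive_lin //; exact: dh (AO x Ax).
- move=> v x Ax; apply: contD; first apply: contD.
  + by apply: contM; [apply: cL => //; exact: xc_differentiable|exact: cD].
  + by apply: contM; [apply: cL => //; exact: yc_differentiable|exact: cD].
  + by apply: contM; [apply: cL => //; exact: zc_differentiable|exact: cD].
Qed.

End C1Calculus.

(** * Oriented local equations of a two-sided surface *)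

Section Conormal.
Variable R : realType.
Variables (S : set (heis R)) (N : heis R -> heis R).
Hypotheses (subS : C2_submanifold 1 S) (ncS : non_characteristic S) (tsN : two_sided_by S N).

Lemma Dxc (y w : heis R) : 'D_w (@xc R) y = xc w. Proof. by case: (dxc y w). Qed.
Lemma Dyc (y w : heis R) : 'D_w (@yc R) y = yc w. Proof. by case: (dyc y w). Qed.
Lemma Dzc (y w : heis R) : 'D_w (@zc R) y = zc w. Proof. by case: (dzc y w). Qed.

Lemma Ck_on_chart (O : set (heis R)) (phi : heis R -> heis R) : open O -> open (phi @` O) ->
  Ck_diffeo 2 O (phi @` O) phi -> Ck_on 2 O phi /\ exists psi : heis R -> heis R,
   Ck_on 2 (phi @` O) psi /\ forall x, O x -> psi (phi x) = x.
Proof.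
move=> oO oP [_ Cphi [psi Cpsi psiK]]; split; first exact: locally_extends_open.
by exists psi; split => //; exact: locally_extends_open.
Qed.

(** The equation is the first coordinate of a slice chart. Differentiating it along curves in [S]
    puts tangent vectors in its kernel; the converse has to exhibit a curve. *)
Lemma local_equation p0 : S p0 -> exists (O : set (heis R)) (Phi : heis R -> R),
  [/\ open O, O p0, Ck_on 2 O Phi &
   forall q, O q -> S q -> forall v, tangent S q v <-> 'D_v Phi q = 0].
Proof.
move=> /subS[B [phi [oB Bp oP dphi SE]]].
have [Cphi [psi [Cpsi psiK]]] := Ck_on_chart oB oP dphi.
exists B, (fun x => xc (phi x)).
have CPhi : Ck_on 2 B (fun x => xc (phi x)).
  by apply: Ck_lin => //; [exact: xc_differentiable|exact: Dxc].
have dPhi q : B q -> differentiable (fun x => xc (phi x)) q by case: CPhi => + _; apply.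
have dph q : B q -> differentiable phi q by case: Cphi => + _; apply.
have S0 q : B q -> S q <-> xc (phi q) = 0.
  move=> Bq; rewrite SE //; split=> [H|H i i1]; first exact: H.
  rewrite -[RHS]H /xc; congr (phi q _ _); apply: val_inj => /=.
  by move: i1; rewrite ltnS leqn0 => /eqP.
split => // q Bq Sq v; split.
- move=> [c [c0 Dc nS]].
  have D : is_derive (0 : R) 1 (fun t => xc (phi (c t))) ('D_v (fun x => xc (phi x)) q).
    have dq : differentiable (fun x => xc (phi x)) (c 0) by rewrite c0; exact: dPhi.
    by have := chain_curve dq Dc; rewrite c0.
  have cc : c t @[t --> 0] --> q.
    by rewrite -[X in _ --> X]c0; apply: differentiable_continuous;
      apply/derivable1_diffP; case: Dc.
  have nB : \forall t \near (0 : R), B (c t) := cc _ (open_nbhs_nbhs (conj oB Bq)).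
  have [_ E1] : is_derive (0 : R) 1 (fun _ : R => 0 : R) ('D_v (fun x => xc (phi x)) q).
    apply: near_is_derive D; apply: filterS (filterI nS nB) => t [St Bt].
    by apply/S0.
  by have [_ E2] := derC (0 : R) (0 : R) 1; rewrite -E1 E2.
- move=> Dv0; pose u := 'D_v phi q.
  have xu : xc u = 0.
    have [_ E] := chain (xc_differentiable (phi q)) (dph q Bq) (erefl u).
    by rewrite -Dv0 -[RHS]/('D_v (@xc R \o phi) q) E Dxc.
  have Pq : (phi @` B) (phi q) by exists q.
  have dpsi : differentiable psi (phi q) by case: Cpsi => + _; apply.
  (* A straight line in the chart: the first coordinate of [u] is 0, so the line stays in the slice
     and its image under [psi] is a curve in [S] with velocity [v]. *)
  pose l (t : R) := phi q + t *: u.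
  have Dl : is_derive (0 : R) 1 l u.
    have H : is_derive (phi q) u (fun x => x) u by exact: is_derive_id.
    by have /is_derive_line := H.
  have l0 : l 0 = phi q by rewrite /l scale0r addr0.
  have dpsi' : differentiable psi (l 0) by rewrite l0.
  have nP : \forall t \near (0 : R), (phi @` B) (l t).
    have cl : l t @[t --> 0] --> l 0.
      by apply: differentiable_continuous; apply/derivable1_diffP; case: Dl.
    by rewrite l0 in cl; exact: (cl _ (open_nbhs_nbhs (conj oP Pq))).
  exists (fun t => psi (l t)); split.
  + by rewrite l0 psiK.
  + apply: is_derive_eq (chain_curve dpsi' Dl) _; rewrite l0.
    have [_ <-] := chain dpsi (dph q Bq) (erefl u).
    have [_ Eid] := is_derive_id q v; rewrite -[RHS]Eid.
    apply: near_derive; apply: filterS (open_nbhs_nbhs (conj oB Bq)) => x Bx.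
    exact: psiK.
  + apply: filterS nP => t [x Bx E]; rewrite -E psiK //; apply/S0 => //.
    have Sq0 : xc (phi q) = 0 by apply/S0.
    by rewrite E /l !coordE Sq0 xu mulr0 addr0.
Qed.

(** If both horizontal derivatives vanished, the distribution would lie in the kernel of the
    differential; non-characteristicity would then make every vector tangent, even the transverse
    [N q]. *)
Lemma equation_noncharacteristic (O : set (heis R)) (Phi : heis R -> R) q :
  O q -> S q -> Ck_on 2 O Phi ->
  (forall v, tangent S q v <-> 'D_v Phi q = 0) -> 0 < dd 1 Phi q ^+ 2 + dd 2 Phi q ^+ 2.
Proof.
move=> Oq Sq [dPhi _] T; rewrite lt_neqAle addr_ge0 ?sqr_ge0 // andbT eq_sym.
rewrite paddr_eq0 ?sqr_ge0 // !sqrf_eq0; apply/negP => /andP[/eqP d1 /eqP d2].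
case: tsN => _ /(_ q Sq)[_]; apply; apply/T.
have [al [w [Tw ->]]] := ncS Sq (N q).
have dq := dPhi q Oq.
rewrite !big_ord_recl big_ord0 addr0.
rewrite -[al 0 ord0 *: _ + _ + w]/(al 0 ord0 *: X_ 1 q + al 0 (lift ord0 ord0) *: X_ 2 q + w).
rewrite -[w]scale1r derive_lin // -!ddP d1 d2.
by have -> : 'D_w Phi q = 0 by [apply/T]; rewrite !scaler0 !addr0.
Qed.

(** Two strict inequalities at [p0], the second after a choice of sign, extend to a neighbourhood by
    continuity. *)
Lemma conormal p0 : S p0 -> exists (O : set (heis R)) (Phi : heis R -> R),
  [/\ open O, O p0, Ck_on 2 O Phi,
   forall q, O q -> 0 < dd 1 Phi q ^+ 2 + dd 2 Phi q ^+ 2 &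
   forall q, O q -> S q -> 0 < 'D_(N q) Phi q /\
     forall v, tangent S q v <-> 'D_v Phi q = 0].
Proof.
move=> Sp; have [B0 [Phi0 [oB0 Bp0 C0 T0]]] := local_equation Sp.
have [B [Phi [oB Bp CPhi T pos]]] : exists (B : set (heis R)) (Phi : heis R -> R),
  [/\ open B, B p0, Ck_on 2 B Phi,
   forall q, B q -> S q -> forall v, tangent S q v <-> 'D_v Phi q = 0 &
   0 < 'D_(N p0) Phi p0].
  have nz : 'D_(N p0) Phi0 p0 != 0.
    apply/eqP => /(T0 p0 Bp0 Sp); by case: tsN => _ /(_ p0 Sp)[].
  (* Transversality excludes the value 0; in the negative case the equation is replaced by its
     opposite. *)
  have [neg|pos|/eqP] := ltgtP ('D_(N p0) Phi0 p0) 0; last by rewrite (negbTE nz).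
  - have d0 q : B0 q -> differentiable Phi0 q by case: C0 => + _; apply.
    have DN q v : B0 q -> 'D_v (fun x => - Phi0 x) q = - 'D_v Phi0 q.
      move=> Bq; have [_ ->] // := derN (derivableP (diff_derivable (v := v) (d0 q Bq))).
    exists B0, (fun x => - Phi0 x); split; [exact: oB0|exact: Bp0| | |].
    + apply: (Ck_lin oB0 (L := fun x : R => - x)) C0 => y.
        by apply: difN; apply/derivable1_diffP; exact: derivable_id.
      by move=> w; have [_ E] := derN (is_derive_id y w); exact: E.
    + move=> q Bq Sq v; rewrite (DN q v Bq) (T0 q Bq Sq v).
      by split=> [->|/eqP]; [rewrite oppr0|rewrite oppr_eq0 => /eqP].
    + by rewrite DN // oppr_gt0.
  - by exists B0, Phi0; split; [exact: oB0|exact: Bp0|exact: C0|exact: T0|exact: pos].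
have dPhi q : B q -> differentiable Phi q by case: CPhi => + _; apply.
have ddc i q (Bq : B q) := @dd_continuous _ _ _ oB CPhi i q Bq.
have np : \forall q \near p0, 0 < dd 1 Phi q ^+ 2 + dd 2 Phi q ^+ 2.
  have c : {for p0, continuous (fun q => dd 1 Phi q * dd 1 Phi q + dd 2 Phi q * dd 2 Phi q)}.
    by apply: contD; apply: contM; apply: ddc.
  have := equation_noncharacteristic Bp Sp CPhi (T p0 Bp Sp); rewrite !expr2 => pp.
  by apply: filterS (cvgr_gt _ c _ pp) => q; rewrite !expr2.
(* [N] is continuous along [S] only, so the limits are taken within [S]. *)
have nN : \forall q \near p0, S q -> 0 < xc (N q) * dd 1 Phi q + yc (N q) * dd 2 Phi q
     + vert q (N q) * dd 0 Phi q.
  have cN : N q @[q --> within S (nbhs p0)] --> N p0.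
    by case: tsN => /subspace_continuousP + _; apply.
  have cdd i : dd i Phi q @[q --> within S (nbhs p0)] --> dd i Phi p0.
    by apply: cvg_within_filter; exact: ddc.
  have cco (L : heis R -> R) : (forall y, differentiable L y) ->
      L (N q) @[q --> within S (nbhs p0)] --> L (N p0).
    by move=> dL; apply: cvg_comp cN _; exact: differentiable_continuous (dL _).
  have cid (L : heis R -> R) : (forall y, differentiable L y) ->
      L q @[q --> within S (nbhs p0)] --> L p0.
    by move=> dL; apply: cvg_within_filter; exact: differentiable_continuous (dL _).
  have cX := cco _ (@xc_differentiable R); have cY := cco _ (@yc_differentiable R).
  have cZ := cco _ (@zc_differentiable R).
  have ix := cid _ (@xc_differentiable R); have iy := cid _ (@yc_differentiable R).
  have cv : vert q (N q) @[q --> within S (nbhs p0)] --> vert p0 (N p0).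
    rewrite /vert; apply: cvgD => //; apply: cvgM; last exact: cvg_cst.
    by apply: cvgB; apply: cvgM.
  have c : (fun q => xc (N q) * dd 1 Phi q + yc (N q) * dd 2 Phi q + vert q (N q) * dd 0 Phi q)
      @ within S (nbhs p0) --> xc (N p0) * dd 1 Phi p0 + yc (N p0) * dd 2 Phi p0
        + vert p0 (N p0) * dd 0 Phi p0.
    exact: (cvgD (cvgD (cvgM cX (cdd 1%N)) (cvgM cY (cdd 2%N))) (cvgM cv (cdd 0%N))).
  have pos' : 0 < xc (N p0) * dd 1 Phi p0 + yc (N p0) * dd 2 Phi p0
     + vert p0 (N p0) * dd 0 Phi p0 by rewrite -derive_frame //; exact: dPhi.
  have n : \forall q \near within S (nbhs p0), 0 < xc (N q) * dd 1 Phi q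
      + yc (N q) * dd 2 Phi q + vert q (N q) * dd 0 Phi q.
    exact: (cvgr_gt _ c _ pos').
  exact: n.
have [C [oC Cp CH]] : exists C : set (heis R), [/\ open C, C p0 & forall q, C q ->
   [/\ B q, 0 < dd 1 Phi q ^+ 2 + dd 2 Phi q ^+ 2 & S q -> 0 < 'D_(N q) Phi q]].
  have nB : \forall q \near p0, B q by exact: open_nbhs_nbhs.
  exists ([set q | [/\ B q, 0 < dd 1 Phi q ^+ 2 + dd 2 Phi q ^+ 2 &
     S q -> 0 < 'D_(N q) Phi q]]^°); split.
  - exact: open_interior.
  - apply: filterS (filterI (filterI nB np) nN) => q [[Bq pq] Nq]; split => // Sq.
    by rewrite derive_frame; [exact: Nq|exact: dPhi].
  - by move=> q /interior_subset.
exists C, Phi; split => //.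
- by apply: Ck_on_sub CPhi => q /CH[].
- by move=> q /CH[].
- by move=> q /CH[Bq _ HN] Sq; split; [exact: HN|exact: T].
Qed.

End Conormal.

Lemma contV (R : realType) (T : topologicalType) (f : T -> R) (x : T) :
  f x != 0 -> {for x, continuous f} -> {for x, continuous (fun y => (f y)^-1)}.
Proof. by move=> n c; exact: (cvgV n c). Qed.

(** * Frame derivatives and class C^1 *)

Section C1Frame.
Variable R : realType.
Variables (A : set (heis R)) (f : heis R -> R).
Hypothesis oA : open A.

Lemma C1_coord : [/\ Ck_on 1 A (@xc R), Ck_on 1 A (@yc R) & Ck_on 1 A (@zc R)].
Proof.
split.
- apply: (C1_intro oA (d := fun v _ => xc v)) => [x _|v x _|v x _].
  + exact: xc_differentiable.
  + exact: Dxc.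
  + exact: contC.
- apply: (C1_intro oA (d := fun v _ => yc v)) => [x _|v x _|v x _].
  + exact: yc_differentiable.
  + exact: Dyc.
  + exact: contC.
- apply: (C1_intro oA (d := fun v _ => zc v)) => [x _|v x _|v x _].
  + exact: zc_differentiable.
  + exact: Dzc.
  + exact: contC.
Qed.

Lemma C1_Xz i : Ck_on 1 A (@Xz R i).
Proof.
have [Cx Cy _] := C1_coord.
case: i => [|[|i]]; rewrite /Xz.
- exact: C1C.
- by apply: (C1N oA); apply: (C1M oA Cy); exact: C1C.
- by apply: (C1M oA Cx); exact: C1C.
Qed.

Lemma C1_ddE i p : Ck_on 1 A f -> A p -> \forall q \near p,
  Xx R i * 'D_(ex R) f q + Xy R i * 'D_(ey R) f q + Xz i q * 'D_(ez R) f q = dd i f q.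
Proof.
move=> Cf Ap; apply: filterS (nearA oA Ap) => q Aq.
by rewrite ddE //; exact: C1_diff Cf Aq.
Qed.

Lemma C1_dd_continuous i p : Ck_on 1 A f -> A p -> {for p, continuous (dd i f)}.
Proof.
move=> Cf Ap; apply: near_continuous (C1_ddE i Cf Ap) _.
have cD u : {for p, continuous ('D_u f)} by exact: (C1_dcont Cf Ap).
apply: contD; first apply: contD.
- by apply: contM; [exact: contC|exact: cD].
- by apply: contM; [exact: contC|exact: cD].
- by apply: contM; [exact: (C1_cont (C1_Xz i) Ap)|exact: cD].
Qed.

Lemma C2_dd_C1 i : Ck_on 2 A f -> Ck_on 1 A (dd i f).
Proof.
move=> Cf; have CD u : Ck_on 1 A ('D_u f) by case: Cf => _; apply.
apply: (Ck_on_eq oA (f := fun q => Xx R i * 'D_(ex R) f q + Xy R i * 'D_(ey R) f q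
   + Xz i q * 'D_(ez R) f q)).
  by move=> q Aq; rewrite ddE //; exact: (C2_differentiable Cf).
apply: (C1D oA); first apply: (C1D oA).
- exact: (C1M oA (C1C oA _) (CD _)).
- exact: (C1M oA (C1C oA _) (CD _)).
- exact: (C1M oA (C1_Xz i) (CD _)).
Qed.

End C1Frame.

(** * The signed distance near a fibre of the tube, with [g] inverse to the exponential map *)

Section Chart.
Variable R : realType.
Variables (S : set (heis R)) (eps : heis R -> R) (N : heis R -> heis R).
Hypotheses (tub : tubular S eps).
Let U := tubU S eps.
Let V := tubV S eps.
Let delta := sdist S.
Let d := signed_dist S eps N.

Variable g : heis R -> coheis R.
Hypothesis Cg : Ck_on 1 U g.
Hypothesis gK : forall l, V l -> g (hexp l) = l.

Lemma gV p : U p -> V (g p) /\ hexp (g p) = p.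
Proof. by move=> [l Vl <-]; rewrite gK. Qed.

(** Injectivity of the exponential map on [V] turns the membership tests of [signed_dist] into sign
    tests on the one covector [g p]. *)
Lemma signedE p : U p -> d p = if 0 < pairing (g p).2 (N (g p).1) then delta p
  else if pairing (g p).2 (N (g p).1) < 0 then - delta p else 0.
Proof.
move=> Up; have [Vg Eg] := gV Up; rewrite /d /signed_dist.
have E1 : (p \in @hexp R @` [set l | tubV S eps l /\ 0 < pairing l.2 (N l.1)]) =
   (0 < pairing (g p).2 (N (g p).1)).
  apply/idP/idP; rewrite inE.
    by move=> [l [Vl pl] lp]; rewrite -lp gK.
  by move=> H; exists (g p).
have E2 : (p \in @hexp R @` [set l | tubV S eps l /\ pairing l.2 (N l.1) < 0]) =
   (pairing (g p).2 (N (g p).1) < 0).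
  apply/idP/idP; rewrite inE.
    by move=> [l [Vl pl] lp]; rewrite -lp gK.
  by move=> H; exists (g p).
by rewrite E1 E2.
Qed.

Variables (O : set (heis R)) (Phi : heis R -> R).
Hypotheses (oO : open O) (CPhi : Ck_on 2 O Phi).
Hypothesis Phi_pos : forall q, O q -> 0 < dd 1 Phi q ^+ 2 + dd 2 Phi q ^+ 2.
Hypothesis Phi_N : forall q, O q -> S q -> 0 < 'D_(N q) Phi q /\
     forall v, tangent S q v <-> 'D_v Phi q = 0.

(** Dividing the differential of [Phi] by its horizontal length gives, at points of [S], the unit
    conormal positive on [N]; [conorm] lists its momenta. *)
Definition hlen q : R := Num.sqrt (dd 1 Phi q ^+ 2 + dd 2 Phi q ^+ 2).
Definition conorm (i : nat) q : R := dd i Phi q / hlen q.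

Lemma hlen_gt0 q : O q -> 0 < hlen q.
Proof. by move=> Oq; rewrite sqrtr_gt0; exact: Phi_pos. Qed.

Lemma conorm_norm q : O q -> conorm 1 q ^+ 2 + conorm 2 q ^+ 2 = 1.
Proof.
move=> Oq; have h0 := hlen_gt0 Oq.
have E : hlen q ^+ 2 = dd 1 Phi q ^+ 2 + dd 2 Phi q ^+ 2.
  by rewrite sqr_sqrtr // ltW // Phi_pos.
by rewrite /conorm !expr_div_n -mulrDl -E divff // expf_neq0 // gt_eqF.
Qed.

Lemma C1_conorm i : Ck_on 1 O (conorm i).
Proof.
have C k := C2_dd_C1 oO k CPhi.
have CL : Ck_on 1 O (fun q => dd 1 Phi q * dd 1 Phi q + dd 2 Phi q * dd 2 Phi q).
  by apply: (C1D oO); apply: (C1M oO).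
pose k (y : R) := (Num.sqrt y)^-1.
pose dk (y : R) := - (2 * Num.sqrt y)^-1 / Num.sqrt y ^+ 2.
have Dk (y : R) : 0 < y -> is_derive y 1 k (dk y).
  move=> y0; apply: derV; first by rewrite gt_eqF // sqrtr_gt0.
  exact: is_derive1_sqrt.
have ck (y : R) : 0 < y -> {for y, continuous dk}.
  move=> y0; have sy : Num.sqrt y != 0 by rewrite gt_eqF // sqrtr_gt0.
  have cs : {for y, continuous (@Num.sqrt R)} by exact: sqrt_continuous.
  have c2 : {for y, continuous (fun y : R => 2 * Num.sqrt y)} := contM (@contC _ _ 2 y) cs.
  have cq : {for y, continuous (fun y : R => Num.sqrt y ^+ 2)} by exact: (contM cs cs).
  apply: contM.
    by apply: contN; apply: (contV _ c2); rewrite mulf_neq0 // pnatr_eq0.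
  by apply: (contV _ cq); exact: expf_neq0.
have CP : forall q, O q -> [set y : R | 0 < y] (dd 1 Phi q * dd 1 Phi q + dd 2 Phi q * dd 2 Phi q).
  by move=> q /Phi_pos; rewrite !expr2.
have CI := C1comp1 oO Dk ck CP CL.
apply: (Ck_on_eq oO (f := fun q => dd i Phi q * k (dd 1 Phi q * dd 1 Phi q + dd 2 Phi q * dd 2 Phi q))).
  by move=> q _; rewrite /conorm /hlen /k !expr2.
exact: (C1M oO (C i) CI).
Unshelve. all: end_near. Qed.

Definition mo (i : nat) (l : coheis R) : R :=
  match i with 0%N => mom0 l | 1%N => mom1 l | _ => mom2 l end.

Lemma pairing_frame (l : coheis R) v :
  pairing l.2 v = xc v * mom1 l + yc v * mom2 l + vert l.1 v * mom0 l.
Proof. by rewrite pairingE /mom1 /mom2 /mom0 /vert; field. Qed.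

Lemma pairing_X (l : coheis R) i : (i < 3)%N -> pairing l.2 (X_ i l.1) = mo i l.
Proof.
case: i => [|[|[|//]]] _; rewrite pairingE /X_ !coordE /mo /mom0 /mom1 /mom2; by field.
Qed.

(** The annihilator is a line. The coefficient is read off from the horizontal momenta because the
    conormal has horizontal length 1. *)
Lemma conormal_multiple l i : annihilator S l -> O l.1 -> (i < 3)%N ->
  mo i l = (mom1 l * conorm 1 l.1 + mom2 l * conorm 2 l.1) * conorm i l.1.
Proof.
move=> [Sl al] Ol i3; have [_ T] := Phi_N Ol Sl.
have dPhi : differentiable Phi l.1 by exact: (C2_differentiable CPhi).
(* The combination of [X_ i] and [X_ k] killed by the differential of [Phi] is tangent, hence killed
   by [l]: the momenta of [l] and of the conormal are proportional. *)
have cross k : (k < 3)%N -> mo i l * conorm k l.1 = mo k l * conorm i l.1.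
  move=> k3; have : tangent S l.1 (dd k Phi l.1 *: X_ i l.1 + (- dd i Phi l.1) *: X_ k l.1).
    apply/T; rewrite derive_lin2 // -!ddP.
    by rewrite mulNr mulrC subrr.
  move=> /al; have E v w (x y : R) : pairing l.2 (x *: v + y *: w) = x * pairing l.2 v + y * pairing l.2 w.
    by rewrite !pairingE !coordE; ring.
  rewrite E !pairing_X // mulNr => /eqP; rewrite subr_eq0 => /eqP H.
  rewrite /conorm !mulrA; congr (_ / _).
  by rewrite mulrC H mulrC.
have c1 : mo i l * conorm 1 l.1 = mom1 l * conorm i l.1 := cross 1%N isT.
have c2 : mo i l * conorm 2 l.1 = mom2 l * conorm i l.1 := cross 2%N isT.
move: c1 c2 (conorm_norm Ol).
move: (conorm 1 l.1) (conorm 2 l.1) (conorm i l.1) (mo i l) (mom1 l) (mom2 l) => a b n x u w c1 c2 K.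
transitivity (x * (a ^+ 2 + b ^+ 2)); first by rewrite K mulr1.
transitivity (x * a * a + x * b * b); first by ring.
rewrite c1 c2; ring.
Qed.

Definition base p := (g p).1.
Definition A0 : set (heis R) := U `&` [set p | O (base p)].
(** The coefficient of the covector [g p] with respect to the unit conormal. It is C^1 together with
    [g], and turns out to be the signed distance. *)
Definition tau p : R := mom1 (g p) * conorm 1 (base p) + mom2 (g p) * conorm 2 (base p).

Lemma C1_base : Ck_on 1 U base.
Proof.
apply: (Ck_lin (tub_open tub) (L := fst)) Cg; first exact: fst_differentiable.
move=> y w; rewrite deriveE; last exact: fst_differentiable.
by rewrite diff_lin // => z; exact: cvg_fst.
Qed.

Lemma C1_covec : Ck_on 1 U (fun p => (g p).2).
Proof.
apply: (Ck_lin (tub_open tub) (L := snd)) Cg; first exact: snd_differentiable.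
move=> y w; rewrite deriveE; last exact: snd_differentiable.
by rewrite diff_lin // => z; exact: cvg_snd.
Qed.

Lemma A0_open : open A0.
Proof.
rewrite openE => p [Up Ob].
have [db _] := C1_base.
have cb : base @ p --> base p := differentiable_continuous (db p Up).
have n1 : \forall x \near p, O (base x) := cb _ (open_nbhs_nbhs (conj oO Ob)).
have n2 : \forall x \near p, U x := open_nbhs_nbhs (conj (tub_open tub) Up).
by apply: filterS (filterI n2 n1) => x [].
Qed.

Lemma A0_annihilator p : A0 p -> annihilator S (g p) /\ O (base p).
Proof. by move=> [Up Ob]; have [[al _] _] := gV Up. Qed.

Lemma A0_mo i p : (i < 3)%N -> A0 p -> mo i (g p) = tau p * conorm i (base p).
Proof. by move=> i3 /A0_annihilator[al Ob]; exact: conormal_multiple. Qed.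

Lemma A0_delta p : A0 p -> delta p = `|tau p|.
Proof.
move=> Ap; have [Up Ob] := Ap; have [Vg Eg] := gV Up.
rewrite -{1}Eg /delta (tub_delta tub Vg) ham2E.
rewrite -[mom1 _]/(mo 1 (g p)) -[mom2 _]/(mo 2 (g p)) !A0_mo //.
move: (@conorm_norm (base p) Ob).
move: (conorm 1 (base p)) (conorm 2 (base p)) => a b K.
by rewrite !exprMn -mulrDr K mulr1 sqrtr_sqr.
Qed.

Lemma A0_signed p : A0 p -> d p = tau p.
Proof.
move=> Ap; have [Up Ob] := Ap; have [[Sb _] _] := A0_annihilator Ap.
have [pN _] := Phi_N Ob Sb.
have h0 := hlen_gt0 Ob.
have dPhi : differentiable Phi (base p) by exact: (C2_differentiable CPhi).
have E : pairing (g p).2 (N (g p).1) = tau p * ('D_(N (base p)) Phi (base p) / hlen (base p)).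
  rewrite pairing_frame -[mom1 _]/(mo 1 (g p)) -[mom2 _]/(mo 2 (g p)) -[mom0 _]/(mo 0 (g p)).
  rewrite !A0_mo // derive_frame // /conorm -/(base p).
  by field; rewrite gt_eqF.
have k0 : 0 < 'D_(N (base p)) Phi (base p) / hlen (base p) by rewrite divr_gt0.
rewrite signedE // E pmulr_lgt0 // pmulr_llt0 // A0_delta //.
have [t0|t0|t0] := ltgtP 0 (tau p).
- by rewrite gtr0_norm.
- by rewrite ltr0_norm // opprK.
- exact: t0.
Qed.

Lemma A0_S p : A0 p -> tau p != 0 -> (U `\` S) p.
Proof.
move=> Ap t0; split; first by case: Ap.
by move=> /(tub_S tub)[_]; rewrite -/delta A0_delta // => /eqP; rewrite normr_eq0 (negbTE t0).
Qed.

Lemma C1_tau : Ck_on 1 A0 tau.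
Proof.
have oA := A0_open.
have Cb : Ck_on 1 A0 base by apply: Ck_on_sub C1_base => p [].
have Cc : Ck_on 1 A0 (fun p => (g p).2) by apply: Ck_on_sub C1_covec => p [].
have Cn i : Ck_on 1 A0 (fun p => conorm i (base p)).
  by apply: (C1comp_heis oA Cb (C1_conorm i)) => p [].
have [Cx Cy Cz] := C1_coord (@openT (heis R)).
have X1 := C1comp_heis oA Cb Cx (fun _ _ => I).
have Y1 := C1comp_heis oA Cb Cy (fun _ _ => I).
have X2 := C1comp_heis oA Cc Cx (fun _ _ => I).
have Y2 := C1comp_heis oA Cc Cy (fun _ _ => I).
have Z2 := C1comp_heis oA Cc Cz (fun _ _ => I).
have C2 := C1C oA (2^-1 : R).
apply: (C1D oA); apply: (C1M oA); try exact: Cn.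
- exact: (C1B oA X2 (C1M oA (C1M oA Y1 C2) Z2)).
- exact: (C1D oA Y2 (C1M oA (C1M oA X1 C2) Z2)).
Qed.

Lemma C1_signed : Ck_on 1 A0 d.
Proof.
by apply: (Ck_on_eq A0_open (f := tau)) C1_tau => p Ap; rewrite A0_signed.
Qed.

Definition ray q t := geo q (conorm 1 q) (conorm 2 q) (conorm 0 q) t.

(** The ray is the exponential of [t] times the unit conormal, for both signs of [t]; it crosses [S]
    at time 0 and [tau] grows along it at unit speed. *)
Lemma rayP q t : S q -> O q -> `|t| < eps q ->
  [/\ A0 (ray q t), base (ray q t) = q & tau (ray q t) = t].
Proof.
move=> Sq Oq tq.
pose l : coheis R := (q, vec3 (conorm 1 q + yc q / 2 * conorm 0 q)
  (conorm 2 q - xc q / 2 * conorm 0 q) (conorm 0 q)).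
have m1 : mom1 l = conorm 1 q by rewrite /mom1 /l /= !coordE; ring.
have m2 : mom2 l = conorm 2 q by rewrite /mom2 /l /= !coordE; ring.
have m0 : mom0 l = conorm 0 q by rewrite /mom0 /l /= coordE.
have [_ T] := Phi_N Oq Sq.
have dPhi : differentiable Phi q by exact: (C2_differentiable CPhi).
have al : annihilator S l.
  split=> // v /T; rewrite derive_frame // pairing_frame m1 m2 m0 /conorm => H.
  have -> : xc v * (dd 1 Phi q / hlen q) + yc v * (dd 2 Phi q / hlen q) +
     vert l.1 v * (dd 0 Phi q / hlen q) = (xc v * dd 1 Phi q + yc v * dd 2 Phi q +
      vert q v * dd 0 Phi q) / hlen q by rewrite /=; ring.
  by rewrite H mul0r.
have Vl : V (Defs.cscale t l).
  by apply: (tubV_scale al); rewrite ham2E m1 m2 conorm_norm // sqrtr1 mulr1.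
have Er : hexp (Defs.cscale t l) = ray q t by rewrite hexp_cscale m1 m2 m0.
have Eg : g (ray q t) = Defs.cscale t l by rewrite -Er gK.
have Eb : base (ray q t) = q by rewrite /base Eg.
split => //.
- by split; [exists (Defs.cscale t l)|rewrite /= Eb].
- rewrite /tau Eb Eg.
  have -> : mom1 (Defs.cscale t l) = t * conorm 1 q by rewrite -m1 /mom1 /= !coordE; ring.
  have -> : mom2 (Defs.cscale t l) = t * conorm 2 q by rewrite -m2 /mom2 /= !coordE; ring.
  move: (conorm_norm Oq); move: (conorm 1 q) (conorm 2 q) => a b K.
  by rewrite -!mulrA -mulrDr -!expr2 K mulr1.
Qed.

Lemma A0_ray p : A0 p ->
  [/\ S (base p), O (base p), `|tau p| < eps (base p) & ray (base p) (tau p) = p].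
Proof.
move=> Ap; have [[Sb _] Ob] := A0_annihilator Ap; have [Up _] := Ap.
have [Vg Eg] := gV Up; have [_ le] := Vg; split => //.
- suff <- : Num.sqrt (2 * ham (g p)) = `|tau p| by exact: le.
  by rewrite -A0_delta // -[p in RHS]Eg /delta (tub_delta tub Vg).
- rewrite /ray -geo_scale -!A0_mo //.
  by rewrite -[RHS]Eg hexpE.
Qed.

Lemma signed_off p : A0 p -> tau p != 0 -> exists B : set (heis R),
  [/\ open B, B p, forall x, B x -> A0 x, Ck_on 2 B d &
   forall x, B x -> dd 1 d x ^+ 2 + dd 2 d x ^+ 2 = 1].
Proof.
move=> Ap t0.
have ctau x : A0 x -> tau @ x --> tau x by move=> Ax; exact: (C1_cont C1_tau Ax).
have nA x : A0 x -> \forall y \near x, A0 y by move=> Ax; exact: (open_nbhs_nbhs (conj A0_open Ax)).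
have dd_near i x (f : heis R -> R) (B : set (heis R)) : open B -> B x ->
    (forall y, B y -> f y = d y) -> dd i d x = dd i f x.
  move=> oB Bx E; rewrite !ddP; apply/esym/near_derive.
  by apply: filterS (open_nbhs_nbhs (conj oB Bx)) => y; exact: E.
have CU := tub_C2 tub.
have [neg|pos|/eqP] := ltgtP (tau p) 0; last by rewrite (negbTE t0).
- pose B := A0 `&` [set x | tau x < 0].
  have oB : open B.
    rewrite openE => x [Ax tx].
    have n : \forall y \near x, tau y < 0 by exact: (cvgr_lt _ (ctau x Ax) _ tx).
    exact: filterI (nA x Ax) n.
  have E x : B x -> - delta x = d x.
    by move=> [Ax tx]; rewrite A0_delta // ltr0_norm // opprK A0_signed.
  have BU x : B x -> (U `\` S) x by move=> [Ax tx]; apply: A0_S => //; rewrite lt_eqF.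
  exists B; split => //; first by move=> x [].
  + apply: (Ck_on_eq oB E); apply: (Ck_lin oB (L := fun x : R => - x)) => [y|y w|].
    * by apply: difN; apply/derivable1_diffP; exact: derivable_id.
    * by have [_ E'] := derN (is_derive_id y w); exact: E'.
    * exact: Ck_on_sub BU CU.
  + move=> x Bx; rewrite !(dd_near _ x _ B oB Bx E).
    have DN i : dd i (fun y => - delta y) x = - dd i delta x.
      have dx : differentiable delta x by case: CU => + _; apply; exact: BU.
      rewrite !ddP.
      by have [_ E'] := derN (derivableP (diff_derivable (v := X_ i x) dx)); exact: E'.
    by rewrite !DN !sqrrN; exact: (tub_eik tub (BU x Bx)).
- pose B := A0 `&` [set x | 0 < tau x].
  have oB : open B.
    rewrite openE => x [Ax tx].
    have n : \forall y \near x, 0 < tau y by exact: (cvgr_gt _ (ctau x Ax) _ tx).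
    exact: filterI (nA x Ax) n.
  have E x : B x -> delta x = d x.
    by move=> [Ax tx]; rewrite A0_delta // gtr0_norm // A0_signed.
  have BU x : B x -> (U `\` S) x by move=> [Ax tx]; apply: A0_S => //; rewrite gt_eqF.
  exists B; split => //; first by move=> x [].
  + by apply: (Ck_on_eq oB E); exact: Ck_on_sub BU CU.
  + by move=> x Bx; rewrite !(dd_near _ x _ B oB Bx E); exact: (tub_eik tub (BU x Bx)).
Qed.

Definition ray1 q t := rot1 (conorm 1 q) (conorm 2 q) (conorm 0 q) t.
Definition ray2 q t := rot2 (conorm 1 q) (conorm 2 q) (conorm 0 q) t.

Lemma der_along_ray (f : heis R -> R) q t : differentiable f (ray q t) ->
  is_derive t 1 (fun s => f (ray q s)) (ray1 q t * dd 1 f (ray q t) + ray2 q t * dd 2 f (ray q t)).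
Proof.
move=> df; have := chain_curve df (der_geo q (conorm 1 q) (conorm 2 q) (conorm 0 q) t).
by rewrite derive_lin2 // -!ddP.
Qed.

Lemma near_abs_lt (t e : R) : `|t| < e -> \forall s \near t, `|s| < e.
Proof.
move=> te; have c : `|s| @[s --> t] --> `|t| by apply: cvg_norm; exact: cvg_id.
exact: (cvgr_lt _ c _ te).
Qed.

(** The equality case of Cauchy-Schwarz: the velocity of the ray and the gradient of [d] are unit
    vectors, and their product is the derivative of [d (ray q t) = t], namely 1. *)
Lemma hgrad_on_ray q t : S q -> O q -> `|t| < eps q -> t != 0 ->
  dd 1 d (ray q t) = ray1 q t /\ dd 2 d (ray q t) = ray2 q t.
Proof.
move=> Sq Oq te t0; have [Ar Eb Et] := rayP Sq Oq te.
have tn : tau (ray q t) != 0 by rewrite Et.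
have [B [oB Br BA CB eB]] := signed_off Ar tn.
have D := der_along_ray (C2_differentiable CB Br).
have [_ E1] : is_derive t 1 (fun s : R => s) (ray1 q t * dd 1 d (ray q t) + ray2 q t * dd 2 d (ray q t)).
  apply: near_is_derive D; apply: filterS (near_abs_lt te) => s se.
  by have [As _ Es] := rayP Sq Oq se; rewrite A0_signed.
have [_ E2] := is_derive_id t (1 : R).
have H := eB _ Br.
have K : ray1 q t ^+ 2 + ray2 q t ^+ 2 = 1 by rewrite /ray1 /ray2 rot_norm conorm_norm.
have L : ray1 q t * dd 1 d (ray q t) + ray2 q t * dd 2 d (ray q t) = 1 by rewrite -E1; exact: E2.
move: H K L; move: (ray1 q t) (ray2 q t) (dd 1 d _) (dd 2 d _) => k1 k2 a1 a2 H K L.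
have Z : (a1 - k1) ^+ 2 + (a2 - k2) ^+ 2 = 0.
  rewrite (_ : _ + _ = (a1 ^+ 2 + a2 ^+ 2) + (k1 ^+ 2 + k2 ^+ 2) - 2 * (k1 * a1 + k2 * a2)); last by ring.
  by rewrite H K L; ring.
move/eqP: Z; rewrite paddr_eq0 ?sqr_ge0 // !sqrf_eq0 !subr_eq0 => /andP[/eqP-> /eqP->].
by [].
Qed.

(** The momenta at [p] of the normal geodesic through it, explicit in [base p] and [tau p] and hence
    meaningful on [S] as well. *)
Definition Dsig (i : nat) p : R :=
  match i with
  | 0%N => conorm 0 (base p)
  | 1%N => ray1 (base p) (tau p)
  | _ => ray2 (base p) (tau p)
  end.

(** For the vertical index, the horizontal gradient along the ray rotates at the rate [conorm 0] by
    the explicit formula, and at the rate [dd 0 d] by the eikonal equation and the bracket. It has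
    length 1, so the rates agree. *)
Lemma dd_signed_off i p : (i < 3)%N -> A0 p -> tau p != 0 -> dd i d p = Dsig i p.
Proof.
move=> i3 Ap t0; have [Sb Ob te Er] := A0_ray Ap.
have [E1 E2] := hgrad_on_ray Sb Ob te t0; rewrite Er in E1 E2.
case: i i3 => [|[|[|//]]] _ //.
have [B [oB Bp BA CB eB]] := signed_off Ap t0.
have near_t : \forall s \near tau p, `|s| < eps (base p) /\ s != 0.
  by apply: filterI; [exact: near_abs_lt|exact: nbhs_neq0].
have Bp' : B (ray (base p) (tau p)) by rewrite Er.
have D1 := der_along_ray (dd_differentiable oB CB 1 Bp').
have D2 := der_along_ray (dd_differentiable oB CB 2 Bp').
have F1 : is_derive (tau p) 1 (ray1 (base p)) (ray1 (base p) (tau p) *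
    dd 1 (dd 1 d) (ray (base p) (tau p)) + ray2 (base p) (tau p) * dd 2 (dd 1 d) (ray (base p) (tau p))).
  apply: near_is_derive (D1); apply: filterS near_t => s [se s0].
  by have [] := hgrad_on_ray Sb Ob se s0.
have F2 : is_derive (tau p) 1 (ray2 (base p)) (ray1 (base p) (tau p) *
    dd 1 (dd 2 d) (ray (base p) (tau p)) + ray2 (base p) (tau p) * dd 2 (dd 2 d) (ray (base p) (tau p))).
  apply: near_is_derive (D2); apply: filterS near_t => s [se s0].
  by have [] := hgrad_on_ray Sb Ob se s0.
have [_ G1] := F1; have [_ G2] := F2.
have [_ R1] := der_rot1 (conorm 1 (base p)) (conorm 2 (base p)) (conorm 0 (base p)) (tau p).
have [_ R2] := der_rot2 (conorm 1 (base p)) (conorm 2 (base p)) (conorm 0 (base p)) (tau p).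
have H1 := etrans (esym G1) R1; have H2 := etrans (esym G2) R2.
rewrite -/(ray1 (base p) (tau p)) -/(ray2 (base p) (tau p)) Er -E1 -E2 in H1 H2.
have K := eB p Bp; have e1 := eik_dd oB CB eB 1 Bp; have e2 := eik_dd oB CB eB 2 Bp.
have Br := dd_bracket12 oB CB Bp.
rewrite /Dsig.
move: H1 H2 K e1 e2 Br.
move: (dd 1 d p) (dd 2 d p) (dd 0 d p) (dd 1 (dd 1 d) p) (dd 1 (dd 2 d) p) (dd 2 (dd 1 d) p)
  (dd 2 (dd 2 d) p) (conorm 0 (base p)) => a1 a2 a0 b11 b12 b21 b22 n0 H1 H2 K e1 e2 Br.
have Eb : b12 = b21 + a0 by rewrite -Br addrC subrK.
have Z2 : a0 * a2 = n0 * a2.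
  apply: oppr_inj; rewrite -H1 -[LHS]addr0 -e1 Eb; ring.
have Z1 : a0 * a1 = n0 * a1.
  rewrite -H2 -[LHS]addr0 -e2 Eb; ring.
rewrite -[LHS]mulr1 -[RHS]mulr1 -K !expr2 !mulrDr !mulrA Z1 Z2.
by [].
Qed.

Lemma C1_Dsig i : Ck_on 1 A0 (Dsig i).
Proof.
have oA := A0_open.
have Cb : Ck_on 1 A0 base by apply: Ck_on_sub C1_base => p [].
have Cn k : Ck_on 1 A0 (fun p => conorm k (base p)).
  by apply: (C1comp_heis oA Cb (C1_conorm k)) => p [].
have Ct := C1M oA (Cn 0%N) C1_tau.
have Cc : Ck_on 1 A0 (fun p => cos (conorm 0 (base p) * tau p)).
  apply: (C1comp1 oA (B := setT) (k := @cos R) (dk := fun x => - sin x)) Ct => // y _.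
    exact: is_derive_cos.
  by apply: contN; exact: continuous_sin.
have Cs : Ck_on 1 A0 (fun p => sin (conorm 0 (base p) * tau p)).
  apply: (C1comp1 oA (B := setT) (k := @sin R) (dk := @cos R)) Ct => // y _.
    exact: is_derive_sin.
  exact: continuous_cos.
case: i => [|[|i]].
- exact: Cn.
- exact: (C1B oA (C1M oA (Cn 1%N) Cc) (C1M oA (Cn 2%N) Cs)).
- exact: (C1D oA (C1M oA (Cn 1%N) Cs) (C1M oA (Cn 2%N) Cc)).
Qed.

(** At a point of [S] both sides are continuous, since [d] is already known to be C^1, and they
    agree on the punctured ray through the point. *)
Lemma dd_signed i p : (i < 3)%N -> A0 p -> dd i d p = Dsig i p.
Proof.
move=> i3 Ap; have [t0|] := eqVneq (tau p) 0; last exact: dd_signed_off.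
have [Sb Ob te Er] := A0_ray Ap; rewrite t0 in te Er.
pose F x := dd i d x - Dsig i x.
have cF : {for p, continuous F}.
  apply: contB; first exact: (C1_dd_continuous A0_open C1_signed Ap).
  exact: (C1_cont (C1_Dsig i) Ap).
have cr : ray (base p) @ 0 --> p.
  rewrite -[X in _ --> X]Er; apply: differentiable_continuous; apply/derivable1_diffP.
  by case: (der_geo (base p) (conorm 1 (base p)) (conorm 2 (base p)) (conorm 0 (base p)) 0).
have cFr : F (ray (base p) t) @[t --> 0] --> F p by exact: (cvg_comp _ _ cr cF).
have cFr' : F (ray (base p) t) @[t --> 0^'] --> F p.
  by apply: cvg_trans cFr; apply: cvg_app; exact: cvg_within.
have z : (fun _ : R => 0 : R) @ 0^' --> F p.
  apply: cvg_trans cFr'; apply: near_eq_cvg; near=> t.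
  have tn0 : t != 0 by near: t; exact: nbhs_dnbhs_neq.
  have tl : `|t| < eps (base p) by near: t; apply: nbhs_dnbhs; exact: near_abs_lt.
  have [Ar Eb Et] := rayP Sb Ob tl.
  by rewrite /F dd_signed_off ?Et // subrr.
have z' : (fun _ : R => 0 : R) @ 0^' --> (0 : R) by exact: cvg_cst.
apply/eqP; rewrite -subr_eq0 -/(F p); apply/eqP.
exact: (cvg_unique _ z z').
Unshelve. all: end_near. Qed.

(** The frame derivatives [Dsig] contain no derivative of [g], only [g] itself, so they are C^1 and
    [d] gains one order. *)
Lemma chart_C2 : Ck_on 2 A0 d.
Proof.
have oA := A0_open; have [dd_ _] := C1_signed.
split=> // v.
apply: (Ck_on_eq oA (f := fun p => xc v * Dsig 1 p + yc v * Dsig 2 p + vert p v * Dsig 0 p)).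
  by move=> p Ap; rewrite derive_frame ?dd_signed //; exact: dd_.
have [Cx Cy _] := C1_coord oA.
have CC (c : R) := C1C oA c.
apply: (C1D oA); first apply: (C1D oA).
- exact: (C1M oA (CC _) (C1_Dsig 1)).
- exact: (C1M oA (CC _) (C1_Dsig 2)).
- apply: (C1M oA _ (C1_Dsig 0)).
  exact: (C1D oA (CC (zc v)) (C1M oA (C1B oA (C1M oA Cy (CC (xc v))) (C1M oA Cx (CC (yc v)))) (CC 2^-1))).
Qed.

Lemma chart_eik p : A0 p -> dd 1 d p ^+ 2 + dd 2 d p ^+ 2 = 1.
Proof.
move=> Ap; have [_ Ob] := Ap; rewrite !dd_signed // /Dsig /ray1 /ray2 rot_norm.
exact: conorm_norm.
Qed.

End Chart.

(** * The signed distance on the whole tube *)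

Section Signed.
Variable R : realType.
Variables (S : set (heis R)) (eps : heis R -> R) (N : heis R -> heis R).
Hypotheses (subS : C2_submanifold 1 S) (ncS : non_characteristic S).
Hypotheses (tub : tubular S eps) (tsN : two_sided_by S N).
Let U := tubU S eps.
Let d := signed_dist S eps N.

Lemma signed_chart p : U p -> exists A : set (heis R), [/\ A p, Ck_on 2 A d &
  forall x, A x -> dd 1 d x ^+ 2 + dd 2 d x ^+ 2 = 1].
Proof.
move=> Up; have [_ _ [g Cg gK]] := tub_diffeo tub.
have Cg' : Ck_on 1 U g by apply: locally_extends_open => //; exact: (tub_open tub).
have [[[Sb _] _] Eg] := gV gK Up.
have [B [Phi [oB Bb CPhi pos HN]]] := conormal subS ncS tsN Sb.
exists (A0 S eps g B); split.
- by split.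
- exact: (chart_C2 tub Cg' gK oB CPhi pos HN).
- exact: (chart_eik tub Cg' gK oB CPhi pos HN).
Qed.

Lemma signed_C2 : Ck_on 2 U d.
Proof. by apply: Ck_on_local => p /signed_chart[A [Ap CA _]]; exists A. Qed.

Lemma signed_eik p : U p -> dd 1 d p ^+ 2 + dd 2 d p ^+ 2 = 1.
Proof. by move=> /signed_chart[A [Ap _]]; apply. Qed.

Lemma signed_div (mu : heis R -> R) (c : R) (Q : nat -> mpoly.mpoly 5 R) (k : nat)
    (M : 'M[R]_2) :
  (forall p, mu p = c) -> divergence_polys Q -> SO2 M ->
  is_iter_div U mu (hgrad d) k (fun p => evalQ (Q k) M d 0 p).
Proof.
move=> muc HQ SM.
apply: (iter_div_poly (tub_open tub) signed_C2 signed_eik (s := fun _ => 0)) => // p Up.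
- rewrite mul0r oppr0; apply: (@near_is_derive _ _ _ (fun _ => c)); last exact: derC.
  by near=> t; rewrite muc.
- by rewrite expr0n oppr0; exact: derC.
Unshelve. all: end_near. Qed.

End Signed.

Theorem proposition1p14 (R : realType) (mu : 'rV[R]_3 -> R)
    (mu_gt0 : forall p, 0 < mu p) (mu_inv : left_invariant mu) :
  exists Q : nat -> nat -> mpoly.mpoly 5 R,
  forall k : nat,
    (forall m : nat, (m = 1 \/ m = 2)%N ->
     forall (S : set 'rV[R]_3) (eps : 'rV[R]_3 -> R),
       C2_submanifold m S -> non_characteristic S -> tubular S eps ->
       let U := tubU S eps in
       let delta := sdist S in
       (forall M M' : 'M[R]_2, SO2 M -> SO2 M' ->
         forall (i : nat) (p : 'rV[R]_3), (i < 4)%N -> (U `\` S) p ->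
           Ffun M delta i p = Ffun M' delta i p) /\
       (forall M : 'M[R]_2, SO2 M ->
         is_iter_div (U `\` S) (fun p => mu p / delta p ^+ m.-1) (hgrad delta) k
           (fun p => evalQ (Q k m) M delta (m.-1%:R / delta p) p))) /\
    (forall (S : set 'rV[R]_3) (eps : 'rV[R]_3 -> R) (N : 'rV[R]_3 -> 'rV[R]_3),
       C2_submanifold 1 S -> non_characteristic S -> tubular S eps ->
       two_sided_by S N ->
       let U := tubU S eps in
       let dsign := signed_dist S eps N in
       forall M : 'M[R]_2, SO2 M ->
         is_iter_div U mu (hgrad dsign) k
           (fun p => evalQ (Q k 1%N) M dsign 0 p)).
Proof.
have [Q HQ] := divergence_polys_ex R.
have muc := left_invariant_cst mu_inv.
exists (fun k _ => Q k) => k; split=> [m m12 S eps _ _ tub U delta|S eps N subS ncS tub tsN U dsign M SM].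
  split=> [M M' SM SM' i p _ Up|M SM]; first exact: (unsigned_frame tub).
  exact: (@unsigned_div _ _ _ tub mu _ Q m k M muc m12 HQ SM).
exact: (@signed_div _ S eps N subS ncS tub tsN mu _ Q k M muc HQ SM).
Qed.
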